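(* Let $n\ge 1$, let $m_1,\dots,m_n$ be nonnegative integers, and let $a,b,c,d,e,f,z_1,\dots,z_n$ be nonzero complex numbers with $a^3q^2=bcdef$. Put $\lambda=a^2q/bcd$. Then $$\sum_{y_1=0}^{m_1}\cdots\sum_{y_n=0}^{m_n} \Bigg(\frac{\Delta(zq^y)}{\Delta(z)}\prod_{k=1}^n\frac{\theta(az_kq^{y_k+|y|})} {\theta(az_k)}\prod_{j=1}^n\frac{(az_j,d/z_j)_{|y|}(aq/z_j)_{|y|-y_j}} {(aq^{1+m_j}z_j,aq^{1-m_j}/z_j)_{|y|}(d/z_j)_{|y|-y_j}}$$ $$\times \prod_{j,k=1}^n\frac{(q^{-m_j}z_k/z_j,q^{m_j}z_jz_k)_{y_k}}{(qz_k/z_j, aqz_jz_k/d)_{y_k}}\prod_{1\leq j<k\leq n}\frac{(aqz_jz_k/d)_{y_j+y_k}} {(z_jz_k)_{y_j+y_k}} \prod_{k=1}^n \frac{(bz_k,cz_k)_{y_k}} {(aqz_k/e,aqz_k/f)_{y_k}}\cdot\frac{(e,f)_{|y|}}{(aq/b,aq/c)_{|y|}}\,q^{|y|}\Bigg)$$ $$=\prod_{k=1}^n\frac{(aqz_k,z_k/\lambda,\lambda qz_k/e,\lambda qz_k/f)_{m_k}} {(\lambda qz_k,z_k/a,aqz_k/e,aqz_k/f)_{m_k}}\sum_{y_1=0}^{m_1}\cdots\sum_{y_n=0}^{m_n} \Bigg(\frac{\Delta(zq^y)}{\Delta(z)}\prod_{k=1}^n\frac{\theta(\lambda z_kq^{y_k+|y|})}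 {\theta(\lambda z_k)}$$ $$\times\prod_{j=1}^n\frac{(\lambda z_j,\lambda d/az_j)_{|y|} (\lambda q/z_j)_{|y|-y_j}} {(\lambda q^{1+m_j}z_j,\lambda q^{1-m_j}/z_j)_{|y|}(\lambda d/az_j)_{|y|-y_j}} \prod_{j,k=1}^n\frac{(q^{-m_j}z_k/z_j,q^{m_j}z_jz_k)_{y_k}}{(qz_k/z_j, aqz_jz_k/d)_{y_k}}$$ $$\times\prod_{1\leq j<k\leq n}\frac{(aqz_jz_k/d)_{y_j+y_k}} {(z_jz_k)_{y_j+y_k}} \prod_{k=1}^n \frac{(\lambda bz_k/a,\lambda cz_k/a)_{y_k}} {(\lambda qz_k/e,\lambda qz_k/f)_{y_k}}\cdot\frac{(e,f)_{|y|}}{(aq/b,aq/c)_{|y|}} \,q^{|y|}\Bigg).$$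
   Context: Fix $p\in\mathbb C$ with $|p|<1$ and $q\in\mathbb C\setminus\{0\}$. For $x\neq 0$ put $\theta(x)=\prod_{j=0}^\infty(1-p^jx)(1-p^{j+1}/x)$ (so $\theta(x)=1-x$ when $p=0$). The elliptic Pochhammer symbol is $(a)_k=\theta(a)\theta(aq)\cdots\theta(aq^{k-1})$ for integers $k\ge 0$, with $(a)_0=1$, and $(a_1,\dots,a_r)_k=(a_1)_k\cdots(a_r)_k$. Everything after a slash is in the denominator, e.g. $\lambda d/az_j$ means $\lambda d/(az_j)$ and $a^2q/bcd$ means $a^2q/(bcd)$. For $z=(z_1,\dots,z_n)$, the elliptic Vandermonde determinant is $\Delta(z)=\prod_{1\le j<k\le n}z_j\,\theta(z_k/z_j)$, and $zq^y=(z_1q^{y_1},\dots,z_nq^{y_n})$, $|y|=y_1+\dots+y_n$. Standing assumption: all expressions are well-defined, i.e. the parameters are such that no denominator occurring on either side vanishes. *)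

(* Defs.v *)
From mathcomp Require Import all_boot all_order all_algebra.
From mathcomp Require Import all_classical all_reals all_analysis.
From mathcomp Require Import complex.

Set Implicit Arguments.
Unset Strict Implicit.
Unset Printing Implicit Defensive.

Import Order.TTheory GRing.Theory Num.Theory numFieldNormedType.Exports.

Local Open Scope classical_set_scope.
Local Open Scope ring_scope.

(* The limit is taken for the topology of the modulus on the complex numbers,
   which the library attaches to the regular module R[i]^o. The partial products
   converge when `|p| < 1 and x != 0; otherwise the value is unspecified.
   For p = 0 the factor j = 0 is 1 - x, since p ^+ 0 = 1, and all others are 1. *)
Definition theta (R : realType) (p x : R[i]) : R[i] :=
  lim ((fun N : nat =>
    \prod_(0 <= j < N) ((1 - p ^+ j * x) * (1 - p ^+ j.+1 / x)) : R[i]^o) @ \oo).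

Definition poch1 (R : realType) (p q a : R[i]) (k : nat) : R[i] :=
  \prod_(0 <= i < k) theta p (a * q ^+ i).

(* (a_1, ..., a_r)_k, with the list [:: a_1; ...; a_r] as argument *)
Definition poch (R : realType) (p q : R[i]) (s : seq R[i]) (k : nat) : R[i] :=
  \prod_(a <- s) poch1 p q a k.

Definition Vandermonde_ell (R : realType) (p : R[i]) (n : nat)
    (z : 'I_n -> R[i]) : R[i] :=
  \prod_(j < n) \prod_(k < n | (j < k)%N) (z j * theta p (z k / z j)).

(* Main.v *)
(* The multiple sum is first read as a sum over subsets.  Replace each z_k by the
   progression z_k, z_k q, ..., z_k q^(m_k - 1), with a bound 1 attached to every
   point: in the resulting sum over subsets S the term of S contains a factor
   theta(1) = 0 unless S meets every progression in an initial segment, and for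
   initial segments of lengths y_k the products telescope to the summand at y.

   For subset sums the Bailey argument applies.  The factors depending on b, c, d
   are expanded by one D_n Jackson summation, the sums are interchanged, and the
   inner sum is evaluated by another one.  Both Jackson summations are proved by
   elliptic interpolation: by the three-term relation for theta, a combination of
   n-fold products of theta(bx) theta(Cx/b) that vanishes at n + 1 generic values
   of b vanishes identically.  At n suitable values the identity reduces to the one
   with a point removed, and at one more value a single term survives.

   The three-term relation is a Pfaffian identity for the antisymmetric kernel
   k(x, y) = theta(xy) theta(x/y) / x.  The Laurent coefficients in x of its finite
   truncations satisfy c_(k+2) = p^(k+1) c_k up to O(p^N), so k is a limit of
   kernels of rank 2, its 3 x 3 determinants vanish, and so does the Pfaffian.

   The argument needs more denominators not to vanish than those of the statement.
   It is applied to parameters multiplied by powers of a real s > 1 outside a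
   countable set, and s tends to 1. *)
Require Import Defs.
From mathcomp Require Import all_boot all_order all_algebra.
From mathcomp Require Import ring lra zify.

Set Implicit Arguments.
Unset Strict Implicit.
Unset Printing Implicit Defensive.

Import GRing.Theory.
Local Open Scope ring_scope.

(** * Elliptic interpolation *)

Section Interpolation.
Variables (K : fieldType) (th : K -> K).

(** The identities over subsets are proved for any function [th] on a field with [th 1 = 0],
    inversion and the three-term relation. Neither quasi-periodicity nor holomorphy enters there, so
    p = 0 is not a special case; theta is used otherwise only through its continuity and the
    location of its zeros. The classical proof of the three-term relation compares zeros and applies
    Liouville's theorem. Here quasi-periodicity is replaced by an exact relation between finite
    products, and the rank 2 comes from the two free starting values of a recursion of step 2.
    Dividing by powers of p forces p to be nonzero in this part; for p = 0 the relation is a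
    polynomial identity. Bailey's argument works because lam = a^2 q / (b c d) makes the factor in
    b, c, d at a the closed form of a sum at lam, while e f = lam a q makes the remaining sum, over
    the complement, a Jackson sum with e and f as a symmetric pair. The perturbation scales all z_k
    alike and keeps p and q, so it cannot make a theta at q^i z_k / z_j nonzero. Exactly these
    quantities are controlled by the denominators of the theorem itself. *)

Definition th_inversion := forall x : K, x != 0 -> th x^-1 = - x^-1 * th x.

(** Unchanged when b is replaced by C / b: the analogue of a linear factor in b + C / b, with a root
    at b = 1 / x. *)
Definition hpair (C b x : K) : K := th (b * x) * th (C * x / b).

(** Weierstrass's addition formula, arranged as a linear dependence between three functions
    [hpair C b] of b. *)
Definition th_three_term := forall C b x u v : K,
  C != 0 -> b != 0 -> x != 0 -> u != 0 -> v != 0 ->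
  hpair C b x * (th (C * u * v) * th (u / v))
  - hpair C b u * (th (C * x * v) * th (x / v))
  + u / v * hpair C b v * (th (C * x * u) * th (x / u)) = 0.

(* The functions of b != 0 spanned by n-fold products of hpair C b x, which play
   the role of the polynomials of degree at most n. *)
Inductive hspan (C : K) : nat -> (K -> K) -> Prop :=
| hspan_const (c : K) (F : K -> K) : (forall b : K, b != 0 -> F b = c) -> hspan C 0 F
| hspan_mul n (x : K) (G F : K -> K) : x != 0 -> hspan C n G ->
    (forall b : K, b != 0 -> F b = hpair C b x * G b) -> hspan C n.+1 F
| hspan_add n (G H F : K -> K) : hspan C n G -> hspan C n H ->
    (forall b : K, b != 0 -> F b = G b + H b) -> hspan C n F.

Hypothesis th1 : th 1 = 0.
Hypothesis thV : th_inversion.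
Hypothesis thW : th_three_term.
Variable C : K.
Hypothesis C0 : C != 0.

Lemma hspan_ext n F G : (forall b : K, b != 0 -> F b = G b) ->
  hspan C n G -> hspan C n F.
Proof.
move=> FG HG; elim: HG F FG => {n G}.
- by move=> c G Gc F FG; apply: (@hspan_const C c) => b b0; rewrite FG // Gc.
- move=> n x G H x0 HG _ HE F FG; apply: (hspan_mul x0 HG) => b b0.
  by rewrite FG // HE.
- move=> n G H E HG _ HH _ EE F FG; apply: (hspan_add HG HH) => b b0.
  by rewrite FG // EE.
Qed.

Lemma hspan_scale n c F : hspan C n F -> hspan C n (fun b => c * F b).
Proof.
elim=> {n F}.
- by move=> c' F Fc; apply: (@hspan_const C (c * c')) => b b0; rewrite Fc.
- move=> n x G F x0 _ IH FE; apply: (hspan_mul x0 IH) => b b0.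
  by rewrite FE // mulrCA.
- move=> n G H F _ IG _ IH FE; apply: (hspan_add IG IH) => b b0.
  by rewrite FE // mulrDr.
Qed.

Lemma hspan_zero n : hspan C n (fun=> 0).
Proof.
elim: n => [|n IH]; first by apply: (@hspan_const C 0).
by apply: (hspan_mul (oner_neq0 K) IH) => b _; rewrite mulr0.
Qed.

Lemma hspan_sum (I : finType) (P : pred I) n (F : I -> K -> K) :
  (forall i, P i -> hspan C n (F i)) ->
  hspan C n (fun b => \sum_(i | P i) F i b).
Proof.
move=> HF.
have: forall s : seq I, hspan C n (fun b => \sum_(i <- s | P i) F i b); last exact.
elim=> [|i s IH].
  by apply: hspan_ext (hspan_zero n) => b _; rewrite big_nil.
case Pi: (P i); last by apply: hspan_ext IH => b _; rewrite big_cons Pi.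
by apply: (hspan_add (HF _ Pi) IH) => b _; rewrite big_cons Pi.
Qed.

Lemma hspan_prod (I : Type) (s : seq I) (P : pred I) (x : I -> K) n F :
  (forall i, P i -> x i != 0) -> hspan C n F ->
  hspan C (count P s + n) (fun b => \prod_(i <- s | P i) hpair C b (x i) * F b).
Proof.
move=> x0 HF; elim: s => [|i s IH].
  by apply: hspan_ext HF => b _; rewrite big_nil mul1r.
rewrite /=; case Pi: (P i); last first.
  by apply: hspan_ext IH => b _; rewrite big_cons Pi.
by apply: (hspan_mul (x0 _ Pi) IH) => b _; rewrite big_cons Pi mulrA.
Qed.

Lemma hspan0_const F : hspan C 0 F ->
  forall b b' : K, b != 0 -> b' != 0 -> F b = F b'.
Proof.
move: {-2}0%N (erefl 0%N) => n n0 HF; elim: HF n0 => {n F} //.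
  by move=> c F Fc _ b b' b0 b0'; rewrite !Fc.
move=> n G H F _ IG _ IH FE n0 b b' b0 b0'.
by rewrite !FE // (IG n0 b b') // (IH n0 b b').
Qed.

(** In the three-term relation with u = 1 / b0 and v = 1 / b1 the coefficient of [hpair C b x] is
    [hpair C b0 b1^-1] up to a unit. When it is nonzero, the functions attached to these two nodes
    span all the others. *)
Lemma hpair_expand (b0 b1 : K) : b0 != 0 -> b1 != 0 -> hpair C b0 b1^-1 != 0 ->
  forall x : K, x != 0 -> exists u v, forall b : K, b != 0 ->
    hpair C b x = u * hpair C b b0^-1 + v * hpair C b b1^-1.
Proof.
move=> b00 b10 h01 x x0.
pose D := th (C * b0^-1 * b1^-1) * th (b0^-1 / b1^-1).
have D0 : D != 0.
  move: h01; rewrite /hpair /D.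
  have -> : C / b1 / b0 = C * b0^-1 * b1^-1 by rewrite mulrAC.
  have -> : b0^-1 / b1^-1 = (b0 / b1)^-1 by rewrite invfM.
  rewrite thV; last by rewrite mulf_neq0 ?invr_eq0.
  rewrite !mulf_eq0 !oppr_eq0 !invr_eq0 !mulf_eq0 !invr_eq0.
  by rewrite (negbTE b00) (negbTE b10) /= orbC.
exists ((th (C * x / b1) * th (x / b1^-1)) / D),
  (- (b0^-1 / b1^-1 * (th (C * x / b0) * th (x / b0^-1))) / D) => b bn0.
have := thW C0 bn0 x0 (invr_neq0 b00) (invr_neq0 b10); rewrite -/D => E.
apply: (mulIf D0); rewrite mulrDl.
rewrite [_ / D * _ * D]mulrAC [_ / D * D]divfK //.
rewrite [_ / D * _ * D]mulrAC [_ / D * D]divfK //.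
by apply/eqP; rewrite -subr_eq0 -E; apply/eqP; ring.
Qed.

(** The analogue of division by b - b0: once every factor is written in terms of the nodes b0 and
    b1, all products but the pure power of the second contain the factor that vanishes at b0. *)
Lemma hspan_split (b0 b1 : K) n F :
  b0 != 0 -> b1 != 0 -> hpair C b0 b1^-1 != 0 -> hspan C n.+1 F ->
  exists G m, hspan C n G /\ forall b : K, b != 0 ->
    F b = hpair C b b0^-1 * G b + m * hpair C b b1^-1 ^+ n.+1.
Proof.
move=> b00 b10 h01.
move: {-2}n.+1 (erefl n.+1) => k kn HF; elim: HF n kn => {k F} //.
- move=> k x G F x0 HG IH FE n [kn]; subst k.
  have [u [v E]] := hpair_expand b00 b10 h01 x0.
  case: n HG IH => [|n] HG IH.
    (* In degree 0 the cofactor is constant, so its value at 1 may stand for it everywhere. *)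
    exists (fun b => u * G b), (v * G 1); split; first exact: hspan_scale.
    move=> b bn0; rewrite FE // E // expr1.
    rewrite (hspan0_const HG (oner_neq0 K) bn0). ring.
  have [G' [m [HG' GE]]] := IH _ (erefl _).
  exists (fun b => u * G b + hpair C b b1^-1 * (v * G' b)), (v * m); split.
    apply: (hspan_add (hspan_scale u HG)); last by move=> b _; reflexivity.
    by apply: (hspan_mul (invr_neq0 b10) (hspan_scale v HG')) => b _.
  move=> b bn0; rewrite FE // E // mulrDl [in v * _ * G b]GE // [_ ^+ n.+2]exprS.
  move: (_ ^+ n.+1) => W; ring.
- move=> k G H F HG IG HH IH FE n kn.
  have [G1 [m1 [HG1 E1]]] := IG _ kn; have [G2 [m2 [HG2 E2]]] := IH _ kn.
  exists (fun b => G1 b + G2 b), (m1 + m2); split.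
    by apply: (hspan_add HG1 HG2).
  by move=> b bn0; rewrite FE // E1 // E2 //; ring.
Qed.

Lemma hpair_diag (b : K) : b != 0 -> hpair C b b^-1 = 0.
Proof. by move=> b0; rewrite /hpair divff // th1 mul0r. Qed.

Lemma hpair_sym (b b' : K) : b != 0 -> b' != 0 ->
  hpair C b b'^-1 != 0 -> hpair C b' b^-1 != 0.
Proof.
move=> b0 b0'; rewrite /hpair => h.
have -> : b' / b = (b / b')^-1 by rewrite invf_div.
rewrite thV; last by rewrite mulf_neq0 ?invr_eq0.
have -> : C / b / b' = C / b' / b by rewrite mulrAC.
move: h; rewrite !mulf_eq0 !oppr_eq0 !invr_eq0 !mulf_eq0 !invr_eq0.
by rewrite (negbTE b0) (negbTE b0').
Qed.

(** The nodes are divided off one at a time, as for a polynomial of degree n with n + 1 roots. The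
    pairwise condition plays the role of distinctness: it separates the nodes modulo b -> C / b and
    the zeros of [th]. *)
Lemma hspan_eq0 n F (s : seq K) : hspan C n F -> size s = n.+1 ->
  all (fun b : K => b != 0) s -> pairwise (fun b b' => hpair C b b'^-1 != 0) s ->
  (forall b, b \in s -> F b = 0) -> forall b : K, b != 0 -> F b = 0.
Proof.
elim: n F s => [|n IH] F [|b0 s] // HF [sz].
  move=> /= /andP[b00 _] _ F0 b bn0.
  by rewrite (hspan0_const HF bn0 b00) F0 // mem_head.
case: s sz => [|b1 s] // [sz] /andP[b00 /andP[b10 sn0]] /= /andP[/andP[h01 h0s] hs] F0.
have [G [m [HG FE]]] := hspan_split b00 b10 h01 HF.
have m0 : m = 0.
  have := F0 b0 (mem_head _ _); rewrite FE // hpair_diag // mul0r add0r.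
  by move=> /eqP; rewrite mulf_eq0 expf_eq0 (negbTE h01) andbF orbF => /eqP.
have Gz : forall b : K, b != 0 -> G b = 0.
  apply: (IH G (b1 :: s)) => //=; first by rewrite sz.
  - by rewrite b10.
  - move=> b bs.
    have b0s : hpair C b0 b^-1 != 0.
      by move: bs; rewrite inE => /orP[/eqP->|bs] //; apply: (allP h0s).
    have bn0 : b != 0.
      by move: bs; rewrite inE => /orP[/eqP-> //|bs]; apply: (allP sn0).
    have := F0 b; rewrite inE bs orbT => /(_ isT).
    rewrite FE // m0 mul0r addr0 => /eqP; rewrite mulf_eq0.
    by rewrite (negbTE (hpair_sym b00 bn0 b0s)) => /eqP.
by move=> b bn0; rewrite FE // Gz // m0 mulr0 mul0r addr0.
Qed.

End Interpolation.

Ltac nonzero :=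
  repeat first
    [ assumption | exact: oner_neq0
    | match goal with
      | |- is_true (_ && _) => apply/andP; split
      | |- is_true (_ * _ != 0) => apply: mulf_neq0
      | |- is_true (_^-1 != 0) => rewrite invr_eq0
      | |- is_true (- _ != 0) => rewrite oppr_eq0
      | |- is_true (_ ^+ _ != 0) => apply: expf_neq0
      | H : _ |- _ => apply: H
      end ].

(** * Jackson and Bailey identities for sums over subsets *)

Section SubsetSums.
Variables (K : fieldType) (th : K -> K) (q : K).
Hypothesis th1 : th 1 = 0.
Hypothesis thV : th_inversion th.
Hypothesis thW : th_three_term th.
Hypothesis q0 : q != 0.

Lemma th_flip x y : x != 0 -> y != 0 -> th (x / y) = - (x / y) * th (y / x).
Proof.
move=> x0 y0; have -> : y / x = (x / y)^-1 by rewrite invf_div.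
have xy0 : x / y != 0 by nonzero.
by rewrite thV // !mulNr mulrN opprK mulrA divff // mul1r.
Qed.

Definition pc (x : K) (n : nat) : K := \prod_(0 <= i < n) th (x * q ^+ i).

Lemma pcS x n : pc x n.+1 = pc x n * th (x * q ^+ n).
Proof. by rewrite /pc big_nat_recr. Qed.

Lemma pcSl x n : pc x n.+1 = th x * pc (x * q) n.
Proof.
rewrite /pc big_nat_recl // expr0 mulr1; congr (_ * _).
by apply: eq_bigr => i _; rewrite exprS mulrA.
Qed.

Lemma sqr_pow_bin n :
  q ^+ 'C(n, 2) * q ^+ 'C(n, 2) * q ^+ n = (q ^+ n) ^+ n.
Proof.
rewrite -exprM -!exprD; congr (_ ^+ _).
by elim: n => // n IH; rewrite binS bin1 mulSn mulnS -IH; lia.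
Qed.

Variables (I : finType) (r : rel I).
Hypothesis r_irr : irreflexive r.
Hypothesis r_total : forall j k, j != k -> r j k = ~~ r k j.
Variable z : I -> K.
Hypothesis z0 : forall k, z k != 0.

(** The order [r] only selects one representative of each unordered pair; the intended F are
    symmetric. *)
Definition pairs (F : I -> I -> K) (A : {set I}) : K :=
  \prod_(j in A) \prod_(k in A | r j k) F j k.

Lemma pairsU1 F (l : I) (A : {set I}) : (forall j k, F j k = F k j) ->
  l \notin A -> pairs F (l |: A) = (\prod_(k in A) F l k) * pairs F A.
Proof.
move=> Fs lA; rewrite /pairs big_setU1 //=.
rewrite [X in _ = X * _](bigID (r l)) /= -mulrA; congr (_ * _).
  apply: eq_bigl => k; rewrite in_setU1.
  by case: eqP => [->|_] //=; rewrite r_irr andbF.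
have -> : \prod_(k in A | ~~ r l k) F l k
        = \prod_(j in A) (if r j l then F j l else 1).
  rewrite big_mkcondr /=; apply: eq_bigr => j jA.
  have jl : j != l by apply: contraNneq lA => <-.
  by rewrite (r_total jl) Fs.
rewrite -big_split /=; apply: eq_bigr => j jA.
rewrite [LHS]big_mkcondr /= big_setU1 //=; congr (_ * _).
by rewrite big_mkcondr.
Qed.

Lemma pairsD1 F (l : I) (A : {set I}) : (forall j k, F j k = F k j) ->
  l \in A -> pairs F A = (\prod_(k in A :\ l) F l k) * pairs F (A :\ l).
Proof.
by move=> Fs lA; rewrite -[in LHS](setD1K lA) pairsU1 // setD11.
Qed.

(** It vanishes as soon as z k = q * z j with k in S and j in A outside S, because [th 1 = 0]. This
    is what later selects the initial segments of progressions. *)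
Definition mixed (A S : {set I}) : K :=
  \prod_(k in S) \prod_(j in A :\: S) (th (z k / (q * z j)) / th (z k / z j)).

Definition ratio (t : K) (j k : I) : K :=
  th (t * q * z j * z k) / th (t * z j * z k).

Lemma ratioC t j k : ratio t j k = ratio t k j.
Proof. by rewrite /ratio -!mulrA [z j * _]mulrC. Qed.

(* jackson2 is the D_n Jackson summation with all m_k = 1, as an identity between
   functions of b in hspan (jC #|A|) #|A|; the nodes are the 1 / z_l, where the
   identity reduces to the one for A :\ l, and a * q ^+ #|A|. *)
Section JacksonII.
Variables a c d : K.
Hypothesis a0 : a != 0.
Hypothesis c0 : c != 0.
Hypothesis d0 : d != 0.

Definition jC n : K := a ^+ 2 * q ^+ n.+1 / (c * d).

Definition jcoef (A S : {set I}) : K :=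
  let N := #|S| in
  (-1) ^+ N / q ^+ 'C(N, 2) * mixed A S * pairs (ratio (a * q / d)) S
  * \prod_(k in S) (th (d * q ^+ N / (q * z k)) * th (c * z k)
      / (th (a * q / d * z k * z k) * th (a * z k * q ^+ N)))
  * \prod_(k in A :\: S) (th (a * z k * q ^+ N.+1))^-1
  / pc (a * q / c) N.

(** The second product fills the degree up to #|A|. Its last factor vanishes at b = a * q ^+ #|A|,
    so that at this node only S = A survives. *)
Definition jspan (A S : {set I}) (b : K) : K :=
  \prod_(k in S) hpair th (jC #|A|) b (z k)
  * \prod_(#|S| <= i < #|A|) hpair th (jC #|A|) b (a * q ^+ i.+1 / jC #|A|).

Definition jrhs (A : {set I}) (b : K) : K :=
  d ^+ #|A| * q ^+ 'C(#|A|, 2) * pairs (ratio (a * q / d)) A / pc (a * q / c) #|A|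
  * \prod_(k in A) (th (a * q * z k / (c * d)) / (z k * th (a * q / d * z k * z k)))
  * \prod_(k in A) hpair th (jC #|A|) b (a * q * z k / (d * jC #|A|)).

Hypothesis gen_zz : forall j k, j != k -> th (z j / z k) != 0.
Hypothesis gen_az : forall k (i : nat), th (a * z k * q ^+ i) != 0.
Hypothesis gen_ac : forall i : nat, th (a / c * q ^+ i) != 0.
Hypothesis gen_t : forall j k, th (a * q / d * z j * z k) != 0.
Hypothesis gen_C : forall j k (i : nat),
  th (a ^+ 2 / (c * d) * z j * z k * q ^+ i) != 0.
Hypothesis gen_acd : forall k, th (a * q / (c * d) * z k) != 0.

Lemma jC0 n : jC n != 0. Proof. by rewrite /jC; nonzero. Qed.

Lemma jCS n : jC n.+1 = q * jC n.
Proof. by rewrite /jC [q ^+ _]exprS; ring. Qed.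

Lemma jspan_hspan (A S : {set I}) : S \subset A ->
  hspan th (jC #|A|) #|A| (jspan A S).
Proof.
move=> SA; have leSA := subset_leq_card SA.
have H1 : hspan th (jC #|A|) (#|A| - #|S|)
  (fun b => \prod_(#|S| <= i < #|A|) hpair th (jC #|A|) b (a * q ^+ i.+1 / jC #|A|)).
  have := @hspan_prod K th (jC #|A|) nat (index_iota #|S| #|A|) xpredT
    (fun i => a * q ^+ i.+1 / jC #|A|) 0 (fun=> 1).
  rewrite count_predT size_iota addn0 => H.
  apply: hspan_ext (H _ _); first by move=> b _; rewrite mulr1.
    by move=> i _; have HC := jC0 #|A|; nonzero.
  by apply: (@hspan_const _ _ _ 1).
have := @hspan_prod K th (jC #|A|) I (index_enum I) (mem S) z _ _ (fun k _ => z0 k) H1.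
by rewrite -sum1_count sum1_card subnKC.
Qed.

Lemma jrhs_hspan (A : {set I}) : hspan th (jC #|A|) #|A| (jrhs A).
Proof.
rewrite /jrhs; apply: hspan_scale.
have := @hspan_prod K th (jC #|A|) I (index_enum I) (mem A)
  (fun k => a * q * z k / (d * jC #|A|)) 0 (fun=> 1).
rewrite -sum1_count sum1_card addn0 => H.
apply: hspan_ext (H _ _); first by move=> b _; rewrite mulr1.
  by move=> i _; have HC := jC0 #|A|; nonzero.
by apply: (@hspan_const _ _ _ 1).
Qed.

(** As jC n.+1 = q * jC n, going from b = 1 / z l for A to b = 1 / (q z l) for A :\ l keeps the
    second theta of each [hpair] over S and turns th (z k / z l) into th (z k / (q z l)). The
    quotient is the factor of [mixed] that disappears with l. The constant in front does not depend
    on S. *)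
Lemma jackson2_step_lhs (A S : {set I}) l : l \in A -> S \subset A :\ l ->
  jcoef A S * jspan A S (z l)^-1
  = th (c * d / (a * q * z l))
    * (jcoef (A :\ l) S * jspan (A :\ l) S (q * z l)^-1).
Proof.
move=> lA SA'; have HC := jC0.
have lS : l \notin S by apply: (contra (subsetP SA' l)); rewrite setD11.
have cardA : #|A| = (#|A :\ l|).+1 by rewrite (cardsD1 l) lA.
have leS := subset_leq_card SA'.
have AS : A :\: S = l |: (A :\ l) :\: S.
  by apply/setP => x; rewrite !inE; case: eqP => [->|] //=; rewrite lA lS.
have lAS : l \notin (A :\ l) :\: S by rewrite !inE eqxx andbF.
set A' := A :\ l in AS lAS cardA leS *; set n := #|A'| in cardA leS *.
have zlS k : k \in S -> k != l by move=> kS; apply: contraNneq lS => <-.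
have Em : mixed A S * \prod_(k in S) hpair th (jC #|A|) (z l)^-1 (z k)
   = mixed A' S * \prod_(k in S) hpair th (jC n) (q * z l)^-1 (z k).
  rewrite /mixed -!big_split /=; apply: eq_bigr => k kS.
  rewrite AS big_setU1 //= -mulrA mulrCA; congr (_ * _).
  have H := gen_zz (zlS _ kS).
  rewrite /hpair [_^-1 * z k]mulrC mulrA divfK // [_^-1 * z k]mulrC; congr (_ * th _).
  by rewrite cardA jCS !invrK; ring.
have Ep : (\prod_(k in A :\: S) (th (a * z k * q ^+ #|S|.+1))^-1)
     * \prod_(#|S| <= i < #|A|) hpair th (jC #|A|) (z l)^-1 (a * q ^+ i.+1 / jC #|A|)
  = th (c * d / (a * q * z l)) * ((\prod_(k in A' :\: S) (th (a * z k * q ^+ #|S|.+1))^-1)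
     * \prod_(#|S| <= i < n) hpair th (jC n) (q * z l)^-1 (a * q ^+ i.+1 / jC n)).
  rewrite AS big_setU1 //= cardA /hpair.
  have -> : \prod_(#|S| <= i < n.+1) (th ((z l)^-1 * (a * q ^+ i.+1 / jC n.+1)) *
      th (jC n.+1 * (a * q ^+ i.+1 / jC n.+1) / (z l)^-1))
    = (\prod_(#|S| <= i < n.+1) th (a * z l * q ^+ i.+1))
      * (\prod_(#|S| <= i < n.+1) th ((z l)^-1 * (a * q ^+ i.+1 / jC n.+1))).
    rewrite -big_split /=; apply: eq_bigr => i _; rewrite mulrC; congr (th _ * _).
    by field; nonzero.
  have -> : \prod_(#|S| <= i < n) (th ((q * z l)^-1 * (a * q ^+ i.+1 / jC n)) *
      th (jC n * (a * q ^+ i.+1 / jC n) / (q * z l)^-1))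
    = (\prod_(#|S| <= i < n) th (a * z l * q ^+ i.+2))
      * (\prod_(#|S| <= i < n) th ((z l)^-1 * (a * q ^+ i.+1 / jC n.+1))).
    rewrite -big_split /=; apply: eq_bigr => i _; rewrite mulrC; congr (th _ * th _).
      by rewrite [in RHS]exprS; field; nonzero.
    by rewrite jCS; move: (jC n) (jC0 n) => X X0; field; nonzero.
  (* The first factor of one run cancels the theta of the point l, which lies outside S; the last
     factor of the other run is the constant in front. *)
  rewrite big_nat_recl // [\prod_(#|S| <= i < n.+1) _]big_nat_recr //=.
  have -> : (z l)^-1 * (a * q ^+ n.+1 / jC n.+1) = c * d / (a * q * z l).
    by rewrite /jC [q ^+ n.+2]exprS; field; nonzero.
  by field; nonzero.
rewrite /jcoef /jspan -/A' -/n.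
transitivity ((-1) ^+ #|S| / q ^+ 'C(#|S|, 2) * pairs (ratio (a * q / d)) S
  * \prod_(k in S) (th (d * q ^+ #|S| / (q * z k)) * th (c * z k)
      / (th (a * q / d * z k * z k) * th (a * z k * q ^+ #|S|)))
  / pc (a * q / c) #|S| * (mixed A S * \prod_(k in S) hpair th (jC #|A|) (z l)^-1 (z k))
  * ((\prod_(k in A :\: S) (th (a * z k * q ^+ #|S|.+1))^-1)
     * \prod_(#|S| <= i < #|A|) hpair th (jC #|A|) (z l)^-1 (a * q ^+ i.+1 / jC #|A|))).
  by move: (_ / _) (pc _ _)^-1 => X Y; ring.
rewrite Em Ep; move: (_ / _) (pc _ _)^-1 => X Y; ring.
Qed.

Lemma jackson2_step_rhs (A : {set I}) l : l \in A ->
  jrhs A (z l)^-1 = th (c * d / (a * q * z l)) * jrhs (A :\ l) (q * z l)^-1.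
Proof.
move=> lA; have HC := jC0.
have cardA : #|A| = (#|A :\ l|).+1 by rewrite (cardsD1 l) lA.
rewrite /jrhs (pairsD1 (ratioC _) lA) cardA.
set A' := A :\ l; set n := #|A'|.
rewrite !(big_setD1 l lA) /= -/A' binS bin1 jCS pcS.
have E : \prod_(k in A') ratio (a * q / d) l k
    * \prod_(k in A') hpair th (q * jC n) (z l)^-1 (a * q * z k / (d * (q * jC n)))
  = \prod_(k in A') hpair th (jC n) (q * z l)^-1 (a * q * z k / (d * jC n)).
  rewrite -big_split /=; apply: eq_bigr => k _.
  rewrite /ratio /hpair.
  have -> : q * jC n * (a * q * z k / (d * (q * jC n))) / (z l)^-1
     = a * q / d * z l * z k by field; nonzero.
  rewrite mulrCA divfK //; congr (_ * _); congr th; field; nonzero.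
set P2 := \prod_(k in A') ratio _ _ _ in E *; set P3 := \prod_(k in A') hpair _ _ _ _ in E *.
rewrite -E /hpair.
have -> : q * jC n * (a * q * z l / (d * (q * jC n))) / (z l)^-1
     = a * q / d * z l * z l by field; nonzero.
have -> : (z l)^-1 * (a * q * z l / (d * (q * jC n))) = c / (a * q / c * q ^+ n * c).
  by rewrite /jC [q ^+ n.+1]exprS; field; nonzero.
have -> : th (c / (a * q / c * q ^+ n * c))
    = - (c / (a * q ^+ n.+1)) * th (a * q / c * q ^+ n).
  rewrite th_flip //; last by nonzero.
  congr (- _ * th _); last by field; nonzero.
  by rewrite exprS; field; nonzero.
have -> : th (c * d / (a * q * z l)) = - (c * d / (a * q * z l)) * th (a * q * z l / (c * d)).
  by rewrite th_flip //; nonzero.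
have gac : th (a * q / c * q ^+ n) != 0.
  have := gen_ac n.+1; suff -> : a / c * q ^+ n.+1 = a * q / c * q ^+ n by [].
  by rewrite exprS; field; nonzero.
rewrite [d ^+ _]exprS exprD [q ^+ n.+1]exprS [(pc _ _ * _)^-1]invfM.
move: (pairs _ _) (d ^+ n) (pc _ _)^-1 (q ^+ 'C(n, 2)) => X1 X2 X3 X4.
move: (q ^+ n) (expf_neq0 n q0) gac => Q Q0 gac.
field; nonzero.
Qed.

(** The thetas match factor by factor after one inversion for each k, which costs -q / (d q^n). The
    n-th power of this has q-exponent n - n^2 = -2 C(n, 2), and so turns the d^n q^C(n, 2) of [jrhs]
    into the sign and the power of [jcoef]. *)
Lemma jackson2_top (A : {set I}) :
  jcoef A A * jspan A A (a * q ^+ #|A|) = jrhs A (a * q ^+ #|A|).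
Proof.
have HC := jC0.
rewrite /jcoef /jspan /jrhs /mixed setDv big_geq // big_set0 mulr1.
rewrite big1 ?mulr1; last by move=> k _; rewrite big_set0.
set n := #|A|.
have E : \prod_(k in A) (th (a * q * z k / (c * d)) / (z k * th (a * q / d * z k * z k))) *
   \prod_(k in A) hpair th (jC n) (a * q ^+ n) (a * q * z k / (d * jC n))
 = (- (q / (d * q ^+ n))) ^+ n * (\prod_(k in A)
   (th (d * q ^+ n / (q * z k)) * th (c * z k) /
    (th (a * q / d * z k * z k) * th (a * z k * q ^+ n)))
   * \prod_(k in A) hpair th (jC n) (a * q ^+ n) (z k)).
  rewrite -[(- _) ^+ n](prodr_const (mem A)) -!big_split /=; apply: eq_bigr => k _.
  rewrite /hpair.
  have -> : jC n * z k / (a * q ^+ n) = a * q * z k / (c * d).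
    by rewrite /jC [q ^+ _.+1]exprS; field; nonzero.
  have -> : a * q ^+ n * (a * q * z k / (d * jC n)) = c * z k.
    by rewrite /jC [q ^+ n.+1]exprS; field; nonzero.
  have -> : jC n * (a * q * z k / (d * jC n)) / (a * q ^+ n) = q * z k / (d * q ^+ n).
    by field; nonzero.
  rewrite [th (q * z k / _)]th_flip; [|nonzero|nonzero].
  have -> : a * q ^+ n * z k = a * z k * q ^+ n by ring.
  have Q0 := expf_neq0 n q0; have H1 := gen_az k n; have H2 := gen_t k k.
  move: (th _) H2 (th _) H1 => X X0 Y Y0.
  by move: (th _) (th _) (th _) => X1 X2 X3; field; nonzero.
rewrite -[RHS]mulrA E [(- (q / _)) ^+ _]exprNn expr_div_n exprMn -sqr_pow_bin.
have Q0 := expf_neq0 n q0; have QC0 := expf_neq0 'C(n, 2) q0.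
have D0 := expf_neq0 n d0.
move: (pc _ _)^-1 => X.
field; nonzero.
Qed.

Lemma jackson2 (A : {set I}) (b : K) : b != 0 ->
  \sum_(S : {set I} | S \subset A) jcoef A S * jspan A S b = jrhs A b.
Proof.
have [n] := ubnP #|A|; elim: n => // n IH in A b * => ltAn b0.
have HC := jC0.
pose F b := \sum_(S : {set I} | S \subset A) jcoef A S * jspan A S b + (-1) * jrhs A b.
have HF : hspan th (jC #|A|) #|A| F.
  apply: (hspan_add _ (hspan_scale (-1) (jrhs_hspan A))); last by move=> ? _.
  by apply: hspan_sum => S SA; apply/hspan_scale/jspan_hspan.
suff: F b = 0.
  by move=> /eqP; rewrite /F mulN1r subr_eq0 => /eqP.
pose s := a * q ^+ #|A| :: [seq (z k)^-1 | k <- enum A].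
apply: (hspan_eq0 th1 thV thW (HC _) HF (s := s)) => //.
- by rewrite /= size_map -cardE.
- rewrite /s /=; apply/andP; split; first by nonzero.
  by apply/allP => x /mapP[k _ ->]; nonzero.
- rewrite /s /=; apply/andP; split.
    apply/allP => x /mapP[k _ ->]; rewrite /hpair invrK.
    have -> : jC #|A| * z k / (a * q ^+ #|A|) = a * q / (c * d) * z k.
      by rewrite /jC [q ^+ _.+1]exprS; field; nonzero.
    have -> : a * q ^+ #|A| * z k = a * z k * q ^+ #|A| by ring.
    by nonzero.
  rewrite pairwise_map.
  apply: sub_pairwise (_ : pairwise (fun x y => x != y) (enum A)).
    move=> j k /= jk; rewrite /hpair !invrK [_ * z k]mulrC.
    have -> : jC #|A| * z k * z j = a ^+ 2 / (c * d) * z j * z k * q ^+ #|A|.+1.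
      by rewrite /jC; field; nonzero.
    by apply: mulf_neq0; [apply: gen_zz; rewrite eq_sym|].
  by rewrite -uniq_pairwise enum_uniq.
move=> x; rewrite inE => /orP[/eqP->|/mapP[l]].
  rewrite /F (bigD1 A) //= big1 ?addr0; first by rewrite jackson2_top mulN1r subrr.
  move=> S /andP[SA SnA].
  have ltSA : (#|S| < #|A|)%N by apply: proper_card; rewrite properEneq SnA.
  suff -> : jspan A S (a * q ^+ #|A|) = 0 by rewrite mulr0.
  rewrite /jspan; case: #|A| ltSA => // m Sm.
  rewrite big_nat_recr //= /hpair.
  have -> : jC m.+1 * (a * q ^+ m.+1 / jC m.+1) / (a * q ^+ m.+1) = 1.
    by have H := expf_neq0 m.+1 q0; field; nonzero.
  by rewrite th1 !mulr0.
rewrite mem_enum => lA ->.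
have lt' : (#|A :\ l| < n)%N by move: ltAn; rewrite (cardsD1 l A) lA.
rewrite /F jackson2_step_rhs // -(IH _ _ lt'); last by nonzero.
(* At b = 1 / z l every term with l in S contains [th 1]; the other terms form the sum for A :\
   l. *)
rewrite (bigID (fun S : {set I} => l \in S)) /= big1 ?add0r.
  rewrite mulN1r mulr_sumr; apply/eqP; rewrite subr_eq0; apply/eqP.
  apply: eq_big => [S|S /andP[SA lS]]; first by rewrite subsetD1.
  by rewrite jackson2_step_lhs // subsetD1 SA.
move=> S /andP[SA lS]; rewrite /jspan (bigD1 l) //= {1}/hpair mulVf // th1.
by rewrite !mul0r mulr0.
Qed.

End JacksonII.

(* jackson1 is likewise an identity between functions of e; its nodes are 1, where
   only U = set0 contributes, and the a * q * z l, which reduce it to A :\ l with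
   a and g multiplied by q. *)
Definition kC (a g : K) : K := a ^+ 2 * q / g.

Definition kcoef (a g : K) (A U : {set I}) : K :=
  let N := #|U| in
  (-1) ^+ N / q ^+ 'C(N, 2) * mixed A U
  * (pairs (ratio 1) A / pairs (ratio 1) (A :\: U))
  * \prod_(k in U) (th (q * z k * z k) / (th (a * z k * q ^+ N) * th (a * q * z k / g)))
  * \prod_(k in A :\: U) (th (a * q ^+ N / z k) / th (a * z k * q ^+ N.+1))
  * pc g N.

(** With f = kC a g / e each factor is th (e x) th (f x), so e and f enter symmetrically. If U is
    nonempty the factor i = 0 vanishes at e = 1; if l is in A but not in U the factor of l vanishes
    at e = a q z l. *)
Definition kspan (a g : K) (A U : {set I}) (e : K) : K :=
  \prod_(k in A :\: U) hpair th (kC a g) e (g * z k / a)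
  * \prod_(0 <= i < #|U|) hpair th (kC a g) e (q ^+ i).

Definition krhs (a g : K) (A : {set I}) (e : K) : K :=
  \prod_(k in A) (- (a / z k) * (th (g * z k / a) / th (a * q * z k / g)))
  * \prod_(k in A) hpair th (kC a g) e (z k / a).

(** Stable under the shift of (a, g) to (a q, g q) made by the induction, hence the powers of q
    wherever this shift moves the argument. *)
Definition kgen (a g : K) : Prop :=
  [/\ forall k i, th (a * z k * q ^+ i) != 0,
      forall k, th (a * q * z k / g) != 0,
      forall k, th (g * z k / a) != 0
    & forall j k i, th (g * z j * z k * q ^+ i) != 0].

Lemma kgenS a g : a != 0 -> g != 0 -> kgen a g -> kgen (a * q) (g * q).
Proof.
move=> a0 g0 [H1 H2 H3 H4]; split=> [k i|k|k|j k i].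
- by have := H1 k i.+1; congr (th _ != 0); rewrite exprS; ring.
- by have := H2 k; congr (th _ != 0); field; nonzero.
- by have := H3 k; congr (th _ != 0); field; nonzero.
- by have := H4 j k i.+1; congr (th _ != 0); rewrite exprS; ring.
Qed.

Hypothesis gen_zz : forall j k, j != k -> th (z j / z k) != 0.
Hypothesis gen_zzq : forall j k (i : nat), th (z j * z k * q ^+ i) != 0.

Lemma ratio1_neq0 j k : ratio 1 j k != 0.
Proof.
have := gen_zzq j k 0; have := gen_zzq j k 1.
rewrite expr0 expr1 mulr1 /ratio !mul1r => H1 H2.
by rewrite mulf_neq0 ?invr_eq0 //; move: H1; congr (th _ != 0); ring.
Qed.

Lemma pairs_neq0 F A : (forall j k, F j k != 0) -> pairs F A != 0.
Proof. by move=> F0; rewrite /pairs; do 2!(apply/prodf_neq0 => ? _). Qed.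

Lemma kcoef_hspan a g (A U : {set I}) : a != 0 -> g != 0 -> U \subset A ->
  hspan th (kC a g) #|A| (kspan a g A U).
Proof.
move=> a0 g0 UA; have leUA := subset_leq_card UA.
have H1 : hspan th (kC a g) #|U|
  (fun b => \prod_(0 <= i < #|U|) hpair th (kC a g) b (q ^+ i)).
  have := @hspan_prod K th (kC a g) nat (index_iota 0 #|U|) xpredT
    (fun i => q ^+ i) 0 (fun=> 1).
  rewrite count_predT size_iota addn0 subn0 => H.
  apply: hspan_ext (H _ _); first by move=> b _; rewrite mulr1.
    by move=> i _; nonzero.
  by apply: (@hspan_const _ _ _ 1).
have := @hspan_prod K th (kC a g) I (index_enum I) (mem (A :\: U))
   (fun k => g * z k / a) _ _ _ H1.
rewrite -sum1_count sum1_card cardsD (setIidPr UA) subnK //; apply.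
by move=> k _; nonzero.
Qed.

Lemma krhs_hspan a g (A : {set I}) : a != 0 ->
  hspan th (kC a g) #|A| (krhs a g A).
Proof.
move=> a0; rewrite /krhs; apply: hspan_scale.
have := @hspan_prod K th (kC a g) I (index_enum I) (mem A)
  (fun k => z k / a) 0 (fun=> 1).
rewrite -sum1_count sum1_card addn0 => H.
apply: hspan_ext (H _ _); first by move=> b _; rewrite mulr1.
  by move=> i _; nonzero.
by apply: (@hspan_const _ _ _ 1).
Qed.

Definition kstep a g (A : {set I}) l : K :=
  - (th g * th (a / (g * z l)) * th (q * z l * z l) / th (a * q * z l / g)
     / q ^+ #|A| * \prod_(k in A) ratio 1 l k).

(** The node e = a q z l stays fixed while a, g and [kC] are multiplied by q, and subsets of A
    containing l correspond to subsets of A :\ l. The factor [kstep] between the two terms does not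
    involve U, so it can be taken out of the sum. *)
Lemma jackson1_step_lhs a g (A U : {set I}) l :
  a != 0 -> g != 0 -> kgen a g -> l \in A -> U \subset A :\ l ->
  kcoef a g A (l |: U) * kspan a g A (l |: U) (a * q * z l)
  = kstep a g (A :\ l) l * (kcoef (a * q) (g * q) (A :\ l) U
      * kspan (a * q) (g * q) (A :\ l) U (a * q * z l)).
Proof.
move=> a0 g0 [H1 H2 H3 H4] lA UA.
have lU : l \notin U by apply: (contra (subsetP UA l)); rewrite setD11.
have EO : A :\: (l |: U) = (A :\ l) :\: U by rewrite setDDl.
set A' := A :\ l in UA EO *; set O := A' :\: U in EO *.
have cO : (#|U| + #|O| = #|A'|)%N.
  by rewrite /O cardsD (setIidPr UA) subnKC // subset_leq_card.
rewrite /kcoef /kspan /kstep EO -/A' -/O cardsU1 lU add1n binS bin1.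
rewrite (pairsD1 (ratioC _) lA) -/A'.
have kCS : kC (a * q) (g * q) = q * kC a g.
  by rewrite /kC; field; nonzero.
rewrite kCS.
(* For k outside l |: U, reflecting both thetas of the pair (l, k) in [mixed] leaves q^-1 th (q z k
   / z l) / th (z k / z l), which exchanges the second theta of the old [hpair] for that of the new
   one. *)
have E1 : mixed A (l |: U) * \prod_(k in O) hpair th (kC a g) (a * q * z l) (g * z k / a)
  = q ^- #|O| * mixed A' U
    * \prod_(k in O) hpair th (q * kC a g) (a * q * z l) (g * q * z k / (a * q)).
  rewrite /mixed big_setU1 //= EO -/O.
  rewrite -[q ^- _]exprVn -(prodr_const (mem O)) [LHS]mulrAC [RHS]mulrAC; congr (_ * _).
  rewrite -!big_split /=; apply: eq_bigr => k; rewrite !inE => /andP[_ /andP[kl _]].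
  rewrite [th (z l / (q * z k))]th_flip; [|nonzero|nonzero].
  rewrite [th (z l / z k)]th_flip; [|nonzero|nonzero].
  rewrite /hpair.
  have -> : kC a g * (g * z k / a) / (a * q * z l) = z k / z l.
    by rewrite /kC; field; nonzero.
  have -> : q * kC a g * (g * q * z k / (a * q)) / (a * q * z l) = q * z k / z l.
    by rewrite /kC; field; nonzero.
  have -> : g * q * z k / (a * q) = g * z k / a by field; nonzero.
  have HX := gen_zz kl; move: HX; move: (th (z k / z l)) => X X0; move: (th _) (th _) => Y Z.
  by field; nonzero.
have E2 : \prod_(0 <= i < #|U|.+1) hpair th (kC a g) (a * q * z l) (q ^+ i)
  = th (a * z l * q ^+ #|U|.+1) * th (a / (g * z l))
    * \prod_(0 <= i < #|U|) hpair th (q * kC a g) (a * q * z l) (q ^+ i).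
  rewrite /hpair !big_split /= big_nat_recr //= [X in _ * X]big_nat_recl //=.
  have -> : a * q * z l * q ^+ #|U| = a * z l * q ^+ #|U|.+1.
    by rewrite exprS; ring.
  have -> : kC a g * q ^+ 0 / (a * q * z l) = a / (g * z l).
    by rewrite /kC expr0; field; nonzero.
  have -> : \prod_(0 <= i < #|U|) th (kC a g * q ^+ i.+1 / (a * q * z l))
    = \prod_(0 <= i < #|U|) th (q * kC a g * q ^+ i / (a * q * z l)).
    by apply: eq_bigr => i _; congr th; rewrite exprS; ring.
  by ring.
have E3 : \prod_(k in l |: U)
     (th (q * z k * z k) / (th (a * z k * q ^+ #|U|.+1) * th (a * q * z k / g)))
  = th (q * z l * z l) / (th (a * z l * q ^+ #|U|.+1) * th (a * q * z l / g))
    * \prod_(k in U) (th (q * z k * z k)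
        / (th (a * q * z k * q ^+ #|U|) * th (a * q * q * z k / (g * q)))).
  rewrite big_setU1 //=; congr (_ * _); apply: eq_bigr => k _.
  by congr (_ / (th _ * th _)); [rewrite exprS; ring | field; nonzero].
have E4 : \prod_(k in O) (th (a * q ^+ #|U|.+1 / z k) / th (a * z k * q ^+ #|U|.+2))
  = \prod_(k in O) (th (a * q * q ^+ #|U| / z k) / th (a * q * z k * q ^+ #|U|.+1)).
  by apply: eq_bigr => k _; congr (th _ / th _);
     [rewrite exprS | rewrite [q ^+ #|U|.+2]exprS]; ring.
rewrite E2 E3 E4 pcSl exprD exprS -cO exprD.
have HQ := expf_neq0 #|U| q0; have HQO := expf_neq0 #|O| q0.
have HC := expf_neq0 'C(#|U|, 2) q0.
have HA := H1 l #|U|.+1; have HG := H2 l.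
set X1 := mixed A _ in E1 *; set X2 := \prod_(k in O) hpair _ _ _ _ in E1 *.
transitivity (X1 * X2 * (-1 * (-1) ^+ #|U| / (q ^+ 'C(#|U|, 2) * q ^+ #|U|) *
  (\prod_(k in A') ratio 1 l k * pairs (ratio 1) A' / pairs (ratio 1) O) *
  (th (q * z l * z l) / (th (a * z l * q ^+ #|U|.+1) * th (a * q * z l / g)) *
   \prod_(k in U)
      (th (q * z k * z k) /
       (th (a * q * z k * q ^+ #|U|) * th (a * q * q * z k / (g * q))))) *
  \prod_(k in O) (th (a * q * q ^+ #|U| / z k) / th (a * q * z k * q ^+ #|U|.+1)) *
  (th g * pc (g * q) #|U|) * (th (a * z l * q ^+ #|U|.+1) * th (a / (g * z l)) *
   \prod_(0 <= i < #|U|) hpair th (q * kC a g) (a * q * z l) (q ^+ i)))).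
  by ring.
rewrite E1.
move: (pairs _ O)^-1 (pairs _ A') (\prod_(k in A') _) (\prod_(k in O) _)
  (\prod_(k in O) _) (\prod_(k in U) _) (\prod_(0 <= i < _) _) => *.
by field; nonzero.
Qed.

Lemma jackson1_step_rhs a g (A : {set I}) l :
  a != 0 -> g != 0 -> kgen a g -> l \in A ->
  krhs a g A (a * q * z l)
  = kstep a g (A :\ l) l * krhs (a * q) (g * q) (A :\ l) (a * q * z l).
Proof.
move=> a0 g0 [H1 H2 H3 H4] lA; rewrite /krhs /kstep !(big_setD1 l lA) /=.
set A' := A :\ l.
have kCS : kC (a * q) (g * q) = q * kC a g by rewrite /kC; field; nonzero.
rewrite kCS.
have E : \prod_(k in A') (- (a / z k) * (th (g * z k / a) / th (a * q * z k / g)))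
    * \prod_(k in A') hpair th (kC a g) (a * q * z l) (z k / a)
  = q ^- #|A'| * \prod_(k in A') ratio 1 l k
    * (\prod_(k in A') (- (a * q / z k) *
        (th (g * q * z k / (a * q)) / th (a * q * q * z k / (g * q))))
      * \prod_(k in A') hpair th (q * kC a g) (a * q * z l) (z k / (a * q))).
  rewrite -exprVn -(prodr_const (mem A')) -!big_split /=; apply: eq_bigr => k _.
  rewrite /hpair /ratio.
  have -> : g * q * z k / (a * q) = g * z k / a by field; nonzero.
  have -> : a * q * q * z k / (g * q) = a * q * z k / g by field; nonzero.
  have -> : q * kC a g * (z k / (a * q)) / (a * q * z l)
      = kC a g * (z k / a) / (a * q * z l) by field; nonzero.
  have -> : a * q * z l * (z k / a) = 1 * q * z l * z k by field; nonzero.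
  have -> : a * q * z l * (z k / (a * q)) = 1 * z l * z k by field; nonzero.
  have HX : th (1 * z l * z k) != 0.
    by have := gen_zzq l k 0; rewrite expr0 mulr1 mul1r.
  have HG := H2 k.
  move: HX HG; move: (th (1 * z l * z k)) (th (a * q * z k / g)) => X Y X0 Y0.
  by move: (th _) (th _) (th _) => *; field; nonzero.
set P1 := \prod_(k in A') (- _ * _) in E *.
set P2 := \prod_(k in A') hpair _ _ _ _ in E *.
transitivity ((- (a / z l) * (th (g * z l / a) / th (a * q * z l / g)))
  * hpair th (kC a g) (a * q * z l) (z l / a) * (P1 * P2)); first by ring.
rewrite E /hpair.
have -> : a * q * z l * (z l / a) = q * z l * z l by field; nonzero.
have -> : kC a g * (z l / a) / (a * q * z l) = g^-1.
  by rewrite /kC; field; nonzero.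
rewrite thV // th_flip ?mulf_neq0 //.
have HG := H2 l; have HQ := expf_neq0 #|A'| q0.
move: HG; move: (th (a * q * z l / g)) => X X0.
move: (\prod_(k in A') ratio 1 l k) (\prod_(k in A') _) (\prod_(k in A') _) => *.
move: (th g) (th (g * z l / a)) (th (q * z l * z l)) => *.
by field; nonzero.
Qed.

Lemma jackson1_bottom a g (A : {set I}) : a != 0 -> g != 0 -> kgen a g ->
  kcoef a g A set0 * kspan a g A set0 1 = krhs a g A 1.
Proof.
move=> a0 g0 [H1 H2 H3 H4].
rewrite /kcoef /kspan /krhs /mixed !big_set0 setD0 cards0 /pc !big_geq //.
rewrite divff; last by apply: pairs_neq0; exact: ratio1_neq0.
rewrite bin0n !expr0 divr1 !mulr1 !mul1r -!big_split /=; apply: eq_bigr => k _.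
rewrite /hpair !divr1 !mul1r [th (a / z k)]th_flip //.
have -> : kC a g * (g * z k / a) = a * z k * q ^+ 1.
  by rewrite /kC expr1; field; nonzero.
have -> : kC a g * (z k / a) = a * q * z k / g.
  by rewrite /kC; field; nonzero.
have HG := H2 k; have HA := H1 k 1.
move: HG HA; move: (th (a * q * z k / g)) (th (a * z k * q ^+ 1)) => X Y X0 Y0.
move: (th _) (th _) => *; field; nonzero.
Qed.

Lemma jackson1 a g (A : {set I}) e : a != 0 -> g != 0 -> e != 0 -> kgen a g ->
  \sum_(U : {set I} | U \subset A) kcoef a g A U * kspan a g A U e
  = krhs a g A e.
Proof.
have [n] := ubnP #|A|; elim: n => // n IH in A a g e * => ltAn a0 g0 e0 Hgen.
have [H1 H2 H3 H4] := Hgen.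
have HC : kC a g != 0 by rewrite /kC; nonzero.
pose F b := \sum_(U : {set I} | U \subset A) kcoef a g A U * kspan a g A U b
  + (-1) * krhs a g A b.
have HF : hspan th (kC a g) #|A| F.
  apply: (hspan_add _ (hspan_scale (-1) (krhs_hspan g A a0))); last by move=> ? _.
  by apply: hspan_sum => S SA; apply/hspan_scale/kcoef_hspan.
suff: F e = 0.
  by move=> /eqP; rewrite /F mulN1r subr_eq0 => /eqP.
pose s := 1 :: [seq a * q * z k | k <- enum A].
apply: (hspan_eq0 th1 thV thW HC HF (s := s)) => //.
- by rewrite /= size_map -cardE.
- rewrite /s /=; apply/andP; split; first by nonzero.
  by apply/allP => x /mapP[k _ ->]; nonzero.
- rewrite /s /=; apply/andP; split.
    apply/allP => x /mapP[k _ ->]; rewrite /hpair divr1 mul1r.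
    have -> : kC a g / (a * q * z k) = (g * z k / a)^-1.
      by rewrite /kC; field; nonzero.
    rewrite !thV; [|nonzero|nonzero].
    by have := H1 k 1; rewrite expr1 mulrAC => HA; nonzero.
  rewrite pairwise_map.
  apply: sub_pairwise (_ : pairwise (fun x y => x != y) (enum A)).
    move=> j k /= jk; rewrite /hpair.
    have -> : a * q * z j / (a * q * z k) = z j / z k by field; nonzero.
    have -> : kC a g / (a * q * z k) / (a * q * z j) = (g * z j * z k * q ^+ 1)^-1.
      by rewrite /kC; field; nonzero.
    rewrite thV; last by nonzero.
    have HZ := gen_zz jk; have HG := H4 j k 1; nonzero.
  by rewrite -uniq_pairwise enum_uniq.
move=> x; rewrite inE => /orP[/eqP->|/mapP[l]].
  rewrite /F (bigD1 set0) ?sub0set //= big1 ?addr0.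
    by rewrite jackson1_bottom // mulN1r subrr.
  move=> U /andP[UA U0].
  suff -> : kspan a g A U 1 = 0 by rewrite mulr0.
  rewrite /kspan; case EU: #|U| => [|m].
    by move/eqP: EU; rewrite cards_eq0 (negbTE U0).
  by rewrite big_nat_recl // [hpair _ _ 1 (q ^+ 0)]/hpair expr0 mulr1 th1 !mul0r mulr0.
rewrite mem_enum => lA ->.
have lt' : (#|A :\ l| < n)%N by move: ltAn; rewrite (cardsD1 l A) lA.
rewrite /F jackson1_step_rhs //.
rewrite -(IH _ _ _ _ lt'); [|nonzero|nonzero|nonzero|exact: kgenS].
rewrite (bigID (fun U : {set I} => l \in U)) /= [X in _ + X + _]big1 ?addr0.
  rewrite mulN1r mulr_sumr; apply/eqP; rewrite subr_eq0; apply/eqP.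
  rewrite (reindex_onto (fun U : {set I} => l |: U) (fun U => U :\ l)) /=; last first.
    by move=> U /andP[_ lU]; rewrite setD1K.
  apply: eq_big => [U|U /andP[/andP[UA _] /eqP lU]].
    rewrite subUset sub1set lA setU11 /= andbT subsetD1.
    case: (boolP (l \in U)) => lU.
      rewrite andbF; apply/negbTE/negP => /andP[_ /eqP E].
      by move: lU; rewrite -E setD11.
    by rewrite setU1K // eqxx !andbT.
  rewrite jackson1_step_lhs //; rewrite subUset in UA; case/andP: UA => _ UA.
  by rewrite subsetD1 UA -lU setD11.
move=> U /andP[UA lU]; rewrite /kspan (bigD1 l) /=; last by rewrite !inE lU.
rewrite {1}/hpair.
have -> : kC a g * (g * z l / a) / (a * q * z l) = 1.
  by rewrite /kC; field; nonzero.
by rewrite th1 !mulr0 !mul0r mulr0.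
Qed.

(** * Bailey transformation of subset sums *)

Section Bailey.
Variables a b c d e f lam : K.
Hypotheses (a0 : a != 0) (b0 : b != 0) (c0 : c != 0) (d0 : d != 0)
  (e0 : e != 0) (f0 : f != 0).
Hypothesis lamE : lam = a ^+ 2 * q / (b * c * d).
Hypothesis efE : e * f = lam * a * q.

Hypothesis gen_lz : forall k (i : nat), th (lam * z k * q ^+ i) != 0.
Hypothesis gen_az : forall k (i : nat), th (a * z k * q ^+ i) != 0.
Hypothesis gen_lVz : forall k (i : nat), th (lam / z k * q ^+ i) != 0.
Hypothesis gen_aVz : forall k, th (a / z k) != 0.
Hypothesis gen_ab : forall i : nat, th (a / b * q ^+ i) != 0.
Hypothesis gen_ac : forall i : nat, th (a / c * q ^+ i) != 0.
Hypothesis gen_bz : forall k, th (b * z k) != 0.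
Hypothesis gen_t : forall j k, th (a * q / d * z j * z k) != 0.
Hypothesis gen_acd : forall j k (i : nat),
  th (a ^+ 2 / (c * d) * z j * z k * q ^+ i) != 0.
Hypothesis gen_al : forall j k (i : nat), th (a / lam * z j * z k * q ^+ i) != 0.
Hypothesis gen_aze : forall k, th (a * q * z k / e) != 0.
Hypothesis gen_azf : forall k, th (a * q * z k / f) != 0.
Hypothesis gen_lze : forall k, th (lam * q * z k / e) != 0.
Hypothesis gen_lzf : forall k, th (lam * q * z k / f) != 0.

Lemma lam0 : lam != 0. Proof. by rewrite lamE; nonzero. Qed.

Lemma pcD x m n : pc x (m + n) = pc x m * pc (x * q ^+ m) n.
Proof.
rewrite /pc (big_cat_nat _ (leq_addr n m)) //=; congr (_ * _).
rewrite -{1}[m]add0n big_addn addKn; apply: eq_bigr => i _.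
by rewrite addnC exprD mulrA.
Qed.

(** The term of the subset sum is [core] times [inner]. The parameters b, c, d occur only in
    [inner], which is the factor to be expanded. *)
Definition core (a' e' f' : K) (A S : {set I}) : K :=
  let N := #|S| in
  (-1) ^+ N / q ^+ 'C(N, 2) * mixed A S
  * (pairs (ratio 1) A / pairs (ratio 1) (A :\: S))
  * \prod_(k in S) (th (q * z k * z k)
      / (th (a' * z k * q ^+ N) * (th (a' * q * z k / e') * th (a' * q * z k / f'))))
  * \prod_(k in A :\: S) (th (a' * q ^+ N / z k) / th (a' * z k * q ^+ N.+1))
  * \prod_(k in A) (th (a' * q * z k) / th (a' / z k))
  * (pc e' N * pc f' N).

Definition inner (a' b' c' d' : K) (S : {set I}) : K :=
  let N := #|S| in
  pairs (ratio (a' * q / d')) S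
  * \prod_(k in S) (th (d' * q ^+ N / (q * z k)) * th (b' * z k) * th (c' * z k)
      / th (a' * q / d' * z k * z k))
  / (pc (a' * q / b') N * pc (a' * q / c') N).

Let b' := lam * b / a.
Let c' := lam * c / a.
Let d' := lam * d / a.

(** Since lam q / (c' d') = b, a q / c = lam q / c' and a q / d = lam q / d', the closed form [jrhs]
    at the parameters lam, b', c', d' is [inner] at a, b, c, d up to powers and one symbol in a q /
    b. *)
Lemma inner_expand (S : {set I}) :
  inner a b c d S = (-1) ^+ #|S| * (a / lam) ^+ #|S| * q ^+ 'C(#|S|, 2)
    / pc (a * q / b) #|S|
    * \sum_(T : {set I} | T \subset S) jcoef lam c' d' S T * jspan lam c' d' S T b'.
Proof.
have l0 := lam0.
have c'0 : c' != 0 by rewrite /c'; nonzero.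
have d'0 : d' != 0 by rewrite /d'; nonzero.
have b'0 : b' != 0 by rewrite /b'; nonzero.
rewrite jackson2 //; first last.
- move=> k; have := gen_bz k; congr (th _ != 0).
  by rewrite /c' /d' lamE; field; nonzero.
- move=> j k i; have := gen_acd j k i; congr (th _ != 0).
  by rewrite /c' /d'; field; nonzero.
- move=> j k; have := gen_t j k; congr (th _ != 0).
  by rewrite /d'; field; nonzero.
- move=> i; have := gen_ac i; congr (th _ != 0).
  by rewrite /c'; field; nonzero.
rewrite /inner /jrhs; set n := #|S|.
have Et : a * q / d = lam * q / d' by rewrite /d'; field; nonzero.
have HT k : th (lam * q / d' * z k * z k) != 0 by rewrite -Et.
rewrite Et.
have -> : (a * q / c) = lam * q / c' by rewrite /c'; field; nonzero.
have C0 : jC lam c' d' n != 0 by rewrite /jC; nonzero.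
have jCE : jC lam c' d' n = a ^+ 2 * q * q ^+ n / (c * d).
  by rewrite /jC [q ^+ _.+1]exprS /c' /d'; field; nonzero.
have E : \prod_(k in S) (th (lam * q * z k / (c' * d')) / (z k * th (lam * q / d' * z k * z k)))
  * \prod_(k in S) hpair th (jC lam c' d' n) b' (lam * q * z k / (d' * jC lam c' d' n))
  = (- (q / (d * q ^+ n))) ^+ n *
  \prod_(k in S)
    (th (d * q ^+ n / (q * z k)) * th (b * z k) * th (c * z k) /
     th (lam * q / d' * z k * z k)).
  rewrite -[(- _) ^+ n](prodr_const (mem S)) -!big_split /=; apply: eq_bigr => k _.
  rewrite /hpair.
  have -> : lam * q * z k / (c' * d') = b * z k.
    by rewrite /c' /d' lamE; field; nonzero.
  have -> : jC lam c' d' n * (lam * q * z k / (d' * jC lam c' d' n)) / b' = c * z k.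
    by transitivity (lam * q * z k / (d' * b'));
      [|rewrite /b' /d' lamE]; field; nonzero.
  have -> : b' * (lam * q * z k / (d' * jC lam c' d' n)) = q * z k / (d * q ^+ n).
    by rewrite jCE /b' /d' lamE; field; nonzero.
  rewrite th_flip; [|nonzero|nonzero].
  have Q0 := expf_neq0 n q0.
  by have H := HT k; field; nonzero.
rewrite -[X in _ = _ * X]mulrA E [(- (q / _)) ^+ n]exprNn [(q / _) ^+ n]expr_div_n
  [(d * _) ^+ n]exprMn -sqr_pow_bin [(a / lam) ^+ n]expr_div_n.
have S1 : (-1) ^+ n * (-1) ^+ n = 1 :> K by rewrite -expr2 sqrr_sign.
have Q0 := expf_neq0 n q0; have QC := expf_neq0 'C(n, 2) q0.
have D0 := expf_neq0 n d0; have A0 := expf_neq0 n a0; have L0 := expf_neq0 n l0.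
rewrite [(pc _ _ * pc _ _)^-1]invfM [d' ^+ n]expr_div_n exprMn.
move: (pc _ _)^-1 (pc _ _)^-1 (pairs _ _) (\prod_(k in S) _) => X1 X2 X3 X4.
move: S1; move: ((-1) ^+ n) => s S1.
by rewrite -[LHS]mul1r -S1; field; nonzero.
Qed.

Lemma prod_tri (x : K) (F : nat -> K) n :
  \prod_(0 <= i < n) (x / q ^+ i * F i)
  = x ^+ n / q ^+ 'C(n, 2) * \prod_(0 <= i < n) F i.
Proof.
elim: n => [|n IH]; first by rewrite !big_geq // bin0n !expr0 divr1 mulr1.
rewrite !big_nat_recr //= IH binS bin1 exprD exprSr.
have Q0 := expf_neq0 n q0; have QC := expf_neq0 'C(n, 2) q0.
by move: (\prod_(0 <= i < n) F i) => X; field; nonzero.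
Qed.

Lemma prod_disjU (A B : {set I}) (F : I -> K) : [disjoint A & B] ->
  \prod_(k in A :|: B) F k = \prod_(k in A) F k * \prod_(k in B) F k.
Proof. by move=> dAB; rewrite -bigU //; apply: eq_bigl => k; rewrite !inE. Qed.

(** With O the rest of A, both sides are the product over the pairs in T x U, T x O and U x O. *)
Lemma mixed_split (A T U : {set I}) : T \subset A -> U \subset A :\: T ->
  mixed A (T :|: U) * mixed (T :|: U) T = mixed A T * mixed (A :\: T) U.
Proof.
move=> TA UA.
have dTU : [disjoint T & U].
  by rewrite disjoint_sym; move: UA; rewrite subsetD => /andP[].
have E1 : (T :|: U) :\: T = U by rewrite setDUl setDv set0U; apply/setDidPl; rewrite disjoint_sym.
have E2 : A :\: T = U :|: (A :\: T) :\: U by rewrite -[LHS](setID _ U) (setIidPr UA).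
have dO : [disjoint U & (A :\: T) :\: U] by rewrite -setI_eq0 setDE setICA setICr setI0.
rewrite /mixed prod_disjU // -setDDl E1.
have -> : \prod_(k in T) \prod_(j in A :\: T) (th (z k / (q * z j)) / th (z k / z j))
  = \prod_(k in T) \prod_(j in U) (th (z k / (q * z j)) / th (z k / z j))
   * \prod_(k in T) \prod_(j in (A :\: T) :\: U) (th (z k / (q * z j)) / th (z k / z j)).
  by rewrite -big_split /=; apply: eq_bigr => k _; rewrite {1}E2 prod_disjU.
by ring.
Qed.

(** Here the constant [jC] divided by b' is a q^#|S|, so each point of T contributes the very theta
    by which [core] divides. The filling factors form a run in a q / b and, read backwards and
    reflected, a run in a / lam. *)
Lemma inner_span (S T : {set I}) : T \subset S ->
  jspan lam c' d' S T b'
  = \prod_(k in T) (th (b' * z k) * th (a * z k * q ^+ #|S|))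
    * (pc (a * q / b) #|S| / pc (a * q / b) #|T|)
    * ((- (lam / a)) ^+ (#|S| - #|T|) / q ^+ 'C(#|S| - #|T|, 2)
       * pc (a / lam) (#|S| - #|T|)).
Proof.
move=> TS; have l0 := lam0; have le := subset_leq_card TS.
rewrite /jspan -(subnKC le) addKn; set M := #|T|; set u := (#|S| - M)%N.
have d'0 : d' != 0 by rewrite /d'; nonzero.
have c'0 : c' != 0 by rewrite /c'; nonzero.
have b'0 : b' != 0 by rewrite /b'; nonzero.
set C := jC _ _ _ _.
have CE : C = a ^+ 2 * q * q ^+ (M + u) / (c * d).
  by rewrite /C /jC [q ^+ _.+1]exprS /c' /d'; field; nonzero.
have C0 : C != 0 by rewrite CE; nonzero.
move: C CE C0 => C CE C0.
have QN := expf_neq0 (M + u) q0.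
rewrite -mulrA; congr (_ * _).
  apply: eq_bigr => k _; rewrite /hpair; congr (_ * th _).
  by rewrite CE /b' lamE; field; nonzero.
rewrite /hpair big_split /= [LHS]mulrC; congr (_ * _).
  have H0 : pc (a * q / b) M != 0.
    rewrite /pc big_mkord; apply/prodf_neq0 => i _.
    by have := gen_ab i.+1; congr (th _ != 0); rewrite exprS; field; nonzero.
  rewrite pcD mulrAC divff // mul1r /pc.
  rewrite -{1}[M]add0n big_addn addKn; apply: eq_bigr => i _; congr th.
  rewrite exprS exprD /b'; move: (q ^+ M) (q ^+ i) => X Y.
  by field; nonzero.
rewrite -{1}[M]add0n big_addn addKn big_nat_rev /= -prod_tri.
apply: eq_big_nat => i /andP[_ ltiu].
have -> : b' * (lam * q ^+ (0 + u - i.+1 + M).+1 / C) = (lam / (a * q ^+ i)).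
  rewrite CE /b' lamE.
  have -> : (M + u = (0 + u - i.+1 + M).+1 + i)%N.
    by move: ltiu; clearbody M u; clear; lia.
  rewrite exprD; move: (q ^+ _.+1) (expf_neq0 (0 + u - i.+1 + M).+1 q0) => X X0.
  by have Q0 := expf_neq0 i q0; field; nonzero.
rewrite th_flip; [|nonzero|nonzero].
by have Q0 := expf_neq0 i q0; congr (_ * th _); field; nonzero.
Qed.

(** What is left of the term of the double sum at S = T :|: U when everything that depends on U has
    been gathered into a term of [jackson1]. *)
Definition outer (A T : {set I}) : K :=
  let M := #|T| in
  (-1) ^+ M * (a / lam) ^+ M / q ^+ 'C(M, 2) * mixed A T
  * (pairs (ratio 1) A / pairs (ratio 1) (A :\: T))
  * \prod_(k in A) (th (a * q * z k) / th (a / z k))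
  * \prod_(k in A) (th (a * q * z k / e) * th (a * q * z k / f))^-1
  * (pc e M * pc f M)
  * pairs (ratio (lam * q / d')) T
  * \prod_(k in T) (th (q * z k * z k) * (th (d' * q ^+ M / (q * z k)) * th (c' * z k)
     / (th (lam * q / d' * z k * z k) * th (lam * z k * q ^+ M))) * th (b' * z k))
  / (pc (lam * q / c') M * pc (a * q / b) M).

(** For fixed T the sum over U is of the form of [jackson1] on A :\: T, with a and e scaled by
    q^#|T| and g = a / lam. The relation e f = lam a q makes [kC] the product of the scaled e and
    f. *)
Lemma core_split (A T U : {set I}) : T \subset A -> U \subset A :\: T ->
  let S := T :|: U in
  core a e f A S * ((-1) ^+ #|S| * (a / lam) ^+ #|S| * q ^+ 'C(#|S|, 2)
    / pc (a * q / b) #|S| * (jcoef lam c' d' S T * jspan lam c' d' S T b'))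
  = outer A T * (kcoef (a * q ^+ #|T|) (a / lam) (A :\: T) U
      * kspan (a * q ^+ #|T|) (a / lam) (A :\: T) U (e * q ^+ #|T|)).
Proof.
move=> TA UA S; have l0 := lam0.
have dTU : [disjoint T & U].
  by rewrite disjoint_sym; move: UA; rewrite subsetD => /andP[].
have EU : S :\: T = U by rewrite /S setDUl setDv set0U; apply/setDidPl; rewrite disjoint_sym.
have EO : A :\: S = (A :\: T) :\: U by rewrite setDDl.
have cS : #|S| = (#|T| + #|U|)%N.
  by rewrite /S cardsU disjoint_setI0 // cards0 subn0.
rewrite inner_span ?subsetUl // /core /jcoef /kcoef /kspan EU EO.
rewrite cS addKn; set O := (A :\: T) :\: U; set M := #|T|; set u := #|U|.
have QM := expf_neq0 M q0.
have eqf : e / lam = a * q / f.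
  have -> : e = lam * a * q / f by rewrite -efE; field.
  by field; nonzero.
have QN : q ^+ (M + u) = q ^+ M * q ^+ u by rewrite exprD.
have Qu := expf_neq0 u q0.
have kCE : kC (a * q ^+ M) (a / lam) = a * lam * q * q ^+ M * q ^+ M.
  by rewrite /kC; field; nonzero.
have kCe k : hpair th (kC (a * q ^+ M) (a / lam)) (e * q ^+ M) (a / lam * z k / (a * q ^+ M))
   = th (a * q * z k / e) * th (a * q * z k / f).
  rewrite /hpair mulrC kCE; congr (th _ * th _); first by field; nonzero.
  by transitivity (e / lam * z k); [|rewrite eqf]; field; nonzero.
have kCi i : hpair th (kC (a * q ^+ M) (a / lam)) (e * q ^+ M) (q ^+ i)
   = th (e * q ^+ M * q ^+ i) * th (f * q ^+ M * q ^+ i).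
  rewrite /hpair kCE; congr (_ * th _).
  have -> : f = lam * a * q / e by rewrite -efE; field.
  by field; nonzero.
rewrite (eq_bigr _ (fun k _ => kCe k)) (eq_bigr _ (fun i _ => kCi i)).
rewrite [\prod_(0 <= i < u) _]big_split /= -/(pc (e * q ^+ M) u) -/(pc (f * q ^+ M) u).
rewrite [pc e (M + u)]pcD [pc f (M + u)]pcD /outer -/M.
have E1 := mixed_split TA UA; rewrite -/S in E1.
have E2 : \prod_(k in S) (th (q * z k * z k)
      / (th (a * z k * q ^+ (M + u)) * (th (a * q * z k / e) * th (a * q * z k / f))))
   = \prod_(k in T) (th (q * z k * z k) / th (a * z k * q ^+ (M + u)))
   * \prod_(k in U) (th (q * z k * z k) / th (a * z k * q ^+ (M + u)))
   * (\prod_(k in S) (th (a * q * z k / e) * th (a * q * z k / f))^-1).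
  by rewrite -prod_disjU // -big_split /=; apply: eq_bigr => k _; rewrite invfM mulrA.
have E3 : \prod_(k in A) (th (a * q * z k / e) * th (a * q * z k / f))^-1
   * \prod_(k in O) (th (a * q * z k / e) * th (a * q * z k / f))
  = \prod_(k in S) (th (a * q * z k / e) * th (a * q * z k / f))^-1.
  have AE : A = S :|: O by rewrite /O -EO setDE setUIr setUCr setIT; symmetry; apply/setUidPr;
    rewrite subUset TA; apply: subset_trans UA (subsetDl _ _).
  have dSO : [disjoint S & O] by rewrite -setI_eq0 /O -EO setIDA setIC -setIDA setDv setI0.
  rewrite {1}AE prod_disjU // -mulrA -big_split /= [X in _ * X]big1 ?mulr1 //.
  by move=> k _; rewrite mulVf //; nonzero.
have E4 : \prod_(k in U) (th (q * z k * z k) / th (a * z k * q ^+ (M + u)))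
     * \prod_(k in U) (th (lam * z k * q ^+ M.+1))^-1
   = \prod_(k in U) (th (q * z k * z k) / (th (a * q ^+ M * z k * q ^+ u)
        * th (a * q ^+ M * q * z k / (a / lam)))).
  rewrite -big_split /=; apply: eq_bigr => k _; rewrite -[LHS]mulrA -invfM.
  congr (_ / (th _ * th _)); first by rewrite QN; ring.
  by rewrite exprS; field; nonzero.
have E5 : \prod_(k in O) (th (a * q ^+ (M + u) / z k) / th (a * z k * q ^+ (M + u).+1))
   = \prod_(k in O) (th (a * q ^+ M * q ^+ u / z k) / th (a * q ^+ M * z k * q ^+ u.+1)).
  apply: eq_bigr => k _; congr (th _ / th _); rewrite ?exprS QN; ring.
(* The factors over T that involve #|U| cancel here: those of [core] against those of [jspan]. *)
have E6 : \prod_(k in T) (th (q * z k * z k) / th (a * z k * q ^+ (M + u)))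
   * (\prod_(k in T) (th (d' * q ^+ M / (q * z k)) * th (c' * z k)
     / (th (lam * q / d' * z k * z k) * th (lam * z k * q ^+ M)))
   * \prod_(k in T) (th (b' * z k) * th (a * z k * q ^+ (M + u))))
  = \prod_(k in T) (th (q * z k * z k) * (th (d' * q ^+ M / (q * z k)) * th (c' * z k)
     / (th (lam * q / d' * z k * z k) * th (lam * z k * q ^+ M))) * th (b' * z k)).
  rewrite -!big_split /=; apply: eq_bigr => k _.
  by have := gen_az k (M + u); move: (th (a * z k * _)) (_ / (_ * _)) => X Y X0; field.
have PT0 : pairs (ratio 1) (A :\: T) != 0 by apply: pairs_neq0; exact: ratio1_neq0.
have ab0 : pc (a * q / b) (M + u) != 0.
  rewrite /pc big_mkord; apply/prodf_neq0 => i _.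
  by have := gen_ab i.+1; congr (th _ != 0); rewrite exprS; field; nonzero.
rewrite E2 E5 -E3 -E4 -E6.
have S1 n : (-1) ^+ n * (-1) ^+ n = 1 :> K by rewrite -expr2 sqrr_sign.
have QC1 := expf_neq0 'C(M + u, 2) q0; have QC2 := expf_neq0 'C(M, 2) q0.
have QC3 := expf_neq0 'C(u, 2) q0.
rewrite [(- (lam / a)) ^+ u]exprNn ![(_ / _) ^+ _]expr_div_n !exprD.
have AM := expf_neq0 M a0; have Au := expf_neq0 u a0.
have LM := expf_neq0 M l0; have Lu := expf_neq0 u l0.
have SM := S1 M; have Su := S1 u.
move: ((-1) ^+ M) ((-1) ^+ u) SM Su => sM su SM Su.
move: E1 ab0 PT0; move: (mixed A S) (mixed S T) (mixed A T) (mixed _ U) => m1 m2 m3 m4 E1.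
move: (pc (a * q / b) (M + u)) (pairs _ (A :\: T)) => p1 p2 p10 p20.
rewrite [(pc _ _ * pc _ _)^-1]invfM.
move: (pc (lam * q / c') M)^-1 (pc (a * q / b) M)^-1 (pairs _ O)^-1 (pairs _ A) (pairs _ T)
  => ipc ipb ipO pA pT.
move: (pc e M) (pc f M) (pc (e * _) u) (pc (f * _) u) (pc (a / lam) u) => e1 f1 e2 f2 pal.
move: (\prod_(k in T) _) => T1; move: (\prod_(k in T) _) (\prod_(k in T) _) => T3 T2.
move: (\prod_(k in U) _) => U1; move: (\prod_(k in U) _) => U2.
move: (\prod_(k in A) _) => A2; move: (\prod_(k in A) _) => A1.
move: (\prod_(k in O) _) => O2; move: (\prod_(k in O) _) => O1.
apply: (@etrans _ _ ((m1 * m2) * (sM * sM) * (su * su) *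
   (sM * (a ^+ M / lam ^+ M) / q ^+ 'C(M, 2) * (pA / p2) * A1 * A2 * (e1 * f1) * pT
    * (T1 * (T2 * T3)) * (ipc * ipb)
    * (su / q ^+ 'C(u, 2) * (p2 * ipO) * (U1 * U2) * O1 * pal * (O2 * (e2 * f2)))))).
  by field; nonzero.
by rewrite E1 SM Su; field; nonzero.
Qed.

Definition prefactor (k : I) : K :=
  th (a * q * z k) * th (z k / lam) * th (lam * q * z k / e) * th (lam * q * z k / f)
  / (th (lam * q * z k) * th (z k / a) * th (a * q * z k / e) * th (a * q * z k / f)).

(** Outside T, [krhs] produces the thetas at lam q z / e and lam q z / f, which the prefactor
    carries over all of A. Those over T are the denominators of [core] at lam. *)
Lemma outer_krhs (A T : {set I}) : T \subset A ->
  outer A T * krhs (a * q ^+ #|T|) (a / lam) (A :\: T) (e * q ^+ #|T|)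
  = \prod_(k in A) prefactor k
    * (core lam e f A T * inner lam b' c' d' T).
Proof.
move=> TA; have l0 := lam0; have QM := expf_neq0 #|T| q0.
rewrite /outer /core /inner; set M := #|T| in QM *; set O := A :\: T.
have AE : A = T :|: O by rewrite /O setDE setUIr setUCr setIT; symmetry; apply/setUidPr.
have dTO : [disjoint T & O] by rewrite -setI_eq0 /O setDE setICA setICr setI0.
have cA : #|A| = (M + #|O|)%N by rewrite {1}AE cardsU disjoint_setI0 // cards0 subn0.
have eaf : e / a = lam * q / f.
  have -> : e = lam * a * q / f by rewrite -efE; field.
  by field; nonzero.
pose L k := th (lam * q * z k / e) * th (lam * q * z k / f).
have HL k : L k != 0 by rewrite /L; nonzero.
have E1 : krhs (a * q ^+ M) (a / lam) O (e * q ^+ M)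
  = (a / lam) ^+ #|O| *
    \prod_(k in O) (th (lam * q ^+ M / z k) / th (lam * z k * q ^+ M.+1))
    * \prod_(k in O) L k.
  rewrite -(prodr_const (mem O)) /krhs -!big_split /=; apply: eq_bigr => k _.
  rewrite /hpair /kC.
  have -> : a / lam * z k / (a * q ^+ M) = z k / (lam * q ^+ M) by field; nonzero.
  have -> : a * q ^+ M * q * z k / (a / lam) = lam * z k * q ^+ M.+1.
    by rewrite exprS; field; nonzero.
  have -> : e * q ^+ M * (z k / (a * q ^+ M)) = lam * q * z k / f.
    by transitivity (e / a * z k); [|rewrite eaf]; field; nonzero.
  have -> : (a * q ^+ M) ^+ 2 * q / (a / lam) * (z k / (a * q ^+ M)) / (e * q ^+ M)
     = lam * q * z k / e by field; nonzero.
  rewrite th_flip; [|nonzero|nonzero].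
  by have H := gen_lz k M.+1; rewrite /L; field; nonzero.
have E2 : \prod_(k in A) prefactor k * \prod_(k in A) (th (lam * q * z k) / th (lam / z k))
  = (a / lam) ^+ #|A| * \prod_(k in A) (th (a * q * z k) / th (a / z k))
  * \prod_(k in A) (th (a * q * z k / e) * th (a * q * z k / f))^-1
  * (\prod_(k in T) L k * \prod_(k in O) L k).
  rewrite -[X in _ = _ * X]prod_disjU // -AE -(prodr_const (mem A)) -!big_split /=.
  apply: eq_bigr => k _; rewrite /prefactor.
  rewrite [th (z k / lam)]th_flip // [th (z k / a)]th_flip //.
  have H1 := gen_lz k 1; rewrite expr1 mulrAC in H1.
  have H2 := gen_lVz k 0; rewrite expr0 mulr1 in H2.
  have H3 := gen_aVz k; rewrite /L.
  by field; nonzero.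
have E3 : \prod_(k in T) (th (q * z k * z k)
      / (th (lam * z k * q ^+ M) * (th (lam * q * z k / e) * th (lam * q * z k / f))))
    * \prod_(k in T) (th (d' * q ^+ M / (q * z k)) * th (b' * z k) * th (c' * z k)
      / th (lam * q / d' * z k * z k))
    * \prod_(k in T) L k
  = \prod_(k in T) (th (q * z k * z k) * (th (d' * q ^+ M / (q * z k)) * th (c' * z k)
     / (th (lam * q / d' * z k * z k) * th (lam * z k * q ^+ M))) * th (b' * z k)).
  rewrite -!big_split /=; apply: eq_bigr => k _.
  have H1 := gen_lz k M.
  have H2 : th (lam * q / d' * z k * z k) != 0.
    by have := gen_t k k; congr (th _ != 0); rewrite /d'; field; nonzero.
  have HL1 := gen_lze k; have HL2 := gen_lzf k.
  by rewrite /L; field; nonzero.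
have -> : a * q / b = lam * q / b' by rewrite /b'; field; nonzero.
rewrite E1 -E3; move: E2; rewrite cA exprD.
move: (\prod_(k in A) prefactor k) => PF.
move: (\prod_(k in A) (th (lam * q * z k) / _)) (\prod_(k in T) L k) (\prod_(k in O) L k) => P1
  P2 P3.
move: (\prod_(k in A) (th (a * q * z k) / th (a / z k))) => P4.
move: (\prod_(k in A) (_ * _)^-1) => P5 E2.
move: (\prod_(k in T) _) (\prod_(k in T) _) (\prod_(k in O) _) => P6 P7 P8.
move: (mixed _ _) (pairs _ A) (pairs _ O)^-1 (pairs _ T) (pc e M) (pc f M)
  => mx pA iO pT eM fM.
rewrite [(pc _ _ * pc _ _)^-1]invfM [(pc (lam * q / b') _ * pc _ _)^-1]invfM.
move: (pc _ _)^-1 (pc _ _)^-1 => i1 i2.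
transitivity ((a / lam) ^+ M * (a / lam) ^+ #|O| * P4 * P5 * (P2 * P3) *
  ((-1) ^+ M / q ^+ 'C(M, 2) * mx * (pA * iO) * P7 * P6 * P8 * (eM * fM) * pT * (i1 * i2))).
  by ring.
by rewrite -E2; ring.
Qed.

Lemma bailey_subsets (A : {set I}) :
  \sum_(S : {set I} | S \subset A) core a e f A S * inner a b c d S
  = \prod_(k in A) prefactor k *
    \sum_(T : {set I} | T \subset A) core lam e f A T * inner lam b' c' d' T.
Proof.
have l0 := lam0.
pose D (S T : {set I}) := core a e f A S *
   ((-1) ^+ #|S| * (a / lam) ^+ #|S| * q ^+ 'C(#|S|, 2)
    / pc (a * q / b) #|S| * (jcoef lam c' d' S T * jspan lam c' d' S T b')).
transitivity (\sum_(S : {set I} | S \subset A) \sum_(T : {set I} | T \subset S) D S T).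
  by apply: eq_bigr => S SA; rewrite inner_expand !mulr_sumr.
rewrite (exchange_big_dep (fun T : {set I} => T \subset A)) /=; last first.
  by move=> S T SA TS; apply: subset_trans TS SA.
rewrite mulr_sumr; apply: eq_bigr => T TA.
rewrite -outer_krhs // -jackson1; [|nonzero|nonzero|nonzero|].
  rewrite mulr_sumr (reindex_onto (fun U : {set I} => T :|: U) (fun S => S :\: T)) /=.
    apply: eq_big => [U|U /andP[/andP[UA _] /eqP EU]].
      rewrite subUset TA subsetUl andbT /= subsetD setDUl setDv set0U.
      by rewrite (sameP eqP setDidPl).
    apply: core_split => //; rewrite subUset in UA; case/andP: UA => _ UA.
    by rewrite -EU setDUl setDv set0U; apply: setSD.
  by move=> S /andP[_ TS]; rewrite setDE setUIr setUCr setIT; apply/setUidPr.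
split=> [k i|k|k|j k i].
- by have := gen_az k (#|T| + i); congr (th _ != 0); rewrite exprD; ring.
- have := gen_lz k #|T|.+1; congr (th _ != 0); rewrite exprS; field.
  by have H := expf_neq0 #|T| q0; nonzero.
- have QM := expf_neq0 #|T| q0.
  have -> : a / lam * z k / (a * q ^+ #|T|) = (lam / z k * q ^+ #|T|)^-1.
    by field; nonzero.
  by rewrite thV; nonzero.
- exact: gen_al.
Qed.

End Bailey.
End SubsetSums.

(** * From subsets to progressions *)

Section Groups.
Variables (K : fieldType) (th : K -> K) (q : K).
Hypothesis thV : th_inversion th.
Hypothesis q0 : q != 0.
Local Notation pc := (pc th q).

Lemma telescope_pos (f : nat -> K) l h : (l <= h)%N ->
  (forall i, (l <= i <= h)%N -> f i != 0) ->
  \prod_(l <= i < h) (f i.+1 / f i) = f h / f l.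
Proof.
rewrite leq_eqVlt => /orP[/eqP->|lh] f0.
  by rewrite big_geq // divff // f0 // leqnn.
by rewrite telescope_prodf // => i /andP[/ltnW li /ltnW ih]; rewrite f0 // li ih.
Qed.

Lemma pc_range (x : K) l h :
  \prod_(l <= i < h) th (x * q ^+ i) = pc (x * q ^+ l) (h - l).
Proof.
rewrite -{1}[l]add0n big_addn /pc.
by apply: eq_bigr => i _; rewrite addnC exprD mulrA.
Qed.

Lemma pc_rev (x : K) l h : (l <= h)%N ->
  \prod_(l <= i < h) th (x / q ^+ i) = pc (x * q / q ^+ h) (h - l).
Proof.
move=> lh; rewrite -{1}[l]add0n big_addn.
rewrite big_nat_rev /= /pc; apply: eq_big_nat => i /andP[_ ih]; congr th.
have -> : q ^+ h = q ^+ (0 + (h - l) - i.+1 + l) * (q * q ^+ i).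
  by rewrite -exprS -exprD; congr (_ ^+ _); move: ih lh; clear; lia.
have := expf_neq0 (0 + (h - l) - i.+1 + l) q0; have := expf_neq0 i q0.
by move: (q ^+ i) (q ^+ _) => X Y X0 Y0; field; nonzero.
Qed.

Lemma pc_neq0 (x : K) n : (forall i, (i < n)%N -> th (x * q ^+ i) != 0) ->
  pc x n != 0.
Proof.
by move=> H; rewrite /pc big_mkord; apply/prodf_neq0 => i _; apply: H.
Qed.

Lemma ratio_rect (x : K) l1 h1 l2 h2 : (l2 <= h2)%N ->
  (forall i, th (x * q ^+ i) != 0) ->
  \prod_(l1 <= i < h1) \prod_(l2 <= i' < h2)
     (th (x * q ^+ (i + i').+1) / th (x * q ^+ (i + i')))
  = \prod_(l1 <= i < h1) (th (x * q ^+ (i + h2)) / th (x * q ^+ (i + l2))).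
Proof.
move=> lh H; apply: eq_bigr => i _.
rewrite -(@telescope_pos (fun i' => th (x * q ^+ (i + i')))) //.
by apply: eq_bigr => i' _; rewrite addnS.
Qed.

Lemma ratio_tri (x : K) l h :
  (forall i, th (x * q ^+ i) != 0) ->
  \prod_(l <= i < h) \prod_(i.+1 <= i' < h)
     (th (x * q ^+ (i + i').+1) / th (x * q ^+ (i + i')))
  = \prod_(l <= i < h) (th (x * q ^+ (i + h)) / th (x * q ^+ (i + i).+1)).
Proof.
move=> H; apply: eq_big_nat => i /andP[_ ih]; rewrite -addnS.
rewrite -(@telescope_pos (fun i' => th (x * q ^+ (i + i')))) //.
by apply: eq_bigr => i' _; rewrite addnS.
Qed.

Lemma ratio_rect_low (x : K) y1 y2 : (forall i, th (x * q ^+ i) != 0) ->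
  \prod_(0 <= i < y1) \prod_(0 <= i' < y2)
     (th (x * q ^+ (i + i').+1) / th (x * q ^+ (i + i')))
  = pc x (y1 + y2) / (pc x y1 * pc x y2).
Proof.
move=> H; rewrite ratio_rect // prodf_div.
have -> : \prod_(0 <= i < y1) th (x * q ^+ (i + y2)) = pc (x * q ^+ y2) y1.
  by apply: eq_bigr => i _; rewrite addnC exprD mulrA.
have -> : \prod_(0 <= i < y1) th (x * q ^+ (i + 0)) = pc x y1.
  by apply: eq_bigr => i _; rewrite addn0.
have P0 := pc_neq0 (n := y2) (fun i _ => H i); have P1 := pc_neq0 (n := y1) (fun i _ => H i).
by rewrite addnC pcD; field; nonzero.
Qed.

(** Pairs inside one progression. Telescoping leaves the odd powers x q^(2 i + 1) below; with the
    even powers from the diagonal they make up (x)_(2 y), whose second half cancels the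
    numerator. *)
Lemma ratio_tri_low (x : K) y : (forall i, th (x * q ^+ i) != 0) ->
  \prod_(0 <= i < y) \prod_(i.+1 <= i' < y)
     (th (x * q ^+ (i + i').+1) / th (x * q ^+ (i + i')))
  * \prod_(0 <= i < y) (th (x * q ^+ (i + i)))^-1
  = (pc x y)^-1.
Proof.
move=> H; rewrite ratio_tri // prodf_div.
have E n : (\prod_(0 <= i < n) th (x * q ^+ (i + i).+1))
     * \prod_(0 <= i < n) th (x * q ^+ (i + i)) = pc x (n + n).
  elim: n => [|n IH]; first by rewrite !big_geq // mulr1 /pc big_geq.
  by rewrite !big_nat_recr //= addSn addnS !pcS -IH; ring.
have D0 : \prod_(0 <= i < y) th (x * q ^+ (i + i)) != 0.
  by rewrite big_mkord; apply/prodf_neq0 => i _; apply: H.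
have B0 : \prod_(0 <= i < y) th (x * q ^+ (i + i).+1) != 0.
  by rewrite big_mkord; apply/prodf_neq0 => i _; apply: H.
have P0 := pc_neq0 (n := y) (fun i _ => H i).
have -> : \prod_(0 <= i < y) th (x * q ^+ (i + y)) = pc (x * q ^+ y) y.
  by apply: eq_bigr => i _; rewrite addnC exprD mulrA.
have := E y; rewrite pcD prodfV => EE.
apply: (mulfI P0); rewrite divff //; apply: (mulIf (mulf_neq0 B0 D0)).
by rewrite mul1r [RHS]EE; field; nonzero.
Qed.

(** The quotient is the product over the L-shaped set of pairs that meet an initial segment. Written
    as rectangle over rectangle, both products telescope. *)
Lemma ratio_rect_compl (x : K) y1 y2 m1 m2 : (y1 <= m1)%N -> (y2 <= m2)%N ->
  (forall i, th (x * q ^+ i) != 0) ->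
  (\prod_(0 <= i < m1) \prod_(0 <= i' < m2)
     (th (x * q ^+ (i + i').+1) / th (x * q ^+ (i + i'))))
  / (\prod_(y1 <= i < m1) \prod_(y2 <= i' < m2)
     (th (x * q ^+ (i + i').+1) / th (x * q ^+ (i + i'))))
  = pc (x * q ^+ m2) y1 * pc (x * q ^+ m1) y2 / pc x (y1 + y2).
Proof.
move=> le1 le2 H; rewrite ratio_rect_low // ratio_rect // prodf_div.
have H' l i : th (x * q ^+ l * q ^+ i) != 0 by rewrite -mulrA -exprD.
have E t : \prod_(y1 <= i < m1) th (x * q ^+ (i + t)) = pc (x * q ^+ (y1 + t)) (m1 - y1).
  rewrite addnC exprD mulrA -pc_range; apply: eq_bigr => i _.
  by rewrite addnC exprD mulrA.
rewrite !E.
have P t s : pc (x * q ^+ t) s != 0 by apply: pc_neq0.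
have P' s : pc x s != 0 by apply: pc_neq0.
have E1 : pc x (m1 + m2) = pc x m2 * pc (x * q ^+ m2) y1 * pc (x * q ^+ (y1 + m2)) (m1 - y1).
  by rewrite -{1}(subnKC le1) addnC addnA !pcD [(m2 + y1)%N]addnC.
have E2 : pc x m1 * pc (x * q ^+ m1) y2 = pc x (y1 + y2) * pc (x * q ^+ (y1 + y2)) (m1 - y1).
  by rewrite -!pcD; congr pc; move: le1; clear; lia.
rewrite E1; move: E2.
move: (P 0%N 0%N) (P' m1) (P' m2) (P' (y1 + y2)%N) (P (y1 + m2)%N (m1 - y1)%N) (P (y1 + y2)%N (m1
  - y1)%N).
move: (pc x m1) (pc x m2) (pc x (y1 + y2)) (pc (x * q ^+ (y1 + m2)) _) (pc (x * q ^+ (y1 + y2)) _).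
move: (pc (x * q ^+ m2) y1) (pc (x * q ^+ m1) y2) => A B C D F G L _ C0 D0 F0 G0 L0 EE.
apply: (mulIf F0); rewrite divfK //; apply: (mulfI C0); rewrite [RHS]mulrCA EE.
by field; nonzero.
Qed.

(** The same inside one progression; the odd powers left by telescoping are cancelled by the
    diagonal factors th (q z z) of [core]. *)
Lemma ratio_tri_compl (x : K) y m : (y <= m)%N ->
  (forall i, th (x * q ^+ i) != 0) ->
  (\prod_(0 <= i < m) \prod_(i.+1 <= i' < m)
     (th (x * q ^+ (i + i').+1) / th (x * q ^+ (i + i'))))
  / (\prod_(y <= i < m) \prod_(i.+1 <= i' < m)
     (th (x * q ^+ (i + i').+1) / th (x * q ^+ (i + i'))))
  * \prod_(0 <= i < y) th (x * q ^+ (i + i).+1)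
  = pc (x * q ^+ m) y.
Proof.
move=> le H; rewrite !ratio_tri // (big_cat_nat _ le) //= mulfK; last first.
  elim/big_rec: _ => [|i t _ t0]; first exact: oner_neq0.
  by have H1 := H (i + m)%N; have H2 := H (i + i).+1; nonzero.
rewrite -big_split /=; apply: eq_bigr => i _; rewrite divfK //.
by rewrite addnC exprD mulrA.
Qed.

Variables (n : nat) (m : 'I_n -> nat) (z : 'I_n -> K).
Hypothesis z0 : forall k, z k != 0.

(* The cell (k, i) stands for the point z k * q ^+ i of the k-th progression. *)
Definition cell : finType := {k : 'I_n & 'I_(m k)}.

Definition wz (x : cell) : K := z (tag x) * q ^+ (tagged x : 'I_(m (tag x))).

(** Comparing progressions first makes the pairs from different progressions appear exactly as the
    products over j < k of the statement. *)
Definition lex_cell : rel cell := fun x y =>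
  (tag x < tag y)%N || ((tag x == tag y)
     && ((tagged x : 'I_(m (tag x))) < (tagged y : 'I_(m (tag y))))%N).

Definition block (l h : 'I_n -> nat) : {set cell} :=
  [set x : cell | (l (tag x) <= (tagged x : 'I_(m (tag x))) < h (tag x))%N].

Lemma lex_cell_irr : irreflexive lex_cell.
Proof. by move=> x; rewrite /lex_cell !ltnn andbF. Qed.

Lemma lex_cell_total (x y : cell) : x != y -> lex_cell x y = ~~ lex_cell y x.
Proof.
case: x y => [k i] [k' i']; rewrite /lex_cell /= => neq.
case: (ltngtP k k') => [lt|gt|/val_inj E] /=; rewrite -?val_eqE.
- by rewrite negb_and gtn_eqF.
- by rewrite gtn_eqF.
subst k'; rewrite eqxx /=.
case: (ltngtP i i') => // /val_inj E.
by move: neq; rewrite E eqxx.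
Qed.

Section CellBigop.
Variables (R : Type) (idx : R) (op : Monoid.com_law idx).

Lemma big_cell (P : 'I_n -> nat -> bool) (G : 'I_n -> nat -> R) :
  \big[op/idx]_(x : cell | P (tag x) (tagged x : 'I_(m (tag x))))
    G (tag x) (tagged x : 'I_(m (tag x)))
  = \big[op/idx]_(k < n) \big[op/idx]_(i < m k | P k i) G k i.
Proof.
by rewrite (sig_big_dep xpredT (fun k (i : 'I_(m k)) => P k i)
  (fun k (i : 'I_(m k)) => G k i)).
Qed.

Lemma big_ord_range (l h N : nat) (G : nat -> R) : (h <= N)%N ->
  \big[op/idx]_(i < N | (l <= i < h)%N) G i = \big[op/idx]_(l <= i < h) G i.
Proof.
move=> hN; rewrite (big_nat_widen _ _ _ _ _ hN) (big_nat_widenl _ 0) // big_mkord.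
by apply: eq_bigl => i; rewrite /= andbC.
Qed.

Lemma big_block (l h : 'I_n -> nat) (G : 'I_n -> nat -> R) :
  (forall k, (h k <= m k)%N) ->
  \big[op/idx]_(x in block l h) G (tag x) (tagged x : 'I_(m (tag x)))
  = \big[op/idx]_(k < n) \big[op/idx]_(l k <= i < h k) G k i.
Proof.
move=> hm; rewrite (eq_bigl _ _ (in_set _)).
rewrite (big_cell (fun k i => (l k <= i < h k)%N)).
by apply: eq_bigr => k _; rewrite big_ord_range.
Qed.
End CellBigop.

Lemma pairs_block (l h : 'I_n -> nat) (G : 'I_n -> nat -> 'I_n -> nat -> K) :
  (forall k, (h k <= m k)%N) ->
  pairs lex_cell (fun x y : cell => G (tag x) (tagged x : 'I_(m (tag x)))
    (tag y) (tagged y : 'I_(m (tag y)))) (block l h)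
  = (\prod_(j < n) \prod_(k < n | (j < k)%N)
       \prod_(l j <= i < h j) \prod_(l k <= i' < h k) G j i k i')
    * \prod_(j < n) \prod_(l j <= i < h j) \prod_(i.+1 <= i' < h j) G j i j i'.
Proof.
move=> hm; rewrite /pairs.
transitivity (\prod_(x in block l h)
  ((\prod_(k < n | (tag x < k)%N) \prod_(l k <= i' < h k)
      G (tag x) (tagged x : 'I_(m (tag x))) k i')
   * \prod_((tagged x : 'I_(m (tag x))).+1 <= i' < h (tag x))
      G (tag x) (tagged x : 'I_(m (tag x))) (tag x) i')).
  apply: eq_bigr => x; rewrite inE => /andP[lx _].
  pose P k i := (l k <= i < h k)%N && ((tag x < k)%N ||
      ((tag x == k) && ((tagged x : 'I_(m (tag x))) < i)%N)).
  transitivity (\prod_(y : cell | P (tag y) (tagged y : 'I_(m (tag y))))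
    G (tag x) (tagged x : 'I_(m (tag x))) (tag y) (tagged y : 'I_(m (tag y)))).
    by apply: eq_bigl => y; rewrite inE.
  rewrite (big_cell _ P) (bigID (fun k : 'I_n => (tag x < k)%N)) /=; congr (_ * _).
    apply: eq_bigr => k xk; rewrite -(big_ord_range _ _ _ (hm k)).
    by apply: eq_bigl => i; rewrite /P xk andbT.
  rewrite (bigD1 (tag x)) ?ltnn //= [X in _ * X]big1 ?mulr1; last first.
    move=> k /andP[/negbTE xk kx]; rewrite big_pred0 // => i.
    by rewrite /P xk eq_sym (negbTE kx) andbF.
  rewrite -(big_ord_range _ _ _ (hm _)); apply: eq_bigl => i.
  rewrite /P ltnn eqxx /=; apply/andP/andP => [[/andP[_ -> ->]] //|[xi ->]].
  by rewrite xi (leq_trans lx (ltnW xi)).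
rewrite big_split /=; congr (_ * _).
  rewrite (big_block _ l (fun j i => \prod_(k < n | (j < k)%N) \prod_(l k <= i' < h k) G j i k
    i')) //.
  by apply: eq_bigr => j _; rewrite exchange_big.
by rewrite (big_block _ l (fun j i => \prod_(i.+1 <= i' < h j) G j i j i')).
Qed.

Lemma prod_square (F : 'I_n -> 'I_n -> K) :
  \prod_(j < n) \prod_(k < n) F j k
  = \prod_(k < n) F k k * \prod_(j < n) \prod_(k < n | (j < k)%N) (F j k * F k j).
Proof.
transitivity (\prod_(j < n) (F j j * (\prod_(k < n | (j < k)%N) F j k
    * \prod_(k < n | (k < j)%N) F j k))).
  apply: eq_bigr => j _; rewrite (bigD1 j) //=; congr (_ * _).
  rewrite (bigID (fun k : 'I_n => (j < k)%N)) /=; congr (_ * _); apply: eq_bigl => k.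
    by rewrite -val_eqE /=; case: ltngtP.
  by rewrite -val_eqE /=; case: ltngtP.
rewrite big_split /= big_split /=; congr (_ * _).
rewrite [X in _ * X](exchange_big_dep xpredT) //= -big_split /=.
by apply: eq_bigr => j _; rewrite -big_split.
Qed.

Lemma pc_flip (x : K) s : x != 0 ->
  pc (x / q ^+ s) s * q ^+ ('C(s, 2) + s) = (- x) ^+ s * pc (q / x) s.
Proof.
move=> x0; rewrite /pc; elim: s => [|s IH]; first by rewrite !big_geq // !expr0.
rewrite big_nat_recl // big_nat_recr //= binS bin1 expr0 mulr1.
have -> : \prod_(0 <= i < s) th (x / q ^+ s.+1 * q ^+ i.+1)
   = \prod_(0 <= i < s) th (x / q ^+ s * q ^+ i).
  apply: eq_bigr => i _; congr th; rewrite !exprS; have := expf_neq0 s q0.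
  by move: (q ^+ s) (q ^+ i) => X Y X0; field; nonzero.
rewrite (th_flip thV) //; last by nonzero.
have -> : q / x * q ^+ s = q ^+ s.+1 / x by rewrite exprS mulrAC.
rewrite [q ^+ (_ + s.+1)]exprD [(- x) ^+ s.+1]exprS.
rewrite [RHS](_ : _ = - x * th (q ^+ s.+1 / x)
   * ((- x) ^+ s * \prod_(0 <= i < s) th (q / x * q ^+ i))); last by ring.
rewrite -IH; have := expf_neq0 s.+1 q0; move: (q ^+ s.+1) => Q Q0.
by field; nonzero.
Qed.

(** To be used with u = z k / z j, s = y j, t = y k. The s + t + 1 consecutive thetas starting at u
    / q^s are cut in two ways: after t of them, where the theta of the shifted Vandermonde factor
    follows, and after s of them, where th u follows. Reflecting the leftover runs gives the
    remaining symbols. *)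
Lemma pc_flip_pair (u : K) s t : u != 0 ->
  q ^+ s * th (u * q ^+ t / q ^+ s) * (pc (u / q ^+ s) t * pc (u^-1 / q ^+ t) s)
    * q ^+ (s * t)
  = th u * (pc (q * u) t * pc (q / u) s).
Proof.
move=> u0; have Qs := expf_neq0 s q0; have Qt := expf_neq0 t q0.
have E1 : pc (u / q ^+ s) t * th (u * q ^+ t / q ^+ s) * pc (u * q ^+ t.+1 / q ^+ s) s
   = pc (u / q ^+ s) s * th u * pc (q * u) t.
  transitivity (pc (u / q ^+ s) (t + s.+1)).
    rewrite pcD pcSl mulrA; congr (_ * th _ * pc _ _); first by field; nonzero.
    by rewrite exprS; field; nonzero.
  rewrite addnC addSn -addnS pcD pcSl mulrA; congr (_ * th _ * pc _ _); field; nonzero.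
have E2 : pc (u^-1 / q ^+ t) s * q ^+ (s * t)
   = (- u^-1) ^+ s * q ^+ 'C(s, 2) * pc (u * q ^+ t.+1 / q ^+ s) s.
  have E : pc (u^-1 / q ^+ t) s * q ^+ (t * s) = (- u^-1) ^+ s * q ^+ 'C(s, 2)
     * \prod_(0 <= i < s) th (u * q ^+ t / q ^+ i).
    rewrite /pc; elim: s {Qs E1} => [|s IH]; first by rewrite !big_geq // muln0 !expr0 !mulr1.
    rewrite !big_nat_recr //= mulnS exprD binS bin1 exprD exprS.
    rewrite [RHS](_ : _ = - u^-1 * q ^+ s * th (u * q ^+ t / q ^+ s) * ((- u^-1) ^+ s
      * q ^+ 'C(s, 2) * \prod_(0 <= i < s) th (u * q ^+ t / q ^+ i))); last by ring.
    rewrite -IH; have Qs := expf_neq0 s q0.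
    have -> : u^-1 / q ^+ t * q ^+ s = q ^+ s / (u * q ^+ t) by field; nonzero.
    rewrite [th (q ^+ s / _)](th_flip thV); [|nonzero|nonzero].
    by move: (q ^+ (t * s)) => X; field; nonzero.
  rewrite mulnC E pc_rev // subn0; congr (_ * pc _ _).
  by rewrite exprS; ring.
have := pc_flip s u0; rewrite exprD => E3.
rewrite [LHS](_ : _ = q ^+ s * (pc (u / q ^+ s) t * th (u * q ^+ t / q ^+ s))
   * (pc (u^-1 / q ^+ t) s * q ^+ (s * t))); last by ring.
rewrite E2.
rewrite [LHS](_ : _ = q ^+ s * ((- u^-1) ^+ s * q ^+ 'C(s, 2)) *
  (pc (u / q ^+ s) t * th (u * q ^+ t / q ^+ s) * pc (u * q ^+ t.+1 / q ^+ s) s)); last by ring.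
rewrite E1.
rewrite [LHS](_ : _ = (- u^-1) ^+ s * (pc (u / q ^+ s) s * (q ^+ 'C(s, 2) * q ^+ s))
   * (th u * pc (q * u) t)); last by ring.
rewrite E3.
rewrite [LHS](_ : _ = ((- u^-1) ^+ s * (- u) ^+ s) * pc (q / u) s * (th u * pc (q * u) t));
  last by ring.
by rewrite -exprMn mulrNN mulVf // expr1n; ring.
Qed.

Lemma bin2_mulnE N : ('C(N, 2) + N + ('C(N, 2) + N) = N * N + N)%N.
Proof. by elim: N => // N IH; rewrite binS bin1; move: IH; move: 'C(N, 2) => C; clear; nia. Qed.

(** Both sides are half of N^2 + N, with the square of the sum expanded. *)
Lemma bin2_sum_ord (y : 'I_n -> nat) : let N := (\sum_(k < n) y k)%N in
  ('C(N, 2) + N = \sum_(k < n) ('C(y k, 2) + y k)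
     + \sum_(j < n) \sum_(k < n | (j < k)%N) y j * y k)%N.
Proof.
move=> N.
have E : (N * N = \sum_(k < n) y k * y k + 2 * \sum_(j < n) \sum_(k < n | (j < k)%N) y j * y k)%N.
  rewrite {1}/N big_distrl /= (eq_bigr (fun j => \sum_(k < n) y j * y k)%N); last first.
    by move=> j _; rewrite big_distrr.
  transitivity (\sum_(j < n) (y j * y j + (\sum_(k < n | (j < k)%N) y j * y k
      + \sum_(k < n | (k < j)%N) y j * y k)))%N.
    apply: eq_bigr => j _; rewrite (bigD1 j) //=; congr (_ + _)%N.
    rewrite (bigID (fun k : 'I_n => (j < k)%N)) /=; congr (_ + _)%N; apply: eq_bigl => k.
      by rewrite -val_eqE /=; case: ltngtP.
    by rewrite -val_eqE /=; case: ltngtP.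
  rewrite big_split /= big_split /=; congr (_ + _)%N.
  rewrite [X in (_ + X)%N](exchange_big_dep xpredT) //= mul2n -addnn; congr (_ + _)%N.
  by apply: eq_bigr => j _; apply: eq_bigr => k _; rewrite mulnC.
have E2 : (\sum_(k < n) ('C(y k, 2) + y k) + \sum_(k < n) ('C(y k, 2) + y k)
   = \sum_(k < n) y k * y k + N)%N.
  by rewrite -!big_split /=; apply: eq_bigr => k _; rewrite bin2_mulnE.
have := bin2_mulnE N; move: E E2.
move: (\sum_(k < n) y k * y k)%N (\sum_(k < n) ('C(y k, 2) + y k))%N => A B.
move: (\sum_(j < n) \sum_(k < n | (j < k)%N) y j * y k)%N ('C(N, 2)) => D C.
clearbody N; clear; lia.
Qed.

Definition vdm (x : 'I_n -> K) : K :=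
  \prod_(j < n) \prod_(k < n | (j < k)%N) (x j * th (x k / x j)).

(** The source of the quotient of Vandermonde products: [pc_flip_pair] for each j < k, [pc_flip] at
    x = 1 on the diagonal, and [bin2_sum_ord] for the total power of q. *)
Lemma vdm_shift (y : 'I_n -> nat) : let N := (\sum_(k < n) y k)%N in
  vdm (fun k => z k * q ^+ y k)
  * (\prod_(j < n) \prod_(k < n) pc (z k / (z j * q ^+ y j)) (y k))
  * q ^+ ('C(N, 2) + N)
  = (-1) ^+ N * vdm z * \prod_(j < n) \prod_(k < n) pc (q * z k / z j) (y k).
Proof.
move=> N; rewrite !prod_square bin2_sum_ord exprD /N -!prodrXr.
under [\prod_(j < n) q ^+ (\sum_(k < n | _) _)]eq_bigr => j _ do rewrite -prodrXr.
rewrite [RHS]mulrA [RHS](_ : _ = (\prod_(k < n) ((-1) ^+ y k * pc (q * z k / z k) (y k)))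
  * (vdm z * \prod_(j < n) \prod_(k < n | (j < k)%N)
       (pc (q * z k / z j) (y k) * pc (q * z j / z k) (y j)))); last first.
  by rewrite big_split /=; ring.
rewrite [LHS](_ : _ = (\prod_(k < n) (pc (z k / (z k * q ^+ y k)) (y k)
     * q ^+ ('C(y k, 2) + y k)))
  * \prod_(j < n) \prod_(k < n | (j < k)%N)
     (z j * q ^+ y j * th (z k * q ^+ y k / (z j * q ^+ y j))
      * (pc (z k / (z j * q ^+ y j)) (y k) * pc (z j / (z k * q ^+ y k)) (y j))
      * q ^+ (y j * y k))); last first.
  rewrite big_split /=.
  under [X in _ = _ * X]eq_bigr => j _ do rewrite !big_split /=.
  rewrite !big_split /= /vdm.
  under [\prod_(j < n) \prod_(k < n | (j < k)%N) (z j * _ * _)]eq_bigr => j _ do rewrite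
    !big_split /=.
  under [\prod_(j < n) \prod_(k < n | (j < k)%N) (pc _ _ * _)]eq_bigr => j _ do rewrite
    !big_split /=.
  rewrite !big_split /=; ring.
congr (_ * _).
  apply: eq_bigr => k _.
  have -> : z k / (z k * q ^+ y k) = 1 / q ^+ y k.
    by have H := expf_neq0 (y k) q0; field; nonzero.
  by rewrite pc_flip ?oner_neq0 // -mulrA divff // mulr1 divr1.
rewrite /vdm -big_split /=; apply: eq_bigr => j _.
rewrite -big_split /=; apply: eq_bigr => k _.
have u0 : z k / z j != 0 by nonzero.
have Qj := expf_neq0 (y j) q0; have Qk := expf_neq0 (y k) q0.
have -> : z k / (z j * q ^+ y j) = (z k / z j) / q ^+ y j by field; nonzero.
have -> : z j / (z k * q ^+ y k) = (z k / z j)^-1 / q ^+ y k by field; nonzero.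
have -> : z k * q ^+ y k / (z j * q ^+ y j) = z k / z j * q ^+ y k / q ^+ y j by field; nonzero.
have -> : q * z k / z j = q * (z k / z j) by rewrite mulrA.
have -> : q * z j / z k = q / (z k / z j) by field; nonzero.
by rewrite -[RHS]mulrA -pc_flip_pair //; ring.
Qed.

(** * Evaluation of the subset term on initial segments of the progressions *)

Section Block.
Variable y : 'I_n -> nat.
Hypothesis ym : forall k, (y k <= m k)%N.
Let N := (\sum_(k < n) y k)%N.

Definition low : {set cell} := block (fun=> 0%N) y.

Lemma setT_block : [set: cell] = block (fun=> 0%N) m.
Proof. by apply/setP => x; rewrite !inE /= ltn_ord. Qed.

Lemma setTDlow : [set: cell] :\: low = block y m.
Proof. by apply/setP => x; rewrite !inE /= -leqNgt ltn_ord !andbT. Qed.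

Lemma card_low : #|low| = N.
Proof.
rewrite -sum1_card (big_block _ _ (fun _ _ => 1%N)) //.
by apply: eq_bigr => k _; rewrite sum_nat_const_nat subn0 muln1.
Qed.

Lemma prod_low (G : 'I_n -> nat -> K) (F : cell -> K) :
  (forall x : cell, F x = G (tag x) (tagged x : 'I_(m (tag x)))) ->
  \prod_(x in low) F x = \prod_(k < n) \prod_(0 <= i < y k) G k i.
Proof. by move=> FG; rewrite -(big_block _ _ G) //; apply: eq_bigr => x _. Qed.

Lemma prod_high (G : 'I_n -> nat -> K) (F : cell -> K) :
  (forall x : cell, F x = G (tag x) (tagged x : 'I_(m (tag x)))) ->
  \prod_(x in [set: cell] :\: low) F x = \prod_(k < n) \prod_(y k <= i < m k) G k i.
Proof.
by move=> FG; rewrite setTDlow -(big_block _ _ G) //; apply: eq_bigr => x _.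
Qed.

Lemma prod_full (G : 'I_n -> nat -> K) (F : cell -> K) :
  (forall x : cell, F x = G (tag x) (tagged x : 'I_(m (tag x)))) ->
  \prod_(x in [set: cell]) F x = \prod_(k < n) \prod_(0 <= i < m k) G k i.
Proof.
by move=> FG; rewrite setT_block -(big_block _ _ G) //; apply: eq_bigr => x _.
Qed.

Hypothesis gen_rat : forall j k i l, (i <= m k)%N -> (l <= m j)%N ->
  (j != k) || (i != l) -> th (z k * q ^+ i / (z j * q ^+ l)) != 0.

(** For each point of an initial segment the quotients telescope along the complementary part of
    every progression; its ends l = m j and l = y j give the two symbols. *)
Lemma mixed_low : mixed th q wz [set: cell] low
  = \prod_(j < n) \prod_(k < n)
      (pc (q ^- m j * z k / z j) (y k) / pc (z k / (z j * q ^+ y j)) (y k)).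
Proof.
rewrite /mixed (prod_low (G := fun k i => \prod_(j < n) \prod_(y j <= l < m j)
  (th (z k * q ^+ i / (z j * q ^+ l.+1)) / th (z k * q ^+ i / (z j * q ^+ l))))); last first.
  move=> x; apply: prod_high => x'; congr (th _ / th _); rewrite /wz.
  by rewrite exprS mulrCA.
rewrite [RHS]exchange_big; apply: eq_bigr => k _.
rewrite exchange_big; apply: eq_bigr => j _.
rewrite -prodf_div; apply: eq_big_nat => i /andP[_ iy].
have im : (i <= m k)%N by apply: leq_trans (ltnW iy) (ym k).
rewrite (telescope_pos (f := fun l => th (z k * q ^+ i / (z j * q ^+ l)))) //.
  have Qm := expf_neq0 (m j) q0; have Qy := expf_neq0 (y j) q0.
  by congr (th _ / th _); field; nonzero.
move=> l /andP[yl lm]; apply: gen_rat => //.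
(* Within one progression i < y k <= l, so the exponents differ. *)
case: eqP => //= jk; subst k; rewrite neq_ltn (leq_trans iy yl) //.
Qed.

Lemma shift_low : vdm z != 0 ->
  (forall j k, pc (q * z k / z j) (y k) != 0) ->
  (-1) ^+ N / q ^+ 'C(N, 2) * mixed th q wz [set: cell] low
  = vdm (fun k => z k * q ^+ y k) / vdm z * q ^+ N
    * ((\prod_(j < n) \prod_(k < n) pc (q ^- m j * z k / z j) (y k))
       / \prod_(j < n) \prod_(k < n) pc (q * z k / z j) (y k)).
Proof.
move=> V0 P0; rewrite mixed_low.
under eq_bigr => j _ do rewrite prodf_div.
rewrite prodf_div; have := vdm_shift y; cbv zeta; rewrite -/N exprD.
have X0 : \prod_(j < n) \prod_(k < n) pc (z k / (z j * q ^+ y j)) (y k) != 0.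
  do 2!(apply/prodf_neq0 => ? _); apply: pc_neq0 => i iy.
  rewrite mulrAC; apply: gen_rat => //; first by apply: leq_trans (ltnW iy) (ym _).
  by case: eqP => //= jk; subst; rewrite neq_ltn iy.
have Y0 : \prod_(j < n) \prod_(k < n) pc (q * z k / z j) (y k) != 0.
  by do 2!(apply/prodf_neq0 => ? _).
have QN := expf_neq0 N q0; have QC := expf_neq0 'C(N, 2) q0.
set X := \prod_(j < n) _ in X0 *; set Y := \prod_(j < n) _ in Y0 *.
move: X0 Y0 V0 QN QC; move: X Y (vdm z) (q ^+ N) (q ^+ 'C(N, 2)).
move=> X Y V Q Q' X0 Y0 V0 QN QC E; set M := \prod_(j < n) _.
apply: (mulIf (mulf_neq0 (mulf_neq0 QC X0) (mulf_neq0 V0 Y0))).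
transitivity ((-1) ^+ N * V * Y * M); first by field; nonzero.
by rewrite -E; field; nonzero.
Qed.

Hypothesis gen_zz : forall j k i, th (z j * z k * q ^+ i) != 0.

Lemma pairs1_low :
  pairs lex_cell (ratio th q wz 1) [set: cell]
  / pairs lex_cell (ratio th q wz 1) ([set: cell] :\: low)
  * \prod_(x in low) th (q * wz x * wz x)
  = (\prod_(j < n) \prod_(k < n) pc (q ^+ m j * z j * z k) (y k))
    / \prod_(j < n) \prod_(k < n | (j < k)%N) pc (z j * z k) (y j + y k).
Proof.
pose G j i k i' := th (z j * z k * q ^+ (i + i').+1) / th (z j * z k * q ^+ (i + i')).
have GE (x x' : cell) : ratio th q wz 1 x x'
   = G (tag x) (tagged x : 'I_(m (tag x))) (tag x') (tagged x' : 'I_(m (tag x'))).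
  by rewrite /ratio /G /wz exprS !exprD; congr (th _ / th _); ring.
have pE A : pairs lex_cell (ratio th q wz 1) A = pairs lex_cell
   (fun x x' : cell => G (tag x) (tagged x : 'I_(m (tag x))) (tag x')
      (tagged x' : 'I_(m (tag x')))) A.
  by apply: eq_bigr => x _; apply: eq_bigr => x' _; exact: GE.
rewrite !pE setTDlow setT_block !pairs_block //.
rewrite (prod_low (G := fun k i => th (z k * z k * q ^+ (i + i).+1))); last first.
  by move=> x; rewrite /wz exprS exprD; congr th; ring.
set A1 := \prod_(j < n) _; set A2 := \prod_(j < n) _; set A3 := \prod_(j < n) _.
set A4 := \prod_(j < n) _; set A5 := \prod_(k < n) _.
have -> : A1 * A2 / (A3 * A4) * A5 = (A1 / A3) * (A2 / A4 * A5).
  by rewrite invfM; ring.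
have -> : A2 / A4 * A5 = \prod_(k < n) pc (z k * z k * q ^+ m k) (y k).
  rewrite /A2 /A4 /A5 -prodf_div -big_split /=; apply: eq_bigr => k _.
  exact: ratio_tri_compl.
have -> : A1 / A3 = \prod_(j < n) \prod_(k < n | (j < k)%N)
   (pc (z j * z k * q ^+ m k) (y j) * pc (z j * z k * q ^+ m j) (y k)
      / pc (z j * z k) (y j + y k)).
  rewrite /A1 /A3 -prodf_div; apply: eq_bigr => j _.
  by rewrite -prodf_div; apply: eq_bigr => k _; apply: ratio_rect_compl.
rewrite prod_square mulrC -[RHS]mulrA; congr (_ * _).
  by apply: eq_bigr => k _; congr pc; ring.
rewrite -prodf_div; apply: eq_bigr => j _; rewrite -prodf_div; apply: eq_bigr => k _.
by congr (_ / _); rewrite mulrC; congr (pc _ _ * pc _ _); ring.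
Qed.

Lemma pairst_low (t : K) : (forall j k i, th (t * z j * z k * q ^+ i) != 0) ->
  pairs lex_cell (ratio th q wz t) low
  * \prod_(x in low) (th (t * wz x * wz x))^-1
  = (\prod_(j < n) \prod_(k < n | (j < k)%N) pc (t * z j * z k) (y j + y k))
    / \prod_(j < n) \prod_(k < n) pc (t * z j * z k) (y k).
Proof.
move=> gen_t.
pose G j i k i' := th (t * z j * z k * q ^+ (i + i').+1) / th (t * z j * z k * q ^+ (i + i')).
have GE (x x' : cell) : ratio th q wz t x x'
   = G (tag x) (tagged x : 'I_(m (tag x))) (tag x') (tagged x' : 'I_(m (tag x'))).
  by rewrite /ratio /G /wz exprS !exprD; congr (th _ / th _); ring.
have -> : pairs lex_cell (ratio th q wz t) low = pairs lex_cell
   (fun x x' : cell => G (tag x) (tagged x : 'I_(m (tag x))) (tag x')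
      (tagged x' : 'I_(m (tag x')))) low.
  by apply: eq_bigr => x _; apply: eq_bigr => x' _; exact: GE.
rewrite pairs_block //.
rewrite (prod_low (G := fun k i => (th (t * z k * z k * q ^+ (i + i)))^-1)); last first.
  by move=> x; rewrite /wz exprD; congr (th _)^-1; ring.
rewrite -mulrA -big_split /=.
under [X in _ * X = _]eq_bigr => k _ do rewrite ratio_tri_low //.
under eq_bigr => j _ do under eq_bigr => k _ do rewrite ratio_rect_low //.
rewrite prod_square invfM [X in _ = _ * X]mulrC mulrA prodfV; congr (_ * _).
rewrite -prodf_div; apply: eq_bigr => j _; rewrite -prodf_div; apply: eq_bigr => k _.
by rewrite [t * z k * z j]mulrAC [pc _ (y j) * _]mulrC.
Qed.

(** Progression by progression, all reduces to cutting one run of consecutive thetas in two ways: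
    [Ex] for the arguments in a / z k and [Ea] for those in a * z k. *)
Lemma single_low (a : K) : a != 0 ->
  (forall k i, th (a * z k * q ^+ i) != 0) ->
  (forall k i, th (a * q / (z k * q ^+ m k) * q ^+ i) != 0) ->
  \prod_(x in low) (th (a * wz x * q ^+ N))^-1
  * \prod_(x in [set: cell] :\: low)
      (th (a * q ^+ N / wz x) / th (a * wz x * q ^+ N.+1))
  * \prod_(x in [set: cell]) (th (a * q * wz x) / th (a / wz x))
  = \prod_(k < n) (th (a * z k * q ^+ (y k + N)) / th (a * z k))
    * \prod_(j < n) ((pc (a * z j) N * pc (a * q / z j) (N - y j))
        / (pc (a * q ^+ (1 + m j) * z j) N * pc (a * q / (z j * q ^+ m j)) N)).
Proof.
move=> a0 gen_az gen_aVz.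
rewrite (prod_low (G := fun k i => (th (a * z k * q ^+ N * q ^+ i))^-1)); last first.
  by move=> x; rewrite /wz; congr (th _)^-1; ring.
rewrite (prod_high (G := fun k i => th (a * q ^+ N / z k / q ^+ i)
    / th (a * z k * q ^+ N.+1 * q ^+ i))); last first.
  by move=> x; rewrite /wz invfM; congr (th _ / th _); ring.
rewrite (prod_full (G := fun k i => th (a * q * z k * q ^+ i)
    / th (a / z k / q ^+ i))); last first.
  by move=> x; rewrite /wz invfM; congr (th _ / th _); ring.
rewrite -!big_split /=; apply: eq_bigr => k _.
have ykN : (y k <= N)%N by rewrite /N (bigD1 k) //= leq_addr.
have Qm := expf_neq0 (m k) q0.
rewrite prodfV !prodf_div !pc_range !pc_rev // !subn0 expr0 !mulr1.
set x := a * q / (z k * q ^+ m k).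
have -> : a * q ^+ N / z k * q / q ^+ m k = x * q ^+ N by rewrite /x; field; nonzero.
have -> : a / z k * q / q ^+ m k = x by rewrite /x; field; nonzero.
have -> : a * q / z k = x * q ^+ m k by rewrite /x; field; nonzero.
have Ex : pc x (m k) * pc (x * q ^+ m k) (N - y k) = pc x N * pc (x * q ^+ N) (m k - y k).
  by rewrite -!pcD; congr pc; move: ykN (ym k); clear; lia.
have Ea : th (a * z k) * pc (a * q * z k) (m k) * pc (a * q ^+ (1 + m k) * z k) N
  = pc (a * z k) N * pc (a * z k * q ^+ N) (y k) * th (a * z k * q ^+ (y k + N))
    * pc (a * z k * q ^+ N.+1 * q ^+ y k) (m k - y k).
  have -> : a * q * z k = a * z k * q by rewrite mulrAC.
  have -> : a * q ^+ (1 + m k) * z k = a * z k * q ^+ (m k).+1 by rewrite mulrAC.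
  have -> : a * z k * q ^+ N.+1 * q ^+ y k = a * z k * q ^+ (N + y k).+1.
    by rewrite -mulrA -exprD.
  rewrite -pcSl -pcD -pcD [(y k + N)%N]addnC -pcS -pcD; congr pc.
  by move: (ym k); clear; lia.
have P0 b s : (forall i, th (b * q ^+ i) != 0) -> pc b s != 0.
  by move=> H; apply: pc_neq0.
have H1 := P0 _ (m k) (gen_aVz k); have H2 := P0 _ N (gen_aVz k).
have H0 : th (a * z k) != 0 by have := gen_az k 0; rewrite expr0 mulr1.
have H3 : pc (a * z k * q ^+ N) (y k) != 0.
  by apply: P0 => i; have := gen_az k (N + i); rewrite exprD mulrA.
have H4 : pc (a * z k * q ^+ N.+1 * q ^+ y k) (m k - y k) != 0.
  by apply: P0 => i; have := gen_az k (N.+1 + y k + i); rewrite !exprD !mulrA.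
have H5 : pc (a * q ^+ (1 + m k) * z k) N != 0.
  by apply: P0 => i; have := gen_az k (1 + m k + i); congr (th _ != 0);
    rewrite [q ^+ (_ + i)]exprD; ring.
rewrite -/x in H1 H2.
move: Ex Ea H0 H1 H2 H3 H4 H5.
move: (pc x _) (pc x N) (pc (x * q ^+ m k) _) (pc (x * q ^+ N) _) (th (a * z k))
  (pc (a * q * z k) _) (pc (a * q ^+ (1 + m k) * z k) _) (pc (a * z k) N)
  (pc (a * z k * q ^+ N) _) (th (a * z k * q ^+ (y k + N))) (pc (a * z k * q ^+ N.+1 * q ^+ y k) _).
move=> A B C D E F G H L M P Ex Ea *.
apply: (@etrans _ _ ((E * F * G) * D / (E * L * P * A * G))); first by field; nonzero.
rewrite Ea; apply: (@etrans _ _ (H * M * (A * C) / (E * A * B * G))); last by field; nonzero.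
by rewrite Ex; field; nonzero.
Qed.

Lemma pc_low (x : K) : \prod_(t in low) th (x * wz t) = \prod_(k < n) pc (x * z k) (y k).
Proof.
by rewrite (prod_low (G := fun k i => th (x * z k * q ^+ i))) // => t; rewrite /wz mulrA.
Qed.

Lemma desc_low (d : K) : (forall k i, th (d / z k * q ^+ i) != 0) ->
  \prod_(t in low) th (d * q ^+ N / (q * wz t))
  = \prod_(k < n) (pc (d / z k) N / pc (d / z k) (N - y k)).
Proof.
move=> gen_d.
rewrite (prod_low (G := fun k i => th (d * q ^+ N / q / z k / q ^+ i))); last first.
  by move=> t; rewrite /wz !invfM; congr th; ring.
apply: eq_bigr => k _; rewrite pc_rev // subn0.
have ykN : (y k <= N)%N by rewrite /N (bigD1 k) //= leq_addr.
have P0 : pc (d / z k) (N - y k) != 0 by apply: pc_neq0.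
have -> : pc (d / z k) N = pc (d / z k) (N - y k) * pc (d / z k * q ^+ (N - y k)) (y k).
  by rewrite -pcD subnK.
rewrite [RHS]mulrAC divff // mul1r; congr pc.
have Q0 := expf_neq0 (N - y k) q0; have Q1 := expf_neq0 (y k) q0.
by rewrite -{1}(subnK ykN) exprD; field; nonzero.
Qed.

(** The subtraction N - y j never truncates, as y j is one of the terms of N. The argument a q^(1 -
    m j) / z j is written with natural exponents only. *)
Definition summand (a b c d e f : K) : K :=
  vdm (fun k => z k * q ^+ y k) / vdm z
  * (\prod_(k < n) (th (a * z k * q ^+ (y k + N)) / th (a * z k)))
  * (\prod_(j < n) ((pc (a * z j) N * pc (d / z j) N * pc (a * q / z j) (N - y j))
      / (pc (a * q ^+ (1 + m j) * z j) N * pc (a * q / (z j * q ^+ m j)) N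
         * pc (d / z j) (N - y j))))
  * (\prod_(j < n) \prod_(k < n)
      (pc (q ^- m j * z k / z j) (y k) * pc (q ^+ m j * z j * z k) (y k)
       / (pc (q * z k / z j) (y k) * pc (a * q / d * z j * z k) (y k))))
  * (\prod_(j < n) \prod_(k < n | (j < k)%N)
      (pc (a * q / d * z j * z k) (y j + y k) / pc (z j * z k) (y j + y k)))
  * (\prod_(k < n) (pc (b * z k) (y k) * pc (c * z k) (y k)
      / (pc (a * q / e * z k) (y k) * pc (a * q / f * z k) (y k))))
  * (pc e N * pc f N / (pc (a * q / b) N * pc (a * q / c) N))
  * q ^+ N.

Lemma low_summand (a b c d e f : K) : a != 0 ->
  vdm z != 0 -> (forall j k, pc (q * z k / z j) (y k) != 0) ->
  (forall k i, th (a * z k * q ^+ i) != 0) ->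
  (forall k i, th (a * q / (z k * q ^+ m k) * q ^+ i) != 0) ->
  (forall k i, th (d / z k * q ^+ i) != 0) ->
  (forall j k i, th (a * q / d * z j * z k * q ^+ i) != 0) ->
  core th q lex_cell wz a e f [set: cell] low * inner th q lex_cell wz a b c d low
  = summand a b c d e f.
Proof.
move=> a0 V0 P0 g1 g2 g3 g4.
have E1 := shift_low V0 P0; have E2 := pairs1_low; have E3 := pairst_low g4.
have E4 := single_low a0 g1 g2; have E5 := desc_low g3.
rewrite /core /inner card_low.
have -> : \prod_(x in low) (th (q * wz x * wz x) / (th (a * wz x * q ^+ N)
      * (th (a * q * wz x / e) * th (a * q * wz x / f))))
   = (\prod_(x in low) th (q * wz x * wz x))
     * (\prod_(x in low) (th (a * wz x * q ^+ N))^-1)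
     * ((\prod_(k < n) pc (a * q / e * z k) (y k))^-1
        * (\prod_(k < n) pc (a * q / f * z k) (y k))^-1).
  rewrite -!pc_low -!prodfV -!big_split /=; apply: eq_bigr => x _.
  by rewrite [a * q / e * _]mulrAC [a * q / f * _]mulrAC !(invfM (th _)); ring.
have -> : \prod_(x in low) (th (d * q ^+ N / (q * wz x)) * th (b * wz x) * th (c * wz x)
      / th (a * q / d * wz x * wz x))
  = (\prod_(x in low) th (d * q ^+ N / (q * wz x)))
   * (\prod_(k < n) pc (b * z k) (y k) * \prod_(k < n) pc (c * z k) (y k))
   * \prod_(x in low) (th (a * q / d * wz x * wz x))^-1.
  by rewrite -!pc_low -!big_split /=; apply: eq_bigr => x _; ring.
rewrite E5 /summand.
rewrite [X in _ = _ * _ * X * _ * _ * _ * _ * _](_ : _ =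
   (\prod_(j < n) ((pc (a * z j) N * pc (a * q / z j) (N - y j))
        / (pc (a * q ^+ (1 + m j) * z j) N * pc (a * q / (z j * q ^+ m j)) N)))
   * \prod_(j < n) (pc (d / z j) N / pc (d / z j) (N - y j))); last first.
  rewrite -big_split /=; apply: eq_bigr => k _.
  by rewrite [(_ * _ * pc (d / z k) _)^-1]invfM; ring.
rewrite [X in _ = _ * X * _ * _ * _ * _](_ : _ =
   (\prod_(j < n) \prod_(k < n) pc (q ^- m j * z k / z j) (y k))
   * (\prod_(j < n) \prod_(k < n) pc (q ^+ m j * z j * z k) (y k))
   / ((\prod_(j < n) \prod_(k < n) pc (q * z k / z j) (y k))
      * (\prod_(j < n) \prod_(k < n) pc (a * q / d * z j * z k) (y k)))); last first.
  rewrite -!big_split -prodf_div /=; apply: eq_bigr => j _.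
  by rewrite -!big_split -prodf_div.
rewrite [X in _ = _ * X * _ * _ * _](_ : _ =
   (\prod_(j < n) \prod_(k < n | (j < k)%N) pc (a * q / d * z j * z k) (y j + y k))
   / (\prod_(j < n) \prod_(k < n | (j < k)%N) pc (z j * z k) (y j + y k))); last first.
  by rewrite -prodf_div; apply: eq_bigr => j _; rewrite -prodf_div.
rewrite [X in _ = _ * X * _ * _](_ : _ =
   (\prod_(k < n) pc (b * z k) (y k) * \prod_(k < n) pc (c * z k) (y k))
   / (\prod_(k < n) pc (a * q / e * z k) (y k) * \prod_(k < n) pc (a * q / f * z k) (y k)));
  last by rewrite -!big_split -prodf_div.
rewrite [X in _ = X](_ : _ = vdm (fun k => z k * q ^+ y k) / vdm z * q ^+ N
    * ((\prod_(j < n) \prod_(k < n) pc (q ^- m j * z k / z j) (y k))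
       / \prod_(j < n) \prod_(k < n) pc (q * z k / z j) (y k))
  * ((\prod_(j < n) \prod_(k < n) pc (q ^+ m j * z j * z k) (y k))
    / \prod_(j < n) \prod_(k < n | (j < k)%N) pc (z j * z k) (y j + y k))
  * ((\prod_(j < n) \prod_(k < n | (j < k)%N) pc (a * q / d * z j * z k) (y j + y k))
    / \prod_(j < n) \prod_(k < n) pc (a * q / d * z j * z k) (y k))
  * (\prod_(k < n) (th (a * z k * q ^+ (y k + N)) / th (a * z k))
    * \prod_(j < n) ((pc (a * z j) N * pc (a * q / z j) (N - y j))
        / (pc (a * q ^+ (1 + m j) * z j) N * pc (a * q / (z j * q ^+ m j)) N)))
  * (\prod_(j < n) (pc (d / z j) N / pc (d / z j) (N - y j))
  * ((\prod_(k < n) pc (b * z k) (y k) * \prod_(k < n) pc (c * z k) (y k))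
   / (\prod_(k < n) pc (a * q / e * z k) (y k) * \prod_(k < n) pc (a * q / f * z k) (y k)))
  * (pc e N * pc f N / (pc (a * q / b) N * pc (a * q / c) N)))).
  by rewrite -E1 -E2 -E3 -E4 !(invfM (\prod_(k < n) _)); ring.
by rewrite !(invfM (\prod_(j < n) _)); ring.
Qed.

End Block.

Hypothesis th1 : th 1 = 0.

(** If a cell is in S and its predecessor in the progression is not, this pair puts the factor
    [th 1] into [mixed]. So membership descends one step at a time from j to i. *)
Lemma mixed_closed (S : {set cell}) k (i j : 'I_(m k)) :
  mixed th q wz [set: cell] S != 0 -> (i <= j)%N ->
  Tagged (fun k => 'I_(m k)) j \in S -> Tagged (fun k => 'I_(m k)) i \in S.
Proof.
move=> M0; have [d] := ubnP (j - i)%N; elim: d j => // d IH j jid ij jS.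
case: (ltngtP i j) ij => // [lt _|/val_inj -> //].
have ltj : (j.-1 < m k)%N by apply: leq_ltn_trans (leq_pred j) (ltn_ord j).
have j0 : (0 < j)%N by apply: leq_ltn_trans lt.
apply: (IH (Ordinal ltj)) => /=.
- by move: jid lt; clear; lia.
- by rewrite -ltnS prednK.
apply: contraTT M0 => jS'; rewrite negbK /mixed.
rewrite (bigD1 (Tagged (fun k => 'I_(m k)) j)) //=.
rewrite (bigD1 (Tagged (fun k => 'I_(m k)) (Ordinal ltj))) /=; last by rewrite !inE jS'.
rewrite {1}/wz /= {1}/wz /= [q * (z k * _)]mulrCA -exprS prednK // divff ?th1 ?mul0r //.
by rewrite mulf_neq0 ?expf_neq0.
Qed.

Lemma mixed_block_shape (S : {set cell}) : mixed th q wz [set: cell] S != 0 ->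
  exists y : {dffun forall k : 'I_n, 'I_(m k).+1}, S = low (fun k => y k).
Proof.
move=> M0.
(* The length y k is the least index not occupied by S. The index m k qualifies vacuously, whence y
   k <= m k. *)
pose Q k i := [forall j : 'I_(m k), (j == i :> nat) ==> (Tagged (fun k => 'I_(m k)) j \notin S)].
have Qm k : exists i, Q k i.
  exists (m k); apply/forallP => j; apply/implyP => /eqP E.
  by have := ltn_ord j; rewrite E ltnn.
have Qle k : (ex_minn (Qm k) < (m k).+1)%N.
  case: ex_minnP => i _ min_i; rewrite ltnS; apply: min_i.
  apply/forallP => j; apply/implyP => /eqP E.
  by have := ltn_ord j; rewrite E ltnn.
exists [ffun k => Ordinal (Qle k)]; apply/setP => -[k i]; rewrite !inE /= ffunE /=.
case: ex_minnP => y Qy min_y; case: ltnP => [iy|yi].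
  apply: contraLR iy => iS; rewrite -leqNgt; apply: min_y.
  by apply/forallP => j; apply/implyP => /eqP/val_inj ->.
apply: negbTE; have ym : (y < m k)%N by apply: leq_ltn_trans yi (ltn_ord i).
have := forallP Qy (Ordinal ym); rewrite eqxx /=; apply: contra.
exact: (@mixed_closed S k (Ordinal ym) i).
Qed.

Lemma low_inj (y y' : {dffun forall k : 'I_n, 'I_(m k).+1}) :
  low (fun k => y k) = low (fun k => y' k) -> y = y'.
Proof.
move=> E; apply/ffunP => k; apply: val_inj => /=.
have aux (u v : {dffun forall k : 'I_n, 'I_(m k).+1}) :
    low (fun k => u k) = low (fun k => v k) -> (v k <= u k)%N.
  move=> Euv; rewrite leqNgt; apply/negP => lt.
  have um : (u k < m k)%N by apply: leq_trans lt _; rewrite -ltnS ltn_ord.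
  have /setP/(_ (Tagged (fun k => 'I_(m k)) (Ordinal um))) := Euv.
  by rewrite !inE /= ltnn lt.
by apply/eqP; rewrite eqn_leq !aux.
Qed.

Lemma sum_low (F : {set cell} -> K) :
  (forall S, mixed th q wz [set: cell] S = 0 -> F S = 0) ->
  \sum_(S : {set cell} | S \subset [set: cell]) F S
  = \sum_(y : {dffun forall k : 'I_n, 'I_(m k).+1}) F (low (fun k => y k)).
Proof.
move=> F0; pose h (y : {dffun forall k : 'I_n, 'I_(m k).+1}) := low (fun k => y k).
rewrite (bigID (fun S => S \in h @: setT)) /= [X in _ + X]big1 ?addr0; last first.
  move=> S /andP[_ hS]; apply: F0; apply/eqP; apply: contraR hS => /mixed_block_shape[y ->].
  exact: imset_f.
rewrite (eq_bigl (fun S => S \in h @: setT)); last by move=> S; rewrite subsetT.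
rewrite big_imset /=; last by move=> y y' _ _; exact: low_inj.
by apply: eq_bigl => y; rewrite inE.
Qed.

Hypothesis thW : th_three_term th.

(** Excluding all integral powers of q at once covers every shift made in the subset argument, in
    both directions, and remains a countable family of conditions. *)
Definition generic (x : K) := forall i : int, th (x * q ^ i) != 0.

Definition bailey_identity (a b c d e f lam : K) : Prop :=
  \sum_(y : {dffun forall k : 'I_n, 'I_(m k).+1}) summand (fun k => y k) a b c d e f
  = \prod_(k < n)
      (pc (a * q * z k) (m k) * pc (z k / lam) (m k)
         * pc (lam * q / e * z k) (m k) * pc (lam * q / f * z k) (m k)
       / (pc (lam * q * z k) (m k) * pc (z k / a) (m k)
         * pc (a * q / e * z k) (m k) * pc (a * q / f * z k) (m k)))
    * \sum_(y : {dffun forall k : 'I_n, 'I_(m k).+1})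
        summand (fun k => y k) lam (lam * b / a) (lam * c / a) (lam * d / a) e f.

(** The ratios z k / z j are kept apart from the genericity conditions, since a common scaling does
    not change them. Their thetas are nonzero because of the Vandermonde product and of the separate
    condition on q^i z k / z j. *)
Lemma bailey_generic (a b c d e f lam : K) :
  a != 0 -> b != 0 -> c != 0 -> d != 0 -> e != 0 -> f != 0 ->
  lam = a ^+ 2 * q / (b * c * d) -> e * f = lam * a * q ->
  vdm z != 0 ->
  (forall k i, (0 < i <= m k)%N -> forall j, th (q ^+ i * z k / z j) != 0) ->
  (forall k, [/\ generic (lam * z k), generic (a * z k), generic (lam / z k),
     generic (a / z k) & generic (b * z k)]) ->
  (forall k, [/\ generic (d / z k), generic (lam * d / a / z k),
     generic (a * z k / e), generic (a * z k / f) & generic (lam * z k / e)]) ->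
  (forall k, generic (lam * z k / f)) ->
  generic (a / b) -> generic (a / c) ->
  (forall j k, [/\ generic (z j * z k), generic (a / d * z j * z k),
     generic (a ^+ 2 / (c * d) * z j * z k) & generic (a / lam * z j * z k)]) ->
  bailey_identity a b c d e f lam.
Proof.
move=> a0 b0 c0 d0 e0 f0 lamE efE V0 rat gen1 gen2 gen3 gab gac gen4.
rewrite /bailey_identity.
have l0 : lam != 0 by rewrite lamE; nonzero.
have ratio_nz j k : j != k -> th (z k / z j) != 0.
  move=> jk.
  have aux (j' k' : 'I_n) : (j' < k')%N -> th (z k' / z j') != 0.
    move=> lt; move: V0; rewrite /vdm (bigD1 j') //= (bigD1 k') //=.
    by apply: contraNneq => ->; rewrite !(mulr0, mul0r).
  case: (ltngtP j k) => [/aux //|lt|/val_inj E]; last by rewrite E eqxx in jk.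
  by rewrite (th_flip thV) // mulf_neq0 ?oppr_eq0 ?aux //; nonzero.
(* Cancelling the smaller exponent, after an inversion if necessary, leaves a positive power of q
   within the allowed range, or the bare ratio. *)
have gen_rat j k i l : (i <= m k)%N -> (l <= m j)%N ->
    (j != k) || (i != l) -> th (z k * q ^+ i / (z j * q ^+ l)) != 0.
  move=> im lm jkil.
  have Qi := expf_neq0 i q0; have Ql := expf_neq0 l q0.
  case: (ltngtP i l) jkil => [lt _|lt _|-> ].
  - rewrite (th_flip thV); [|nonzero|nonzero]; rewrite mulNr oppr_eq0 mulf_neq0 //.
      by nonzero.
    have -> : z j * q ^+ l / (z k * q ^+ i) = q ^+ (l - i) * z j / z k.
      by rewrite -{1}(subnK (ltnW lt)) exprD; field; nonzero.
    by apply: rat; rewrite subn_gt0 lt (leq_trans (leq_subr _ _)).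
  - have -> : z k * q ^+ i / (z j * q ^+ l) = q ^+ (i - l) * z k / z j.
      by rewrite -{1}(subnK (ltnW lt)) exprD; field; nonzero.
    by apply: rat; rewrite subn_gt0 lt (leq_trans (leq_subr _ _)).
  - rewrite orbF => jk.
    have -> : z k * q ^+ l / (z j * q ^+ l) = z k / z j by field; nonzero.
    exact: ratio_nz.
have wz0 (x : cell) : wz x != 0 by rewrite /wz; nonzero.
have wz_zz (x x' : cell) : x != x' -> th (wz x / wz x') != 0.
  move: x x' => [k i] [j l] neq; rewrite /wz /=; apply: gen_rat; try exact: ltnW.
  case: (eqVneq j k) neq => //= jk; subst j.
  by apply: contraNneq => /val_inj ->.
have gVX x i l : generic x -> th (x * q ^+ i / q ^+ l) != 0.
  move=> /(_ (i%:Z - l%:Z)); rewrite expfzDr // -exprnN -exprnP.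
  by rewrite mulrA.
have gX x i : generic x -> th (x * q ^+ i) != 0.
  by move=> /(gVX _ i 0); rewrite expr0 divr1.
have Qn i := expf_neq0 i q0.
have B := @bailey_subsets K th q th1 thV thW q0 cell lex_cell lex_cell_irr
  lex_cell_total wz wz0 wz_zz _ a b c d e f lam a0 b0 c0 d0 e0 f0 lamE efE
  _ _ _ _ _ _ _ _ _ _ _ _ _ _ [set: cell].
have {}B := B _ _ _ _ _ _ _ _ _ _ _ _ _ _ _.
pose F a' b' c' d' S := core th q lex_cell wz a' e f [set: cell] S
  * inner th q lex_cell wz a' b' c' d' S.
have FE a' b' c' d' : a' != 0 ->
   (forall k, generic (a' * z k)) -> (forall k, generic (a' / z k)) ->
   (forall k, generic (d' / z k)) -> (forall j k, generic (a' / d' * z j * z k)) ->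
   \sum_(S : {set cell} | S \subset [set: cell]) F a' b' c' d' S
   = \sum_(y : {dffun forall k : 'I_n, 'I_(m k).+1}) summand (fun k => y k) a' b' c' d' e f.
  move=> a'0 h1 h2 h3 h4; rewrite sum_low; last first.
    by move=> S M0; rewrite /F /core M0 !(mulr0, mul0r).
  apply: eq_bigr => y _; have ym k : (y k <= m k)%N by rewrite -ltnS.
  apply: low_summand => //.
  - by move=> j k i; apply: gX; case: (gen4 j k).
  - move=> j k; apply: pc_neq0 => i iy.
    have := @rat k i.+1; rewrite (leq_trans iy (ym k)) => /(_ isT j).
    by congr (th _ != 0); rewrite exprS; ring.
  - by move=> k i; apply: gX.
  - move=> k i; have := gVX _ i.+1 (m k) (h2 k); congr (th _ != 0).
    by rewrite exprS; field; nonzero.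
  - by move=> k i; apply: gX.
  - move=> j k i; have := gX _ i.+1 (h4 j k); congr (th _ != 0).
    by rewrite exprS; ring.
have g1 k := gen1 k; have g2 k := gen2 k; have g4 j k := gen4 j k.
rewrite -FE //; first last.
- by move=> j k; case: (g4 j k).
- by move=> k; case: (g2 k).
- by move=> k; case: (g1 k).
- by move=> k; case: (g1 k).
rewrite -FE //; first last.
- move=> j k; case: (g4 j k) => _ + _ _; congr (generic _).
  by field; nonzero.
- by move=> k; case: (g2 k).
- by move=> k; case: (g1 k).
- by move=> k; case: (g1 k).
rewrite /F B.
- congr (_ * _).
  rewrite (prod_full (G := fun k i => th (a * q * z k * q ^+ i) * th (z k / lam * q ^+ i)
    * th (lam * q / e * z k * q ^+ i) * th (lam * q / f * z k * q ^+ i)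
    / (th (lam * q * z k * q ^+ i) * th (z k / a * q ^+ i)
       * th (a * q / e * z k * q ^+ i) * th (a * q / f * z k * q ^+ i)))); last first.
    move=> x; rewrite /prefactor /wz.
    by congr (th _ * th _ * th _ * th _ / (th _ * th _ * th _ * th _)); ring.
  by apply: eq_bigr => k _; rewrite prodf_div !big_split.
- move=> [j u] [k v] i; have [+ _ _ _] := gen4 j k => /(gX _ (u + v + i)%N).
  by congr (th _ != 0); rewrite /wz /= !exprD; ring.
- move=> [k u] i; have [+ _ _ _ _] := gen1 k => /(gX _ (u + i)%N).
  by congr (th _ != 0); rewrite /wz /= exprD; ring.
- move=> [k u] i; have [_ + _ _ _] := gen1 k => /(gX _ (u + i)%N).
  by congr (th _ != 0); rewrite /wz /= exprD; ring.
- move=> [k u] i; have [_ _ + _ _] := gen1 k => /(gVX _ i u).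
  by congr (th _ != 0); rewrite /wz /= invfM; ring.
- move=> [k u]; have [_ _ _ + _] := gen1 k => /(gVX _ 0%N u).
  by congr (th _ != 0); rewrite /wz /= invfM; ring.
- by move=> i; apply: gX.
- by move=> i; apply: gX.
- move=> [k u]; have [_ _ _ _ +] := gen1 k => /(gX _ u).
  by congr (th _ != 0); rewrite /wz /=; ring.
- move=> [j u] [k v]; have [_ + _ _] := gen4 j k => /(gX _ (u + v).+1).
  by congr (th _ != 0); rewrite /wz /= exprS exprD; ring.
- move=> [j u] [k v] i; have [_ _ + _] := gen4 j k => /(gX _ (u + v + i)%N).
  by congr (th _ != 0); rewrite /wz /= !exprD; ring.
- move=> [j u] [k v] i; have [_ _ _ +] := gen4 j k => /(gX _ (u + v + i)%N).
  by congr (th _ != 0); rewrite /wz /= !exprD; ring.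
- move=> [k u]; have [_ _ + _ _] := gen2 k => /(gX _ u.+1).
  by congr (th _ != 0); rewrite /wz /= exprS; ring.
- move=> [k u]; have [_ _ _ + _] := gen2 k => /(gX _ u.+1).
  by congr (th _ != 0); rewrite /wz /= exprS; ring.
- move=> [k u]; have [_ _ _ _ +] := gen2 k => /(gX _ u.+1).
  by congr (th _ != 0); rewrite /wz /= exprS; ring.
- move=> [k u]; have := gX _ u.+1 (gen3 k).
  by congr (th _ != 0); rewrite /wz /= exprS; ring.
Qed.
End Groups.

From mathcomp Require Import all_classical all_reals all_analysis.
From mathcomp Require Import complex.
Import Order.TTheory GRing.Theory Num.Theory numFieldNormedType.Exports.

(** * Limits and infinite products of complex numbers *)

Section ComplexLimits.
Variable R : realType.
Local Notation C := R[i].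
Local Notation Re := (@complex.Re R).
Local Notation Im := (@complex.Im R).
Implicit Types (u v : nat -> C) (l x y : C).

Definition nrm (x : C) : R := ComplexField.Normc.normc x.

Lemma nrmE x : `|x| = (nrm x)%:C%C. Proof. by []. Qed.

(* A wrapper that keeps the filters of the library out of unification. *)
Variant tends u l : Prop :=
  Tends of ((u : nat -> C^o) @ \oo --> (l : C^o))%classic.

Lemma tendsP u l : tends u l <->
  forall e : R, 0 < e -> exists N, forall n, (N <= n)%N -> nrm (l - u n) < e.
Proof.
split.
  move=> [/cvgrPdist_lt H] e e0.
  have e0' : (0 : C) < e%:C%C by rewrite ltcR.
  have [N _ HN] := H _ e0'; exists N => n Nn.
  by have := HN n Nn; rewrite /= nrmE ltcR.
move=> H; constructor; apply/cvgrPdist_lt => e e0.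
have eE : e = (Re e)%:C%C by rewrite RRe_real // gtr0_real.
have [|N HN] := H (Re e); first by rewrite -ltcR -eE.
exists N => // n Nn /=; rewrite eE nrmE ltcR; exact: HN.
Qed.

Lemma tends_lim u l : tends u l -> lim ((u : nat -> C^o) @ \oo)%classic = l.
Proof. by move=> [H]; apply: cvg_lim. Qed.

Lemma tends_uniq u l l' : tends u l -> tends u l' -> l = l'.
Proof. by move=> /tends_lim <- /tends_lim <-. Qed.

Lemma tends_cst l : tends (fun=> l) l.
Proof. by constructor; apply: cvg_cst. Qed.

Lemma tendsD u v l l' : tends u l -> tends v l' -> tends (fun n => u n + v n) (l + l').
Proof. by move=> [H1] [H2]; constructor; exact: (cvgD H1 H2). Qed.

Lemma tendsN u l : tends u l -> tends (fun n => - u n) (- l).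
Proof. by move=> [H1]; constructor; exact: (cvgN H1). Qed.

Lemma tendsM u v l l' : tends u l -> tends v l' -> tends (fun n => u n * v n) (l * l').
Proof. by move=> [H1] [H2]; constructor; exact: (cvgM H1 H2). Qed.

Lemma tendsV u l : l != 0 -> tends u l -> tends (fun n => (u n)^-1) l^-1.
Proof. by move=> H1 [H2]; constructor; exact: (cvgV H1 H2). Qed.

Lemma tends_ext u v l : (forall n, u n = v n) -> tends u l -> tends v l.
Proof. by move=> uv; rewrite (_ : u = v) //; apply: funext. Qed.

Lemma tends_eq u l l' : tends u l -> l = l' -> tends u l'.
Proof. by move=> H <-. Qed.

Lemma tends_sum (I : Type) (s : seq I) (P : pred I) (F : nat -> I -> C) (L : I -> C) :
  (forall i, P i -> tends (F^~ i) (L i)) ->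
  tends (fun n => \sum_(i <- s | P i) F n i) (\sum_(i <- s | P i) L i).
Proof.
move=> H; elim: s => [|i s IH].
  by rewrite big_nil; apply: (tends_ext _ (tends_cst 0)) => n; rewrite big_nil.
rewrite big_cons; case Pi: (P i).
  by apply: (tends_ext _ (tendsD (H i Pi) IH)) => n; rewrite big_cons Pi.
by apply: (tends_ext _ IH) => n; rewrite big_cons Pi.
Qed.

Lemma tends_prod (I : Type) (s : seq I) (P : pred I) (F : nat -> I -> C) (L : I -> C) :
  (forall i, P i -> tends (F^~ i) (L i)) ->
  tends (fun n => \prod_(i <- s | P i) F n i) (\prod_(i <- s | P i) L i).
Proof.
move=> H; elim: s => [|i s IH].
  by rewrite big_nil; apply: (tends_ext _ (tends_cst 1)) => n; rewrite big_nil.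
rewrite big_cons; case Pi: (P i).
  by apply: (tends_ext _ (tendsM (H i Pi) IH)) => n; rewrite big_cons Pi.
by apply: (tends_ext _ IH) => n; rewrite big_cons Pi.
Qed.

Lemma tendsX u l k : tends u l -> tends (fun n => u n ^+ k) (l ^+ k).
Proof.
move=> H; elim: k => [|k IH]; first by rewrite expr0; apply: (tends_ext _ (tends_cst 1)).
by rewrite exprS; apply: (tends_ext _ (tendsM H IH)) => n; rewrite exprS.
Qed.

Lemma nrm_ge0 x : 0 <= nrm x. Proof. by rewrite -lecR -nrmE; exact: normr_ge0. Qed.
Lemma nrmM x y : nrm (x * y) = nrm x * nrm y. Proof. exact: ComplexField.Normc.normcM. Qed.
Lemma nrmN x : nrm (- x) = nrm x. Proof. exact: normcN. Qed.
Lemma nrmD x y : nrm (x + y) <= nrm x + nrm y. Proof. exact: le_normcD. Qed.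
Lemma nrmB x y : nrm (x - y) <= nrm x + nrm y.
Proof. by rewrite -[nrm y]nrmN nrmD. Qed.
Lemma nrm1 : nrm 1 = 1. Proof. exact: ComplexField.Normc.normc1. Qed.
Lemma nrm0 : nrm 0 = 0. Proof. exact: ComplexField.Normc.normc0. Qed.
Lemma nrm_eq0 x : (nrm x == 0) = (x == 0).
Proof.
apply/eqP/eqP => [|->]; [exact: ComplexField.Normc.eq0_normc|exact: nrm0].
Qed.
Lemma nrm_gt0 x : x != 0 -> 0 < nrm x.
Proof. by rewrite lt_def nrm_eq0 nrm_ge0 andbT. Qed.
Lemma nrmV x : nrm x^-1 = (nrm x)^-1. Proof. exact: ComplexField.Normc.normcV. Qed.
Lemma nrmX x k : nrm (x ^+ k) = nrm x ^+ k.
Proof. by elim: k => [|k IH]; rewrite ?nrm1 // !exprS nrmM IH. Qed.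
Lemma nrm_prod (I : Type) (s : seq I) (P : pred I) (F : I -> C) :
  nrm (\prod_(i <- s | P i) F i) = \prod_(i <- s | P i) nrm (F i).
Proof. exact: (big_morph nrm nrmM nrm1). Qed.
Lemma nrm_sum (I : Type) (s : seq I) (P : pred I) (F : I -> C) :
  nrm (\sum_(i <- s | P i) F i) <= \sum_(i <- s | P i) nrm (F i).
Proof.
elim/big_rec2: _ => [|i y x _ H]; first by rewrite nrm0.
by apply: le_trans (nrmD _ _) _; rewrite lerD2l.
Qed.
Lemma nrm_Re x : `|Re x| <= nrm x.
Proof. by rewrite -lecR -nrmE normc_ge_Re. Qed.
Lemma nrm_Im x : `|Im x| <= nrm x.
Proof.
have -> : Im x = - Re (x * 'i%C) by rewrite ReiNIm opprK.
rewrite normrN; apply: le_trans (nrm_Re _) _; rewrite nrmM.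
suff -> : nrm 'i%C = 1 by rewrite mulr1.
by rewrite /nrm /= expr0n expr1n add0r sqrtr1.
Qed.
Lemma nrm_le_ReIm x : nrm x <= `|Re x| + `|Im x|.
Proof.
rewrite [x in nrm x]complexE; apply: le_trans (nrmD _ _) _.
rewrite nrmM (_ : nrm 'i%C = 1) ?mul1r; last by rewrite /nrm /= expr0n expr1n add0r sqrtr1.
by rewrite /nrm /= expr0n /= addr0 addr0 !sqrtr_sqr.
Qed.

Lemma tends_geometric (p : C) : nrm p < 1 -> tends (fun n => p ^+ n) 0.
Proof.
move=> p1; apply/tendsP => e e0.
have /cvgrPdist_lt /(_ e e0)[N _ HN] :
    ((fun n => nrm p ^+ n) @ \oo --> (0 : R))%classic.
  by apply: cvg_expr; rewrite ger0_norm ?nrm_ge0.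
exists N => n Nn; have := HN n Nn.
by rewrite /= !sub0r nrmN normrN nrmX ger0_norm // exprn_ge0 // nrm_ge0.
Qed.

(** Adding the tail B r^n / (1 - r) makes the sequence nonincreasing and subtracting it makes it
    nondecreasing, so monotone convergence applies. *)
Lemma geo_cauchy_real (a : nat -> R) (B r : R) : 0 <= B -> 0 <= r -> r < 1 ->
  (forall n, `|a n.+1 - a n| <= B * r ^+ n) -> exists t : R, (a @ \oo --> t)%classic.
Proof.
move=> B0 r0 r1 Ha.
have r1' : 0 < 1 - r by rewrite subr_gt0.
pose b n := a n + B / (1 - r) * r ^+ n.
pose c n := a n - B / (1 - r) * r ^+ n.
have E n : B / (1 - r) * r ^+ n = B * r ^+ n + B / (1 - r) * r ^+ n.+1.
  rewrite exprS; move: (r ^+ n) => t; field; by rewrite gt_eqF.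
have bdec : nonincreasing_seq b.
  apply/nonincreasing_seqP => n; rewrite /b [X in _ <= _ + X]E addrA lerD2r.
  by have := Ha n; rewrite ler_norml => /andP[_]; rewrite lerBlDl.
have cinc n : c n <= c n.+1.
  rewrite /c [X in _ - X <= _]E opprD addrA lerD2r.
  by have := Ha n; rewrite ler_norml => /andP[+ _]; rewrite lerBrDl.
have c0 n : c 0%N <= c n.
  by elim: n => // n IH; apply: le_trans IH (cinc n).
have cb n : c n <= b n.
  rewrite /c /b lerD2l; apply: (@le_trans _ _ 0); rewrite ?oppr_le0.
    by rewrite mulr_ge0 ?exprn_ge0 // divr_ge0 // ltW.
  by rewrite mulr_ge0 ?exprn_ge0 // divr_ge0 // ltW.
have bcvg : (cvgn b)%classic.
  apply: nonincreasing_is_cvgn => //; exists (c 0%N) => _ [n _ <-].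
  exact: le_trans (c0 n) (cb n).
exists (limn b - B / (1 - r) * 0)%classic.
have -> : a = (fun n => b n - B / (1 - r) * r ^+ n).
  by apply: funext => n; rewrite /b addrK.
apply: cvgB => //; apply: cvgM; first exact: cvg_cst.
by apply: cvg_expr; rewrite ger0_norm.
Qed.

Lemma geo_cauchy u (B r : R) : 0 <= B -> 0 <= r -> r < 1 ->
  (forall n, nrm (u n.+1 - u n) <= B * r ^+ n) -> exists l, tends u l.
Proof.
move=> B0 r0 r1 Hu.
have [x Hx] : exists t : R, ((fun n => Re (u n)) @ \oo --> t)%classic.
  apply: (geo_cauchy_real B0 r0 r1) => n; apply: le_trans (Hu n).
  by apply: le_trans (nrm_Re _); rewrite raddfB.
have [y Hy] : exists t : R, ((fun n => Im (u n)) @ \oo --> t)%classic.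
  apply: (geo_cauchy_real B0 r0 r1) => n; apply: le_trans (Hu n).
  by apply: le_trans (nrm_Im _); rewrite raddfB.
exists (x +i* y)%C; apply/tendsP => e e0.
have e2 : 0 < e / 2 by rewrite divr_gt0.
have /cvgrPdist_lt /(_ _ e2)[N1 _ H1] := Hx.
have /cvgrPdist_lt /(_ _ e2)[N2 _ H2] := Hy.
exists (maxn N1 N2) => n; rewrite geq_max => /andP[n1 n2].
apply: le_lt_trans (nrm_le_ReIm _) _; rewrite !raddfB /= [e]splitr.
by apply: ltrD; [exact: H1|exact: H2].
Qed.

End ComplexLimits.

(** * Products whose factors approach 1 geometrically *)

Section InfiniteProducts.
Variable R : realType.
Local Notation C := R[i].

Lemma geo_sum_le (B r : R) M N : 0 <= B -> 0 <= r -> r < 1 ->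
  \sum_(M <= j < N) B * r ^+ j <= B * r ^+ M / (1 - r).
Proof.
move=> B0 r0 r1; have r1' : 0 < 1 - r by rewrite subr_gt0.
case: (leqP M N) => [MN|/ltnW NM]; last first.
  by rewrite big_geq // divr_ge0 ?mulr_ge0 ?exprn_ge0 // ltW.
apply: (@le_trans _ _ (B * r ^+ M / (1 - r) - B * r ^+ N / (1 - r))); last first.
  by rewrite lerBlDr lerDl divr_ge0 ?mulr_ge0 ?exprn_ge0 // ltW.
elim: N MN => [|N IH].
  by rewrite leqn0 => /eqP ->; rewrite big_geq // subrr.
rewrite leq_eqVlt => /orP[/eqP<-|]; first by rewrite big_geq // subrr.
rewrite ltnS => MN; rewrite big_nat_recr //=.
apply: le_trans (lerD (IH MN) (lexx _)) _.
rewrite le_eqVlt; apply/orP; left; apply/eqP; rewrite exprS.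
by move: (r ^+ M) (r ^+ N) => s t; field; rewrite gt_eqF.
Qed.

Lemma nrm_prod_le (al : nat -> C) (w : nat -> R) M N :
  (forall j, nrm (al j) <= 1 + w j) ->
  nrm (\prod_(M <= j < N) al j) <= expR (\sum_(M <= j < N) w j).
Proof.
move=> H; rewrite nrm_prod expR_sum; apply: ler_prod => j _.
rewrite nrm_ge0 /=; apply: le_trans (H j) _; exact: expR_ge1Dx.
Qed.

Variables (al : nat -> C) (B r : R).
Hypotheses (B0 : 0 <= B) (r0 : 0 <= r) (r1 : r < 1).
Hypothesis al1 : forall j, nrm (al j - 1) <= B * r ^+ j.

Lemma nrm_factor_le j : nrm (al j) <= 1 + B * r ^+ j.
Proof.
rewrite -[al j](subrK 1) addrC; apply: le_trans (nrmD _ _) _.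
by rewrite nrm1 lerD2l.
Qed.

Lemma nrm_partial_le N : nrm (\prod_(0 <= j < N) al j) <= expR (B / (1 - r)).
Proof.
apply: le_trans (nrm_prod_le _ _ nrm_factor_le) _.
by rewrite ler_expR; have := geo_sum_le 0 N B0 r0 r1; rewrite expr0 mulr1.
Qed.

Lemma partial_cvg : exists l, tends (fun N => \prod_(0 <= j < N) al j) l.
Proof.
apply: (geo_cauchy (B := expR (B / (1 - r)) * B) (r := r)) => //.
  by rewrite mulr_ge0 // expR_ge0.
move=> N; rewrite big_nat_recr //= -[X in _ - X]mulr1 -mulrBr nrmM -mulrA.
by apply: ler_pM => //; rewrite ?nrm_ge0 ?nrm_partial_le.
Qed.

(** Once the tail of the deviations from M on is at most 1/2, Weierstrass's inequality, product at
    least 1 minus sum, keeps the product from M on at modulus at least 1/2. The factors before M are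
    finitely many and nonzero. *)
Lemma partial_lim_neq0 l : (forall j, al j != 0) ->
  tends (fun N => \prod_(0 <= j < N) al j) l -> l != 0.
Proof.
move=> al0 Hl; have r1' : 0 < 1 - r by rewrite subr_gt0.
have [M HM] : exists M, B * r ^+ M / (1 - r) <= 1 / 2.
  have H : ((fun n => B * r ^+ n / (1 - r)) @ \oo --> (0 : R))%classic.
    have -> : 0 = B * 0 / (1 - r) by rewrite mulr0 mul0r.
    apply: cvgM; last exact: cvg_cst.
    by apply: cvgM; [exact: cvg_cst | apply: cvg_expr; rewrite ger0_norm].
  have half : (0 : R) < 1 / 2 by rewrite divr_gt0.
  have /cvgrPdist_le /(_ _ half)[N _ HN] := H.
  exists N; have := HN N (leqnn N); rewrite /= sub0r normrN.
  by apply: le_trans; rewrite ler_norm.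
have low n : 1 - \sum_(M <= j < M + n) B * r ^+ j <= nrm (\prod_(M <= j < M + n) al j).
  elim: n => [|n IH]; first by rewrite addn0 !big_geq // nrm1 subr0.
  rewrite addnS !big_nat_recr ?leq_addr //= nrmM.
  set S := \sum_(_ <= j < _) _ in IH *; set w := B * r ^+ (M + n).
  have w0 : 0 <= w by rewrite mulr_ge0 ?exprn_ge0.
  have S0 : 0 <= S by apply: sumr_ge0 => j _; rewrite mulr_ge0 ?exprn_ge0.
  have Sw : S + w <= 1 / 2.
    have := geo_sum_le M (M + n).+1 B0 r0 r1; rewrite big_nat_recr ?leq_addr //= => H.
    exact: le_trans H HM.
  have aw : 1 - w <= nrm (al (M + n)%N).
    rewrite lerBlDr -{1}(@nrm1 R) -{1}(subrK (al (M + n)%N) 1).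
    apply: le_trans (nrmD _ _) _; rewrite addrC lerD2l -nrmN opprB; exact: al1.
  apply: (@le_trans _ _ ((1 - S) * (1 - w))); first by nra.
  by apply: ler_pM => //; lra.
apply/eqP => l0; move: Hl; rewrite l0 => /tendsP Hl.
have PM0 : \prod_(0 <= j < M) al j != 0 by elim/big_rec: _ => [|i x _ x0];
  rewrite ?oner_neq0 // mulf_neq0.
have d0 : 0 < nrm (\prod_(0 <= j < M) al j) / 2 by rewrite divr_gt0 // nrm_gt0.
have [N HN] := Hl _ d0; have := HN (M + N)%N (leq_addl M N).
rewrite sub0r nrmN (big_cat_nat _ (leq_addr N M)) //= nrmM ltNge => /negP; apply.
rewrite ler_wpM2l ?nrm_ge0 //; apply: le_trans (low N).
have := le_trans (geo_sum_le M (M + N) B0 r0 r1) HM; lra.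
Qed.

End InfiniteProducts.

(** The factors are exchanged one at a time. The bound is uniform in N, so it survives in the limit
    and gives the continuity of theta. *)
Lemma partial_lipschitz (R : realType) (al be : nat -> R[i]) (B r L : R) :
  0 <= B -> 0 <= r -> r < 1 -> 0 <= L ->
  (forall j, nrm (al j - 1) <= B * r ^+ j) ->
  (forall j, nrm (be j - 1) <= B * r ^+ j) ->
  (forall j, nrm (al j - be j) <= L * r ^+ j) ->
  forall N, nrm (\prod_(0 <= j < N) al j - \prod_(0 <= j < N) be j)
    <= expR (B / (1 - r)) * (L / (1 - r)).
Proof.
move=> B0 r0 r1 L0 al1 be1 ab N.
have r1' : 0 < 1 - r by rewrite subr_gt0.
apply: (@le_trans _ _ (expR (\sum_(0 <= j < N) B * r ^+ j) * \sum_(0 <= j < N) L * r ^+ j)).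
  elim: N => [|N IH]; first by rewrite !big_geq // subrr nrm0 mulr0.
  rewrite !big_nat_recr //=.
  set A := \prod_(0 <= j < N) al j in IH *; set D := \prod_(0 <= j < N) be j in IH *.
  have -> : A * al N - D * be N = (A - D) * al N + D * (al N - be N) by ring.
  apply: le_trans (nrmD _ _) _; rewrite !nrmM.
  rewrite expRD mulrDr; apply: lerD.
    rewrite mulrAC; apply: ler_pM; rewrite ?nrm_ge0 //.
    by apply: le_trans (nrm_factor_le al1 N) _; exact: expR_ge1Dx.
  apply: ler_pM; rewrite ?nrm_ge0 //.
  apply: le_trans (nrm_prod_le 0 N (nrm_factor_le be1)) _.
  rewrite ler_pMr ?expR_gt0 //; apply: le_trans (expR_ge1Dx _).
  by rewrite lerDl mulr_ge0 ?exprn_ge0.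
apply: ler_pM; rewrite ?expR_ge0 //.
- by apply: sumr_ge0 => j _; rewrite mulr_ge0 ?exprn_ge0.
- by rewrite ler_expR; have := geo_sum_le 0 N B0 r0 r1; rewrite expr0 mulr1.
- by have := geo_sum_le 0 N L0 r0 r1; rewrite expr0 mulr1.
Qed.

(** * The theta function *)

Section Theta.
Variables (R : realType) (p : R[i]).
Hypothesis hp : `|p| < 1.
Local Notation C := R[i].
Local Notation r := (nrm p).

Lemma nrmp_lt1 : r < 1. Proof. by move: hp; rewrite nrmE ltcR. Qed.

Definition theta_fac (x : C) (j : nat) : C := (1 - p ^+ j * x) * (1 - p ^+ j.+1 / x).

Definition theta_part (x : C) (N : nat) : C := \prod_(0 <= j < N) theta_fac x j.

Definition theta_size (x : C) : R := nrm x + nrm x^-1 + 1.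

Lemma theta_size_ge0 x : 0 <= theta_size x.
Proof. by rewrite !addr_ge0 ?nrm_ge0. Qed.

Lemma theta_facE x j : x != 0 ->
  theta_fac x j = 1 + p ^+ j * (p ^+ j.+1 - x - p / x).
Proof. by move=> x0; rewrite /theta_fac exprS; field. Qed.

Lemma theta_fac_close (B : R) x j : x != 0 -> theta_size x <= B ->
  nrm (theta_fac x j - 1) <= B * r ^+ j.
Proof.
move=> x0 xB; have r1 := ltW nrmp_lt1.
rewrite theta_facE // addrC addKr nrmM nrmX mulrC ler_wpM2r ?exprn_ge0 ?nrm_ge0 //.
apply: le_trans (nrmB _ _) _; rewrite nrmM.
apply: le_trans (lerD (nrmB _ _) (lexx _)) _; rewrite nrmX.
apply: le_trans xB; rewrite /theta_size [leRHS]addrC addrA; apply: lerD.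
  by rewrite lerD2r exprn_ile1 // nrm_ge0.
by rewrite ler_piMl // nrm_ge0.
Qed.

Lemma theta_tends x : x != 0 -> tends (theta_part x) (theta p x).
Proof.
move=> x0; have [l Hl] := partial_cvg (theta_size_ge0 x) (nrm_ge0 p) nrmp_lt1
  (fun j => theta_fac_close j x0 (lexx _)).
by rewrite (_ : theta p x = l) //; exact: tends_lim Hl.
Qed.

Lemma theta1 : theta p 1 = 0.
Proof.
apply: (tends_uniq (theta_tends (oner_neq0 _))); apply/tendsP => e e0; exists 1%N => N N0.
rewrite sub0r nrmN /theta_part (big_cat_nat _ N0) //= big_nat1 /theta_fac.
by rewrite expr0 mulr1 subrr !mul0r nrm0.
Qed.

(** The two partial products differ only in their end factors. Cross-multiplication makes the
    induction a polynomial identity. *)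
Lemma theta_part_inv x N : x != 0 ->
  theta_part x^-1 N * ((1 - x) * (1 - p ^+ N / x))
  = theta_part x N * ((1 - x^-1) * (1 - p ^+ N * x)).
Proof.
move=> x0; elim: N => [|N IH].
  by rewrite /theta_part !big_geq // expr0 !mul1r mulrC.
rewrite /theta_part !big_nat_recr //= -!/(theta_part _ _) /theta_fac invrK.
rewrite [LHS](_ : _ = theta_part x^-1 N * ((1 - x) * (1 - p ^+ N / x))
   * ((1 - p ^+ N.+1 * x) * (1 - p ^+ N.+1 / x))); last by ring.
by rewrite IH; ring.
Qed.

Lemma thetaV : th_inversion (theta p).
Proof.
move=> x x0; have [->|x1] := eqVneq x 1; first by rewrite invr1 theta1 mulr0.
have xV0 : x^-1 != 0 by rewrite invr_eq0.
have T (c : C) : tends (fun N => 1 - p ^+ N * c) 1.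
  apply: tends_eq (tendsD (tends_cst 1) (tendsN (tendsM (tends_geometric nrmp_lt1) (tends_cst
    c)))) _.
  by rewrite mul0r subr0.
have H1 := tendsM (theta_tends xV0) (tendsM (tends_cst (1 - x)) (T x^-1)).
have H2 := tendsM (theta_tends x0) (tendsM (tends_cst (1 - x^-1)) (T x)).
have E := tends_uniq H1 (tends_ext (fun N => esym (theta_part_inv N x0)) H2).
have x1' : 1 - x != 0 by rewrite subr_eq0 eq_sym.
apply: (mulIf x1'); move: E; rewrite !mulr1 => ->.
by field.
Qed.

Lemma theta_eq0 x : x != 0 -> theta p x = 0 ->
  exists j : nat, p ^+ j * x = 1 \/ p ^+ j.+1 = x.
Proof.
move=> x0 tx; apply: contrapT => /forallNP H.
have F0 j : theta_fac x j != 0.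
  rewrite /theta_fac mulf_neq0 // subr_eq0 eq_sym; apply/eqP => E.
    by apply: (H j); left.
  by apply: (H j); right; rewrite -[RHS]mul1r -E divfK.
have := partial_lim_neq0 (theta_size_ge0 x) (nrm_ge0 p) nrmp_lt1
  (fun j => theta_fac_close j x0 (lexx _)) F0 (theta_tends x0).
by rewrite tx eqxx.
Qed.

Lemma theta_fac_lip (K : R) x y j : x != 0 -> y != 0 -> 0 <= K ->
  nrm x^-1 <= K -> nrm y^-1 <= K ->
  nrm (theta_fac x j - theta_fac y j) <= (1 + K * K) * nrm (x - y) * r ^+ j.
Proof.
move=> x0 y0 K0 xK yK; rewrite !theta_facE //.
have -> : 1 + p ^+ j * (p ^+ j.+1 - x - p / x) - (1 + p ^+ j * (p ^+ j.+1 - y - p / y))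
  = p ^+ j * ((x - y) * (p * x^-1 * y^-1 - 1)) by field; rewrite x0 y0.
rewrite nrmM nrmX nrmM mulrC ler_wpM2r ?exprn_ge0 ?nrm_ge0 // mulrC.
rewrite ler_wpM2r ?nrm_ge0 //; apply: le_trans (nrmB _ _) _.
rewrite nrm1 addrC lerD2l !nrmM -mulrA.
apply: (@le_trans _ _ (1 * (K * K))); last by rewrite mul1r.
by apply: ler_pM; rewrite ?nrm_ge0 ?mulr_ge0 ?nrm_ge0 ?(ltW nrmp_lt1) // ler_pM ?nrm_ge0.
Qed.

Lemma tends_nrm_le (u : nat -> C) l (B : R) : tends u l ->
  (exists N0, forall N, (N0 <= N)%N -> nrm (u N) <= B) -> nrm l <= B.
Proof.
move=> /tendsP H [N0 HB]; rewrite leNgt; apply/negP => Bl.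
have d0 : 0 < nrm l - B by rewrite subr_gt0.
have [N1 H1] := H _ d0.
have := H1 (maxn N0 N1) (leq_maxr _ _); have := HB (maxn N0 N1) (leq_maxl _ _).
set w := u _ => w1 w2.
have : nrm l <= nrm (l - w) + nrm w by rewrite -{1}(subrK w l) nrmD.
move=> w3; lra.
Qed.

Lemma tends_theta (u : nat -> C) l : l != 0 -> (forall n, u n != 0) -> tends u l ->
  tends (fun n => theta p (u n)) (theta p l).
Proof.
move=> l0 u0 Hu; have uV := tendsV l0 Hu.
have r1' : 0 < 1 - r by rewrite subr_gt0 nrmp_lt1.
(* Eventually u n and its inverse are within 1 of their limits. Then K bounds the moduli of both
   points and of their inverses, B bounds [theta_size] at both, and L is a Lipschitz constant. *)
pose K := nrm l + nrm l^-1 + 1.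
have K0 : 0 <= K by exact: theta_size_ge0.
pose B := K + K + 1.
pose L := expR (B / (1 - r)) * ((1 + K * K) / (1 - r)).
have L0 : 0 < L.
  rewrite mulr_gt0 ?expR_gt0 // divr_gt0 //.
  by rewrite ltr_pwDl // mulr_ge0.
apply/tendsP => e e0.
have [N1 H1] := (tendsP _ _).1 Hu _ (ltr01 : 0 < (1 : R)).
have [N2 H2] := (tendsP _ _).1 uV _ (ltr01 : 0 < (1 : R)).
have eL : 0 < e / (2 * L) by rewrite divr_gt0 // mulr_gt0.
have [N3 H3] := (tendsP _ _).1 Hu _ eL.
exists (maxn N1 (maxn N2 N3)) => n; rewrite !geq_max => /and3P[n1 n2 n3].
have uK : nrm (u n) <= K.
  rewrite -[u n](subKr l); apply: le_trans (nrmB _ _) _; have := ltW (H1 n n1).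
  by rewrite /K => h; have := nrm_ge0 l^-1; lra.
have uVK : nrm (u n)^-1 <= K.
  rewrite -[(u n)^-1](subKr l^-1); apply: le_trans (nrmB _ _) _; have := ltW (H2 n n2).
  by rewrite /K => h; have := nrm_ge0 l; lra.
have lVK : nrm l^-1 <= K by rewrite /K; have := nrm_ge0 l; lra.
have lK : nrm l <= K by rewrite /K; have := nrm_ge0 l^-1; lra.
have B0 : 0 <= B by rewrite /B; lra.
have lip N : nrm (theta_part l N - theta_part (u n) N)
    <= expR (B / (1 - r)) * ((1 + K * K) * nrm (l - u n) / (1 - r)).
  apply: (partial_lipschitz B0 (nrm_ge0 p) nrmp_lt1).
  - by rewrite mulr_ge0 ?nrm_ge0 // addr_ge0 // mulr_ge0.
  - by move=> j; apply: theta_fac_close => //; rewrite /theta_size /B; lra.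
  - by move=> j; apply: theta_fac_close => //; rewrite /theta_size /B; lra.
  - by move=> j; apply: theta_fac_lip.
have T := tendsD (theta_tends l0) (tendsN (theta_tends (u0 n))).
have := tends_nrm_le T (ex_intro _ 0%N (fun N _ => lip N)).
move=> /le_lt_trans; apply.
rewrite [ltLHS](_ : _ = L * nrm (l - u n)); last by rewrite /L; ring.
apply: (@le_lt_trans _ _ (L * (e / (2 * L)))); first by rewrite ler_pM2l // ltW // H3.
rewrite [ltLHS](_ : _ = e / 2); last by field; rewrite gt_eqF.
lra.
Qed.

End Theta.

(** * The three-term relation *)

Section LaurentCoefficients.
Variables (R : realType) (p : R[i]).
Hypothesis hp : `|p| < 1.
Hypothesis p0 : p != 0.
Local Notation C := R[i].
Local Notation r := (nrm p).
Variable Y : C.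

(* With Y = y + y^-1 one has qa j = (1 - p^j y X) (1 - p^j X / y) and
   qb j = (X - p^j y) (X - p^j / y), so that qG N / X ^ (N + N).+1 is a truncation of
   the kernel x |-> theta (x y) theta (x / y) / x. *)
Definition qa (j : nat) : {poly C} := 1 - (p ^+ j * Y) *: 'X + (p ^+ j * p ^+ j) *: 'X^2.
Definition qb (j : nat) : {poly C} := 'X^2 - (p ^+ j * Y) *: 'X + (p ^+ j * p ^+ j)%:P.
Definition qG (N : nat) : {poly C} := qa 0 * \prod_(0 <= j < N) (qa j.+1 * qb j.+1).

Lemma qa_scale j : qa j \Po (p *: 'X) = qa j.+1.
Proof.
rewrite /qa comp_polyD comp_polyB !comp_polyZ comp_polyX comp_Xn_poly -[1]polyC1 comp_polyC.
by rewrite exprZn !scalerA [p ^+ j.+1]exprS; congr (_ - _ *: _ + _ *: _); ring.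
Qed.

Lemma qb_scale j : qb j.+1 \Po (p *: 'X) = p ^+ 2 *: qb j.
Proof.
rewrite /qb comp_polyD comp_polyB !comp_polyZ comp_polyX comp_Xn_poly comp_polyC.
rewrite exprZn !scalerDr scalerN !scalerA.
have -> : p ^+ 2 *: (p ^+ j * p ^+ j)%:P = (p ^+ 2 * (p ^+ j * p ^+ j))%:P.
  by rewrite [RHS]polyCM mul_polyC.
by rewrite [p ^+ j.+1]exprS; congr (_ - _ *: _ + _%:P); ring.
Qed.

Lemma qGS N : qG N.+1 = qG N * (qa N.+1 * qb N.+1).
Proof. by rewrite /qG big_nat_recr //= mulrA. Qed.

(** A finite form of quasi-periodicity under x -> p x: scaling moves each factor to its neighbour,
    so the product changes only at its ends. *)
Lemma qG_scale N : (qG N \Po (p *: 'X)) * qb N = p ^+ (N + N) *: (qG N * qa N.+1).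
Proof.
elim: N => [|N IH].
  rewrite /qG big_geq // mulr1 qa_scale scale1r mulrC; congr (_ * _).
  by rewrite /qa /qb !expr0 !mulr1 !mul1r !scale1r polyC1; ring.
rewrite qGS (comp_polyM (qG N)) (comp_polyM (qa N.+1)) qa_scale qb_scale.
rewrite [LHS](_ : _ = p ^+ 2 *: (((qG N \Po (p *: 'X)) * qb N) * (qa N.+2 * qb N.+1))); last first.
  by rewrite -!scalerAr -!scalerAl; congr (_ *: _); ring.
rewrite IH -scalerAl scalerA -exprD addSn addnS; congr (_ *: _); ring.
Qed.

Lemma coef_scale (F : {poly C}) s : (F \Po (p *: 'X))`_s = p ^+ s * F`_s.
Proof.
rewrite comp_polyE coef_sum.
under eq_bigr => i _ do rewrite exprZn scalerA coefZ coefXn mulr_natr mulrb.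
case: (ltnP s (size F)) => [lt|ge].
  rewrite (bigD1 (Ordinal lt)) //= eqxx big1 ?addr0 1?mulrC // => i.
  by rewrite -val_eqE /= eq_sym => /negbTE ->.
rewrite nth_default // mulr0 big1 // => i _; case: eqP => // E.
by have := ltn_ord i; rewrite -E ltnNge ge.
Qed.

Lemma coef_mulb (F : {poly C}) N s : (F * qb N)`_s.+2
  = F`_s - p ^+ N * Y * F`_s.+1 + p ^+ N * p ^+ N * F`_s.+2.
Proof.
rewrite /qb !mulrDr mulrN -scalerAr !coefD coefN coefZ coefMX coefMXn coefMC /=.
by rewrite !subSS subn0 [F`_s.+2 * _]mulrC.
Qed.

Lemma coef_mula (F : {poly C}) N s : (F * qa N)`_s.+2
  = F`_s.+2 - p ^+ N * Y * F`_s.+1 + p ^+ N * p ^+ N * F`_s.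
Proof.
rewrite /qa !mulrDr mulrN mulr1 -!scalerAr !coefD coefN !coefZ coefMX coefMXn /=.
by rewrite !subSS subn0.
Qed.

Lemma qG_rec N s : let g := (qG N : seq C) in
  p ^+ s * g`_s - p ^+ N * Y * (p ^+ s.+1 * g`_s.+1)
    + p ^+ N * p ^+ N * (p ^+ s.+2 * g`_s.+2)
  = p ^+ (N + N) * (g`_s.+2 - p ^+ N.+1 * Y * g`_s.+1
    + p ^+ N.+1 * p ^+ N.+1 * g`_s).
Proof.
have := congr1 (fun F : {poly C} => F`_s.+2) (qG_scale N).
by rewrite /= coef_mulb coefZ coef_mula !coef_scale.
Qed.

Definition cpos N k : C := (qG N)`_((N + N).+1 + k).
Definition cneg N k : C := (qG N)`_((N + N).+1 - k).

Lemma cpos_rec N k :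
  cpos N k.+2 - p ^+ k.+1 * cpos N k
  = p ^+ N * (p ^+ N * (p ^+ k.+3 * cpos N k.+2 - p ^+ 2 * cpos N k)
       + (p - p ^+ k.+2) * Y * cpos N k.+1).
Proof.
have := qG_rec N ((N + N).+1 + k); cbv zeta; rewrite /cpos !addnS.
have -> : p ^+ ((N + N).+1 + k) = p * (p ^+ N * p ^+ N) * p ^+ k.
  by rewrite addSn exprS !exprD mulrA.
have E1 : p ^+ ((N + N).+1 + k).+1 = p * (p * (p ^+ N * p ^+ N) * p ^+ k).
  by rewrite addSn !exprS !exprD; ring.
have E2 : p ^+ ((N + N).+1 + k).+2 = p * (p * (p * (p ^+ N * p ^+ N) * p ^+ k)).
  by rewrite addSn !exprS !exprD; ring.
rewrite E1 E2 !exprS expr0 exprD.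
move: (_`_(_ + k)) (_`_(_ + k).+1) (_`_(_ + k).+2) => g0 g1 g2.
have QN := expf_neq0 N p0; move: (p ^+ N) QN (p ^+ k) => Q Q0 S E.
apply: (mulfI (mulf_neq0 Q0 Q0)); apply/eqP; rewrite -subr_eq0.
move/eqP: E; rewrite eq_sym -subr_eq0 => /eqP E; rewrite -E; apply/eqP; ring.
Qed.

(** The recursion downwards from the middle degree is the same as upwards. With [cneg0] and [cneg1]
    the coefficients of x^k and x^-k therefore agree in the limit, and two values determine all of
    them. *)
Lemma cneg_rec N k : (k.+2 <= (N + N).+1)%N ->
  cneg N k.+2 - p ^+ k.+1 * cneg N k
  = p ^+ N * (p ^+ N * (p ^+ k.+3 * cneg N k.+2 - p ^+ 2 * cneg N k)
       + (p - p ^+ k.+2) * Y * cneg N k.+1).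
Proof.
move=> kN; have := qG_rec N ((N + N).+1 - k.+2); cbv zeta; rewrite /cneg.
have -> : ((N + N).+1 - k.+1 = ((N + N).+1 - k.+2).+1)%N by lia.
have -> : ((N + N).+1 - k = ((N + N).+1 - k.+2).+2)%N by lia.
have Es : p ^+ N * p ^+ N = p ^+ ((N + N).+1 - k.+2) * (p * p ^+ k).
  by rewrite -exprS -!exprD; congr (_ ^+ _); lia.
rewrite exprD; set s := ((N + N).+1 - k.+2)%N in Es *.
rewrite !exprS expr0.
move: (_`_s) (_`_s.+1) (_`_s.+2) => g0 g1 g2.
have QN := expf_neq0 N p0; have Ss := expf_neq0 s p0; have Pk := expf_neq0 k p0.
move: (p ^+ N) QN (p ^+ k) Pk (p ^+ s) Ss Es => Q Q0 S S0 T T0 Es E.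
apply: (mulfI T0); apply/eqP; rewrite -subr_eq0.
move/eqP: E; rewrite -subr_eq0 => /eqP E.
have {}E : T * (g0 - Q * Y * (p * g1) + Q * Q * (p * (p * g2)))
  - T * (p * S) * (g2 - p * Q * Y * g1 + p * Q * (p * Q) * g0) = 0.
  by rewrite -Es -[RHS]E; ring.
by rewrite -[X in _ == X]E; apply/eqP; ring.
Qed.

Lemma cneg0 N : cneg N 0 = cpos N 0. Proof. by rewrite /cneg /cpos subn0 addn0. Qed.

Lemma cneg1 N : cneg N 1 - cpos N 1
  = p ^+ N * p ^+ N * (p ^+ 2 * cneg N 1 - p ^+ 2 * cpos N 1).
Proof.
have := qG_rec N (N + N); cbv zeta.
have -> : (qG N)`_(N + N) = cneg N 1 by rewrite /cneg subn1.
have -> : (qG N)`_(N + N).+2 = cpos N 1 by rewrite /cpos addn1.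
move: (cneg N 1) (cpos N 1) => g0 g2.
rewrite !exprS !expr0 exprD.
have QN := expf_neq0 N p0; move: (p ^+ N) QN => Q Q0 E.
apply: (mulfI (mulf_neq0 Q0 Q0)); apply/eqP; rewrite -subr_eq0.
by move/eqP: E; rewrite -subr_eq0 => /eqP E; rewrite -E; apply/eqP; ring.
Qed.

(* Majorizing the Laurent series at radius X bounds the coefficients by qcst X / X^k. *)
Definition majorant (F : {poly C}) (P : {poly R}) := forall s, nrm F`_s <= P`_s.

Lemma majorantD F G P Q : majorant F P -> majorant G Q -> majorant (F + G) (P + Q).
Proof. by move=> H1 H2 s; rewrite !coefD (le_trans (nrmD _ _)) // lerD. Qed.

Lemma majorantN F P : majorant F P -> majorant (- F) P.
Proof. by move=> H s; rewrite coefN nrmN. Qed.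

Lemma majorantM F G P Q : majorant F P -> majorant G Q -> majorant (F * G) (P * Q).
Proof.
move=> H1 H2 s; rewrite !coefM; apply: le_trans (nrm_sum _ _ _) _.
by apply: ler_sum => i _; rewrite nrmM ler_pM ?nrm_ge0.
Qed.

Lemma majorantXn c n : majorant (c *: 'X^n) (nrm c *: 'X^n).
Proof.
move=> s; rewrite !coefZ !coefXn nrmM; case: (s == n); rewrite ?nrm1 ?nrm0 //.
Qed.

Lemma majorantC c : majorant c%:P (nrm c)%:P.
Proof. by move=> s; rewrite !coefC; case: (s == 0%N); rewrite ?nrm0. Qed.

Lemma majorant_coef F P (X : R) s : 0 < X -> majorant F P -> nrm F`_s * X ^+ s <= P.[X].
Proof.
move=> X0 H; have P0 i : 0 <= P`_i by apply: le_trans (H i); exact: nrm_ge0.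
apply: (@le_trans _ _ (P`_s * X ^+ s)); first by rewrite ler_wpM2r // exprn_ge0 // ltW.
rewrite horner_coef; case: (ltnP s (size P)) => [lt|ge].
  rewrite (bigD1 (Ordinal lt)) //= lerDl; apply: sumr_ge0 => i _.
  by rewrite mulr_ge0 // exprn_ge0 // ltW.
rewrite nth_default // mul0r; apply: sumr_ge0 => i _.
by rewrite mulr_ge0 // exprn_ge0 // ltW.
Qed.

Definition qA (j : nat) : {poly R} :=
  1 + (r ^+ j * nrm Y) *: 'X^1 + (r ^+ j * r ^+ j) *: 'X^2.
Definition qB (j : nat) : {poly R} :=
  1 *: 'X^2 + (r ^+ j * nrm Y) *: 'X^1 + (r ^+ j * r ^+ j)%:P.

Lemma majorant_qa j : majorant (qa j) (qA j).
Proof.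
apply: majorantD; first apply: majorantD.
- by have := majorantC 1; rewrite nrm1 !polyC1.
- by apply: majorantN; have := majorantXn (p ^+ j * Y) 1; rewrite nrmM nrmX expr1.
- by have := majorantXn (p ^+ j * p ^+ j) 2; rewrite nrmM nrmX.
Qed.

Lemma majorant_qb j : majorant (qb j) (qB j).
Proof.
apply: majorantD; first apply: majorantD.
- by have := majorantXn 1 2; rewrite nrm1 (scale1r ('X^2 : {poly C})).
- by apply: majorantN; have := majorantXn (p ^+ j * Y) 1; rewrite nrmM nrmX expr1.
- by have := majorantC (p ^+ j * p ^+ j); rewrite nrmM nrmX.
Qed.

(** Bounds the majorant at X divided by X^(2 N + 1): the first factor comes from [qA 0], the
    exponentials from the products of the other [qA] and of the [qB], by 1 + t <= exp t. Its
    symmetry under X -> 1 / X gives the negative degrees. *)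
Definition qcst (X : R) : R := (X^-1 + nrm Y + X)
  * (expR ((nrm Y * X + X ^+ 2) / (1 - r)) * expR ((nrm Y / X + X ^- 2) / (1 - r))).

Lemma qcstV (X : R) : 0 < X -> qcst X^-1 = qcst X.
Proof.
move=> X0; have X1 : X != 0 by rewrite gt_eqF.
rewrite /qcst [X in _ * X]mulrC; congr (_ * (expR (_ / _) * expR (_ / _))).
- by rewrite invrK; ring.
- by field.
- by field.
Qed.

Lemma coef_bound (X : R) N s : 0 < X -> nrm (qG N)`_s * X ^+ s <= X ^+ (N + N).+1 * qcst X.
Proof.
move=> X0; have r0 : 0 <= r := nrm_ge0 p; have r1 := nrmp_lt1 hp.
have X1 := ltW X0; have Y0 := nrm_ge0 Y.
have H : majorant (qG N) (qA 0 * \prod_(0 <= j < N) (qA j.+1 * qB j.+1)).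
  elim: N => [|N IH].
    by rewrite /qG !big_geq // !mulr1; exact: majorant_qa.
  rewrite qGS big_nat_recr //= [X in majorant _ X]mulrA; apply: (majorantM IH).
  by apply: majorantM; [exact: majorant_qa | exact: majorant_qb].
apply: le_trans (majorant_coef s X0 H) _.
rewrite hornerM horner_prod.
under eq_bigr => j _ do rewrite hornerM.
have EA j : (qA j).[X] = 1 + r ^+ j * nrm Y * X + r ^+ j * r ^+ j * X ^+ 2.
  by rewrite /qA !hornerE /= ?expr1.
have EB j : (qB j).[X] = X ^+ 2 * (1 + r ^+ j * (nrm Y / X) + r ^+ j * r ^+ j * X ^- 2).
  by rewrite /qB !hornerE /= ?expr1; field; rewrite gt_eqF.
rewrite EA !expr0 !mul1r.
have -> : X ^+ (N + N).+1 * qcst X = (1 + nrm Y * X + X ^+ 2) *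
  (X ^+ (N + N) * (expR ((nrm Y * X + X ^+ 2) / (1 - r))
     * expR ((nrm Y / X + X ^- 2) / (1 - r)))).
  by rewrite /qcst exprS; field; rewrite gt_eqF.
rewrite ler_wpM2l ?addr_ge0 ?mulr_ge0 ?exprn_ge0 //.
under eq_bigr => j _ do rewrite EA EB mulrCA.
rewrite big_split /= prodr_const_nat subn0 -exprM mul2n addnn ler_wpM2l ?exprn_ge0 //.
rewrite big_split /=.
have aux (u v : R) : 0 <= u -> 0 <= v ->
    \prod_(0 <= j < N) (1 + r ^+ j.+1 * u + r ^+ j.+1 * r ^+ j.+1 * v)
    <= expR ((u + v) / (1 - r)).
  move=> u0 v0; have uv0 : 0 <= u + v by rewrite addr_ge0.
  apply: (@le_trans _ _ (expR (\sum_(0 <= j < N) (u + v) * r ^+ j))); last first.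
    by rewrite ler_expR; have := geo_sum_le 0 N uv0 r0 r1; rewrite expr0 mulr1.
  rewrite expR_sum; apply: ler_prod => j _; apply/andP; split.
    by rewrite !addr_ge0 ?mulr_ge0 ?exprn_ge0.
  apply: le_trans (expR_ge1Dx _); rewrite -addrA lerD2l mulrDl.
  have rj : r ^+ j.+1 <= r ^+ j by rewrite exprS ler_piMl ?exprn_ge0 // ltW.
  have rj1 : r ^+ j.+1 <= 1 by rewrite exprn_ile1 // ltW.
  apply: lerD; rewrite mulrC ler_wpM2l //.
  by apply: le_trans rj; rewrite ler_piMl // exprn_ge0.
apply: ler_pM.
- by apply: prodr_ge0 => j _; rewrite !addr_ge0 ?mulr_ge0 ?exprn_ge0.
- by apply: prodr_ge0 => j _; rewrite !addr_ge0 ?mulr_ge0 ?exprn_ge0 ?invr_ge0 ?exprn_ge0.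
- under eq_bigr => j _ do rewrite -[_ * _ * X]mulrA.
  by apply: aux; rewrite ?mulr_ge0 ?exprn_ge0.
- by apply: aux; rewrite ?mulr_ge0 ?invr_ge0 ?exprn_ge0.
Qed.

Lemma cpos_bound (X : R) N k : 0 < X -> nrm (cpos N k) * X ^+ k <= qcst X.
Proof.
move=> X0; have := coef_bound N ((N + N).+1 + k) X0.
by rewrite exprD mulrCA ler_pM2l ?exprn_gt0.
Qed.

Lemma cneg_bound (X : R) N k : 0 < X -> (k <= (N + N).+1)%N -> nrm (cneg N k) * X ^+ k <= qcst X.
Proof.
move=> X0 kN; have XV : 0 < X^-1 by rewrite invr_gt0.
have := coef_bound N ((N + N).+1 - k) XV; rewrite qcstV //.
have -> : X^-1 ^+ ((N + N).+1 - k) = X^-1 ^+ (N + N).+1 * X ^+ k.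
  by rewrite -{2}(subnK kN) exprD -mulrA -exprMn mulVf ?gt_eqF // expr1n mulr1.
by rewrite mulrCA ler_pM2l ?exprn_gt0.
Qed.

(** The solution of the limiting recursion with starting values 1, 1: p to the power floor(k^2 / 4),
    the coefficients of a theta series. *)
Fixpoint pl (k : nat) : C :=
  match k with 0 => 1 | 1 => 1 | (k'.+1 as k1).+1 => p ^+ k1 * pl k' end.

(** The multiplier p^(k+1) has modulus at most 1, so errors are never amplified and each step adds
    at most d. *)
Lemma chain_approx (c : nat -> C) (w0 w1 : C) (e d : R) n : 0 <= e -> 0 <= d ->
  nrm (c 0%N - w0) <= e -> nrm (c 1%N - w1) <= e ->
  (forall k, (k.+2 <= n)%N -> nrm (c k.+2 - p ^+ k.+1 * c k) <= d) ->
  forall k, (k <= n)%N -> nrm (c k - pl k * (if odd k then w1 else w0)) <= e + k%:R * d.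
Proof.
move=> e0 d0 H0 H1 H k.
suff: ((k <= n)%N -> nrm (c k - pl k * (if odd k then w1 else w0)) <= e + k%:R * d) /\
  ((k.+1 <= n)%N -> nrm (c k.+1 - pl k.+1 * (if odd k.+1 then w1 else w0)) <= e + k.+1%:R * d).
  by case.
elim: k => [|k [IH1 IH2]]; first by rewrite /= !mul1r mul0r addr0; split=> // _; rewrite ler_wpDr.
split=> // kn; have {}IH1 := IH1 (ltnW (ltnW kn)).
set w := if odd k then w1 else w0 in IH1.
have -> : c k.+2 - pl k.+2 * (if odd k.+2 then w1 else w0)
   = (c k.+2 - p ^+ k.+1 * c k) + p ^+ k.+1 * (c k - pl k * w).
  by rewrite /= negbK -/w; ring.
apply: le_trans (nrmD _ _) _; rewrite nrmM nrmX.
have r1 := ltW (nrmp_lt1 hp); have r0 := nrm_ge0 p.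
apply: (@le_trans _ _ (d + (e + k%:R * d))).
  apply: lerD; first exact: H.
  by apply: le_trans IH1; rewrite ler_piMl ?nrm_ge0 // exprn_ile1.
by rewrite addrCA lerD2l -[X in X + _]mul1r -mulrDl ler_wpM2r // nat1r ler_nat.
Qed.

Definition base_dev : R := (2 + 2 * nrm Y) * qcst 1.

Lemma qcst_ge0 (X : R) : 0 < X -> 0 <= qcst X.
Proof.
by move=> X0; rewrite !mulr_ge0 ?expR_ge0 // !addr_ge0 ?nrm_ge0 ?invr_ge0 ?ltW.
Qed.

Lemma base_dev_ge0 : 0 <= base_dev.
Proof. by rewrite mulr_ge0 ?qcst_ge0 // addr_ge0 // mulr_ge0 ?nrm_ge0. Qed.

Lemma rec_dev (N k : nat) (c0 c1 c2 : C) :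
  nrm c0 <= qcst 1 -> nrm c1 <= qcst 1 -> nrm c2 <= qcst 1 ->
  nrm (p ^+ N * (p ^+ N * (p ^+ k.+3 * c2 - p ^+ 2 * c0) + (p - p ^+ k.+2) * Y * c1))
  <= base_dev * r ^+ N.
Proof.
move=> H0 H1 H2; have r1 := ltW (nrmp_lt1 hp); have r0 := nrm_ge0 p.
have rn n : r ^+ n <= 1 by rewrite exprn_ile1.
have Q0 := qcst_ge0 (ltr01 : 0 < (1 : R)).
rewrite nrmM nrmX mulrC ler_wpM2r ?exprn_ge0 //.
apply: le_trans (nrmD _ _) _; rewrite /base_dev [leRHS]mulrDl; apply: lerD.
  rewrite nrmM nrmX; apply: (@le_trans _ _ (nrm (p ^+ k.+3 * c2 - p ^+ 2 * c0))).
    by rewrite ler_piMl ?nrm_ge0.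
  apply: le_trans (nrmB _ _) _; rewrite [nrm (_ * c2)]nrmM [nrm (_ * c0)]nrmM !nrmX mulr_natl
    mulr2n; apply: lerD.
    by rewrite -[leRHS]mul1r ler_pM ?exprn_ge0 ?nrm_ge0.
  by rewrite -[leRHS]mul1r ler_pM ?exprn_ge0 ?nrm_ge0.
rewrite !nrmM; apply: ler_pM; rewrite ?mulr_ge0 ?nrm_ge0 //.
rewrite ler_wpM2r ?nrm_ge0 //; apply: le_trans (nrmB _ _) _.
by rewrite nrmX; have := rn k.+2; lra.
Qed.

Lemma cpos_approx N k :
  nrm (cpos N k - pl k * (if odd k then cpos N 1 else cpos N 0))
  <= k.+1%:R * (base_dev * r ^+ N).
Proof.
have D0 : 0 <= base_dev * r ^+ N by rewrite mulr_ge0 ?base_dev_ge0 ?exprn_ge0 ?nrm_ge0.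
have Hb i : nrm (cpos N i) <= qcst 1.
  by have := cpos_bound N i (ltr01 : 0 < (1 : R)); rewrite expr1n mulr1.
have := @chain_approx (cpos N) (cpos N 0) (cpos N 1) 0 (base_dev * r ^+ N) k (lexx _) D0.
rewrite !subrr nrm0 => /(_ (lexx _) (lexx _)) H.
apply: (le_trans (H _ k (leqnn k))).
  by move=> i _; rewrite cpos_rec; apply: rec_dev.
by rewrite add0r ler_wpM2r // ler_nat.
Qed.

Lemma cneg_approx N k : (k <= (N + N).+1)%N ->
  nrm (cneg N k - pl k * (if odd k then cpos N 1 else cpos N 0))
  <= k.+1%:R * (base_dev * r ^+ N).
Proof.
move=> kN.
have D0 : 0 <= base_dev * r ^+ N by rewrite mulr_ge0 ?base_dev_ge0 ?exprn_ge0 ?nrm_ge0.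
have Hb i : (i <= (N + N).+1)%N -> nrm (cneg N i) <= qcst 1.
  by move=> iN; have := cneg_bound (ltr01 : 0 < (1 : R)) iN; rewrite expr1n mulr1.
have Hp i : nrm (cpos N i) <= qcst 1.
  by have := cpos_bound N i (ltr01 : 0 < (1 : R)); rewrite expr1n mulr1.
have r1 := ltW (nrmp_lt1 hp); have r0 := nrm_ge0 p.
have H1 : nrm (cneg N 1 - cpos N 1) <= base_dev * r ^+ N.
  rewrite cneg1 !nrmM !nrmX mulrAC ler_wpM2r ?exprn_ge0 //.
  have Q0 := qcst_ge0 (ltr01 : 0 < (1 : R)).
  apply: (@le_trans _ _ (nrm (p ^+ 2 * cneg N 1 - p ^+ 2 * cpos N 1))).
    by rewrite ler_piMl ?nrm_ge0 // exprn_ile1.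
  apply: le_trans (nrmB _ _) _; rewrite [nrm (_ * cneg N 1)]nrmM [nrm (_ * cpos N 1)]nrmM !nrmX
    /base_dev [leRHS]mulrDl.
  apply: ler_wpDr; first by rewrite mulr_ge0 // mulr_ge0 ?nrm_ge0.
  rewrite mulr_natl mulr2n; apply: lerD; rewrite -[leRHS]mul1r.
    by rewrite ler_pM ?exprn_ge0 ?nrm_ge0 ?exprn_ile1 ?Hb.
  by rewrite ler_pM ?exprn_ge0 ?nrm_ge0 ?exprn_ile1 ?Hp.
have := @chain_approx (cneg N) (cpos N 0) (cpos N 1) (base_dev * r ^+ N)
   (base_dev * r ^+ N) (N + N).+1 D0 D0.
rewrite cneg0 subrr nrm0 => /(_ D0 H1) H.
apply: (le_trans (H _ k kN)).
  move=> i iN; rewrite cneg_rec //; apply: rec_dev; apply: Hb => //.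
  - by rewrite ltnW // ltnW.
  - by rewrite ltnW.
by rewrite -[k.+1%:R]nat1r [leRHS]mulrDl mul1r.
Qed.

Lemma size_qG N : (size (qG N) <= (N + N).+1 + (N + N).+2)%N.
Proof.
have s1 j : (size (qa j) <= 3)%N.
  apply: leq_trans (size_polyD _ _) _; rewrite geq_max; apply/andP; split.
    apply: leq_trans (size_polyD _ _) _; rewrite geq_max size_poly1 size_polyN /=.
    by apply: leq_trans (size_scale_leq _ _) _; rewrite size_polyX.
  by apply: leq_trans (size_scale_leq _ _) _; rewrite size_polyXn.
have s2 j : (size (qb j) <= 3)%N.
  apply: leq_trans (size_polyD _ _) _; rewrite geq_max; apply/andP; split.
    apply: leq_trans (size_polyD _ _) _; rewrite geq_max size_polyXn size_polyN /=.
    by apply: leq_trans (size_scale_leq _ _) _; rewrite size_polyX.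
  by apply: leq_trans (size_polyC_leq1 _) _.
elim: N => [|N IH]; first by rewrite /qG big_geq // mulr1.
rewrite qGS; apply: leq_trans (size_polyMleq _ _) _.
have := size_polyMleq (qa N.+1) (qb N.+1); have := s1 N.+1; have := s2 N.+1; move: IH.
by move: (size (qG N)) (size (qa _)) (size (qb _)) (size (qa N.+1 * qb N.+1 : {poly C})) => A B D
  E; clear; lia.
Qed.

Lemma qG_eval N x : x != 0 -> (qG N).[x] / x ^+ (N + N).+1
  = \sum_(0 <= k < (N + N).+2) cpos N k * x ^+ k
    + \sum_(1 <= k < (N + N).+2) cneg N k * x^-1 ^+ k.
Proof.
move=> x0; rewrite (horner_coef_wide _ (size_qG N)).
rewrite -(big_mkord xpredT (fun i => (qG N)`_i * x ^+ i)).
rewrite (big_cat_nat _ (leq_addr (N + N).+2 (N + N).+1)) //= mulrDl addrC; congr (_ + _).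
  rewrite -{1}[(N + N).+1]add0n big_addn addKn mulr_suml; apply: eq_bigr => i _.
  have X0 := expf_neq0 (N + N).+1 x0.
  by rewrite exprD /cpos addnC mulrA mulfK.
rewrite big_nat_rev /= mulr_suml big_add1; apply: eq_big_nat => i /andP[_ iN].
rewrite add0n exprVn /cneg -mulrA; congr (_ * _).
have X0 := expf_neq0 i.+1 x0; have X1 := expf_neq0 ((N + N).+1 - i.+1) x0.
by rewrite -{2}(subnK iN) exprD; field; rewrite X0 X1.
Qed.

(** Below degree M the coefficients are compared one by one. From M on, the coefficient bound at
    radius 2 K makes the term of degree k at most Q / 2^k, a geometric tail. *)
Lemma truncation (c w : nat -> C) (x : C) (K D Q : R) i0 M L : (i0 <= M)%N -> (M <= L)%N ->
  0 < K -> nrm x <= K -> 0 <= Q ->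
  (forall k, (k < M)%N -> nrm (c k - w k) <= k.+1%:R * D) ->
  (forall k, (k < L)%N -> nrm (c k) * (2 * K) ^+ k <= Q) ->
  nrm (\sum_(i0 <= k < L) c k * x ^+ k - \sum_(i0 <= k < M) w k * x ^+ k)
  <= D * (\sum_(0 <= k < M) k.+1%:R * K ^+ k) + Q * 2 * 2^-1 ^+ M.
Proof.
move=> iM ML K0 xK Q0 H1 H2; rewrite (big_cat_nat iM ML) //= addrAC -sumrB.
apply: le_trans (nrmD _ _) _; apply: lerD.
  apply: le_trans (nrm_sum _ _ _) _; rewrite mulr_sumr.
  have T k : (k < M)%N -> nrm (c k * x ^+ k - w k * x ^+ k) <= D * (k.+1%:R * K ^+ k).
    move=> kM; rewrite -mulrBl nrmM nrmX mulrCA mulrA; apply: ler_pM;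
      rewrite ?nrm_ge0 ?exprn_ge0 ?nrm_ge0 ?H1 //.
    by rewrite lerXn2r ?nnegrE ?nrm_ge0 // ltW.
  rewrite [leRHS](big_cat_nat (leq0n _) iM) //=; apply: ler_wpDl.
    rewrite big_nat; apply: sumr_ge0 => k /andP[_ ki].
    by apply: le_trans (T k (leq_trans ki iM)); exact: nrm_ge0.
  by rewrite !big_nat; apply: ler_sum => k /andP[_ kM]; exact: T.
apply: le_trans (nrm_sum _ _ _) _.
apply: (@le_trans _ _ (\sum_(M <= k < L) Q * 2^-1 ^+ k)); last first.
  have h0 : 0 <= 2^-1 :> R by lra.
  have h1 : 2^-1 < 1 :> R by lra.
  apply: le_trans (geo_sum_le M L Q0 h0 h1) _.
  have -> : 1 - 2^-1 = 2^-1 :> R by lra.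
  by rewrite invrK mulrAC.
rewrite !big_nat; apply: ler_sum => k /andP[_ kL]; rewrite nrmM nrmX.
apply: (@le_trans _ _ (nrm (c k) * (2 * K) ^+ k * 2^-1 ^+ k)); last first.
  by rewrite ler_wpM2r ?exprn_ge0 ?invr_ge0 // H2.
rewrite -mulrA ler_wpM2l ?nrm_ge0 // -exprMn mulrAC divff ?mul1r ?pnatr_eq0 //.
by rewrite lerXn2r ?nnegrE ?nrm_ge0 // ltW.
Qed.

(* The two limit kernels, of even and odd degrees, span the functions even_odd M w0 w1. *)
Definition even_odd M (w0 w1 : C) (x : C) : C :=
  \sum_(0 <= k < M) pl k * (if odd k then w1 else w0) * x ^+ k
  + \sum_(1 <= k < M) pl k * (if odd k then w1 else w0) * x^-1 ^+ k.

Lemma qG_approx (K : R) M N x : 0 < K -> x != 0 -> nrm x <= K -> nrm x^-1 <= K ->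
  (0 < M)%N -> (M <= (N + N).+2)%N ->
  nrm ((qG N).[x] / x ^+ (N + N).+1 - even_odd M (cpos N 0) (cpos N 1) x)
  <= 2 * (base_dev * r ^+ N * (\sum_(0 <= k < M) k.+1%:R * K ^+ k)
          + qcst (2 * K) * 2 * 2^-1 ^+ M).
Proof.
move=> K0 x0 xK xK' M0 MN; have K2 : 0 < 2 * K by rewrite mulr_gt0.
rewrite qG_eval // /even_odd opprD addrACA; apply: le_trans (nrmD _ _) _.
rewrite mulr_natl mulr2n; apply: lerD.
  apply: (truncation (leq0n _) MN K0 xK (qcst_ge0 K2)) => k _.
    exact: cpos_approx.
  exact: cpos_bound.
apply: (truncation M0 MN K0 xK' (qcst_ge0 K2)) => k kM.
  by apply: cneg_approx; rewrite -ltnS (leq_trans kM).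
by apply: cneg_bound.
Qed.

Lemma even_oddE M w0 w1 x :
  even_odd M w0 w1 x = w0 * even_odd M 1 0 x + w1 * even_odd M 0 1 x.
Proof.
rewrite /even_odd !mulrDr addrACA !mulr_sumr -!big_split /=.
by congr (_ + _); apply: eq_bigr => k _; case: (odd k); ring.
Qed.

End LaurentCoefficients.

(** * The kernel as a limit of kernels of rank two *)

Section RankTwo.
Variables (R : realType) (p : R[i]).
Hypothesis hp : `|p| < 1.
Hypothesis p0 : p != 0.
Local Notation C := R[i].

Definition kernel (x y : C) : C := theta p (x * y) * theta p (x / y) / x.

(** The partial products contain [qa j] for j < N but [qb j] for 1 <= j <= N, so one [qa] has to be
    supplied; its value tends to 1. *)
Lemma theta_part_qG x y N : x != 0 -> y != 0 ->
  theta_part p (x * y) N * theta_part p (x / y) N * ((qa p (y + y^-1) N).[x] / x)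
  = (qG p (y + y^-1) N).[x] / x ^+ (N + N).+1.
Proof.
move=> x0 y0; elim: N => [|N IH].
  by rewrite /theta_part /qG !big_geq // !mul1r mulr1 expr1.
rewrite qGS hornerM [(_ * qb _ _ _).[x]]hornerM addSn addnS [x ^+ _]exprS [x ^+ _.+2]exprS.
have -> (g u v X : C) : g * (u * v) / (x * (x * X)) = g / X * (u * v / x ^+ 2).
  by rewrite !invfM; ring.
rewrite -IH /theta_part !big_nat_recr //= -!/(theta_part _ _ _) /theta_fac.
have -> : (qb p (y + y^-1) N.+1).[x] = (x - p ^+ N.+1 * y) * (x - p ^+ N.+1 / y).
  by rewrite /qb !hornerE /=; field.
have -> : (qa p (y + y^-1) N).[x] = (1 - p ^+ N * (x * y)) * (1 - p ^+ N * (x / y)).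
  by rewrite /qa !hornerE /=; field.
by field; rewrite x0 y0.
Qed.

Lemma small_geo (h : C) (B e : R) : nrm h < 1 -> 0 <= B -> 0 < e ->
  exists M0, forall M, (M0 <= M)%N -> B * nrm h ^+ M <= e.
Proof.
move=> h1 B0 e0; have B1 : 0 < B + 1 by lra.
have [M0 H] := (tendsP _ _).1 (tends_geometric h1) _ (divr_gt0 e0 B1).
exists M0 => M /H; rewrite sub0r nrmN nrmX ltr_pdivlMr // => /ltW; apply: le_trans.
by rewrite mulrC ler_wpM2l ?exprn_ge0 ?nrm_ge0 //; lra.
Qed.

Lemma nrm_half : nrm (2^-1 : C) = 2^-1.
Proof.
rewrite nrmV; congr (_^-1); apply: (@complexI R).
by rewrite -nrmE normr_nat rmorph_nat.
Qed.

Lemma kernel_tends x y : x != 0 -> y != 0 ->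
  tends (fun N => (qG p (y + y^-1) N).[x] / x ^+ (N + N).+1) (kernel x y).
Proof.
move=> x0 y0; apply: (tends_ext (fun N => theta_part_qG N x0 y0)).
rewrite /kernel.
have T : tends (fun N => (qa p (y + y^-1) N).[x] / x) x^-1.
  have G := tends_geometric (nrmp_lt1 hp).
  apply: (@tends_ext _ (fun N => (1 - p ^+ N * ((y + y^-1) * x) + p ^+ N * p ^+ N * x ^+ 2) / x)).
    by move=> N; rewrite /qa !hornerE /=; congr (_ / _); ring.
  apply: tends_eq (tendsM (tendsD (tendsD (tends_cst 1) (tendsN (tendsM G (tends_cst _))))
     (tendsM (tendsM G G) (tends_cst _))) (tends_cst _)) _.
  by rewrite !mul0r subr0 addr0 mul1r.
have xy0 : x * y != 0 by rewrite mulf_neq0.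
have xy1 : x / y != 0 by rewrite mulf_neq0 ?invr_eq0.
exact: (tendsM (tendsM (theta_tends hp xy0) (theta_tends hp xy1)) T).
Qed.

(** M is fixed before N: first the tail beyond degree M is made small, then N is taken large enough
    for the coefficients below M. As every large M is allowed, one M serves several y; the functions
    of x are then common to them and only the pair c depends on y. *)
Lemma kernel_rank2 (x : 'I_3 -> C) y (e : R) : (forall i, x i != 0) -> y != 0 -> 0 < e ->
  exists M0, forall M, (M0 <= M)%N -> exists c : C * C, forall i,
   nrm (kernel (x i) y - (c.1 * even_odd p M 1 0 (x i) + c.2 * even_odd p M 0 1 (x i))) < e.
Proof.
move=> x0 y0 e0; set Y := y + y^-1.
pose K := 1 + \sum_i (nrm (x i) + nrm (x i)^-1).
have S0 i : 0 <= nrm (x i) + nrm (x i)^-1 by rewrite addr_ge0 ?nrm_ge0.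
have KS i : nrm (x i) + nrm (x i)^-1 <= K.
  by rewrite /K (bigD1 i) //= addrCA lerDl addr_ge0 // sumr_ge0.
have K0 : 0 < K by rewrite ltr_pwDl // sumr_ge0.
have Q0 : 0 <= qcst p Y (2 * K) * 4 by rewrite mulr_ge0 // qcst_ge0 // mulr_gt0.
have e3 : 0 < e / 4 by lra.
have h1 : nrm (2^-1 : C) < 1 by rewrite nrm_half; lra.
have [M0 HM] := small_geo h1 Q0 e3.
exists M0.+1 => M MM.
pose B := 2 * (base_dev p Y * \sum_(0 <= k < M) k.+1%:R * K ^+ k).
have B0 : 0 <= B.
  rewrite mulr_ge0 // mulr_ge0 ?base_dev_ge0 // sumr_ge0 // => k _.
  by rewrite mulr_ge0 // exprn_ge0 // ltW.
have [N0 HN] := small_geo (nrmp_lt1 hp) B0 e3.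
have HK i := (tendsP _ _).1 (kernel_tends (x0 i) y0) _ e3.
have [NN HNN] := choice HK.
pose N := (maxn M (maxn N0 (\max_i NN i)))%N.
exists (cpos p Y N 0, cpos p Y N 1) => i /=; rewrite -even_oddE.
have Ni : (NN i <= N)%N.
  by rewrite /N !leq_max [X in [|| _, _ | X]](leq_bigmax i) !orbT.
have MN : (M <= (N + N).+2)%N.
  by apply: (@leq_trans N); [exact: leq_maxl|exact: leqW (leqW (leq_addr N N))].
have N0N : (N0 <= N)%N by rewrite /N !leq_max leqnn orbT.
have xK : nrm (x i) <= K by apply: le_trans (KS i); rewrite lerDl nrm_ge0.
have xK' : nrm (x i)^-1 <= K by apply: le_trans (KS i); rewrite lerDr nrm_ge0.
have M1 : (0 < M)%N by exact: leq_trans MM.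
have A := qG_approx hp p0 Y K0 (x0 i) xK xK' M1 MN.
have H1 := HNN i N Ni; have H2 := HM M (ltnW MM); have H3 := HN N N0N.
move: A H1 H2 H3; rewrite -/Y nrm_half /B; set g := _ / _; set E := even_odd _ _ _ _ _.
move=> A H1 H2 H3.
rewrite -(subrK g (kernel _ _)) -addrA; apply: le_lt_trans (nrmD _ _) _.
have -> : e = e / 4 + 3 * (e / 4) by lra.
by apply: ltr_leD => //; apply: le_trans A _; lra.
Qed.

End RankTwo.

(** * Vanishing determinants, the Pfaffian identity and the three-term relation *)

Section ThreeTerm.
Variables (R : realType) (p : R[i]).
Hypothesis hp : `|p| < 1.
Local Notation C := R[i].

Lemma kernel_rank2_seq (x y : 'I_3 -> C) : p != 0 ->
  (forall i, x i != 0) -> (forall j, y j != 0) ->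
  exists u v : nat -> 'I_3 -> C * C, forall i j,
    tends (fun n => (v n j).1 * (u n i).1 + (v n j).2 * (u n i).2) (kernel p (x i) (y j)).
Proof.
move=> p0 x0 y0.
have H (n : nat) : exists uv : ('I_3 -> C * C) * ('I_3 -> C * C), forall i j,
    nrm (kernel p (x i) (y j) - ((uv.2 j).1 * (uv.1 i).1 + (uv.2 j).2 * (uv.1 i).2)) < 2^-1 ^+ n.
  have e0 : 0 < 2^-1 ^+ n :> R by rewrite exprn_gt0 // invr_gt0.
  have [M0 HM] := choice (fun j => kernel_rank2 hp p0 x0 (y0 j) e0).
  have [v Hv] := choice (fun j => HM j (\max_j M0 j)%N (leq_bigmax j)).
  pose u i := (even_odd p (\max_j M0 j)%N 1 0 (x i), even_odd p (\max_j M0 j)%N 0 1 (x i)).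
  by exists (u, v) => i j; exact: Hv.
have [uv Huv] := choice H.
exists (fun n => (uv n).1), (fun n => (uv n).2) => i j; apply/tendsP => e e0.
have h1 : nrm (2^-1 : C) < 1 by rewrite nrm_half; lra.
have [N0 HN] := (tendsP _ _).1 (tends_geometric h1) e e0.
exists N0 => N NN; apply: lt_trans (Huv N i j) _.
by have := HN N NN; rewrite sub0r nrmN nrmX nrm_half.
Qed.

Definition det3 (F : 'I_3 -> 'I_3 -> C) : C :=
  let i := inord 0 in let j := inord 1 in let k := inord 2 in
  F i i * (F j j * F k k - F j k * F k j) - F i j * (F j i * F k k - F j k * F k i)
  + F i k * (F j i * F k j - F j j * F k i).

(** Each approximant is the product of a 3 x 2 and a 2 x 3 matrix, so its determinant vanishes
    identically. *)
Lemma kernel_det3 (x y : 'I_3 -> C) : p != 0 ->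
  (forall i, x i != 0) -> (forall j, y j != 0) ->
  det3 (fun i j => kernel p (x i) (y j)) = 0.
Proof.
move=> p0 x0 y0; have [u [v H]] := kernel_rank2_seq p0 x0 y0.
pose A n i j := (v n j).1 * (u n i).1 + (v n j).2 * (u n i).2.
have E n : det3 (A n) = 0 by rewrite /det3 /A /=; ring.
apply: (tends_uniq (u := fun n => det3 (A n))); last first.
  exact: tends_ext (fun n => esym (E n)) (tends_cst 0).
have T2 i j k l := tendsM (H i j) (H k l).
have T3 i j k l i' j' k' l' := tendsD (T2 i j k l) (tendsN (T2 i' j' k' l')).
by apply: (tendsD (tendsD _ (tendsN _)) _); apply: tendsM (H _ _) (T3 _ _ _ _ _ _ _ _).
Qed.

Lemma kernelC x y : x != 0 -> y != 0 -> kernel p y x = - kernel p x y.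
Proof.
move=> x0 y0; rewrite /kernel [y * x]mulrC.
have xy0 : x / y != 0 by rewrite mulf_neq0 ?invr_eq0.
have := thetaV hp xy0; rewrite invf_div => ->; field; rewrite x0 y0 //.
Qed.

Lemma kernelxx x : x != 0 -> kernel p x x = 0.
Proof. by move=> x0; rewrite /kernel divff // theta1 // mulr0 mul0r. Qed.

(** By antisymmetry the minor with rows a, b, c and columns a, b, d factors as the entry at (a, b)
    times the Pfaffian. *)
Lemma kernel_pfaffian_mul a b c d : p != 0 -> a != 0 -> b != 0 -> c != 0 -> d != 0 ->
  kernel p a b * (kernel p a b * kernel p c d - kernel p a c * kernel p b d
                  + kernel p a d * kernel p b c) = 0.
Proof.
move=> p0 a0 b0 c0 d0.
pose x (i : 'I_3) := [:: a; b; c]`_i; pose y (i : 'I_3) := [:: a; b; d]`_i.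
have x0 i : x i != 0 by case: i => [[|[|[|]]]].
have y0 i : y i != 0 by case: i => [[|[|[|]]]].
have := kernel_det3 p0 x0 y0; rewrite /det3 /x /y !inordK //=.
rewrite !kernelxx // (kernelC a0 b0) (kernelC a0 c0) (kernelC b0 c0) => E.
by rewrite -[RHS]E; ring.
Qed.

Lemma theta_p0 x : p = 0 -> x != 0 -> theta p x = 1 - x.
Proof.
move=> p0 x0; apply: (tends_uniq (theta_tends hp x0)); apply/tendsP => e e0.
exists 1%N => N N1; rewrite (_ : theta_part p x N = 1 - x) ?subrr ?nrm0 //.
case: N N1 => // N _; rewrite /theta_part big_nat_recl // /theta_fac p0 big1 => [|j _].
  by rewrite expr0 mul1r expr1 mul0r subr0 !mulr1.
by rewrite !exprS !mul0r subr0 mulr1.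
Qed.

(** Up to sign the Pfaffian is symmetric in the four points, so the spare factor to be divided out
    may be any of the entries (a, b), (a, c), (a, d). If all three vanish, so does every term. *)
Lemma kernel_pfaffian a b c d : a != 0 -> b != 0 -> c != 0 -> d != 0 ->
  kernel p a b * kernel p c d - kernel p a c * kernel p b d
                  + kernel p a d * kernel p b c = 0.
Proof.
move=> a0 b0 c0 d0; have [p0|p0] := eqVneq p 0.
  by rewrite /kernel !theta_p0 ?mulf_neq0 ?invr_eq0 //; field; rewrite a0 b0 c0 d0.
have [ab|ab] := eqVneq (kernel p a b) 0; last first.
  by apply: (mulfI ab); rewrite mulr0; exact: kernel_pfaffian_mul.
have [ac|ac] := eqVneq (kernel p a c) 0; last first.
  apply: (mulfI ac); rewrite mulr0 -[RHS]oppr0 -(kernel_pfaffian_mul p0 a0 c0 b0 d0).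
  by rewrite (kernelC b0 c0); ring.
have [ad|ad] := eqVneq (kernel p a d) 0; last first.
  apply: (mulfI ad); rewrite mulr0 -(kernel_pfaffian_mul p0 a0 d0 b0 c0).
  by rewrite (kernelC c0 d0) (kernelC b0 d0); ring.
by rewrite ab ac ad; ring.
Qed.

Lemma theta_three_term : th_three_term (theta p).
Proof.
(* With s a square root of D, [hpair] at D, b, x is a multiple of the kernel at b / s and s x; the
   claim becomes the Pfaffian identity for b / s, s x, s u, s v. *)
move=> D b x u v D0 b0 x0 u0 v0; pose s := sqrtc D.
have sD : D = s * s by rewrite -expr2 sqr_sqrtc.
have s0 : s != 0 by apply: contra_neq D0 => s0; rewrite sD s0 mul0r.
have B0 : b / s != 0 by rewrite mulf_neq0 ?invr_eq0.
have [X0 U0 V0] : [/\ s * x != 0, s * u != 0 & s * v != 0] by rewrite !mulf_neq0.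
have k1 w : w != 0 -> hpair (theta p) D b w = - (s * w) * kernel p (b / s) (s * w).
  move=> w0; have W0 : s * w != 0 by rewrite mulf_neq0.
  rewrite (kernelC W0 B0) mulrNN /kernel mulrC divfK // /hpair sD.
  by congr (theta p _ * theta p _); field; rewrite ?s0 ?b0.
have k2 w t : w != 0 -> t != 0 ->
    theta p (D * w * t) * theta p (w / t) = (s * w) * kernel p (s * w) (s * t).
  move=> w0 t0; have W0 : s * w != 0 by rewrite mulf_neq0.
  rewrite /kernel mulrC [RHS]mulrC divfK // sD.
  by rewrite mulrC; congr (theta p _ * theta p _); field; rewrite ?s0 ?t0.
rewrite !k1 // !k2 //; have := kernel_pfaffian B0 X0 U0 V0.
set k1' := kernel p (b / s) _; set k2' := kernel p (s * u) _; set k3' := kernel p (b / s) (s * u).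
set k4 := kernel p (s * x) _; set k5 := kernel p (b / s) (s * v); set k6 := kernel p (s * x) _.
move=> E; rewrite -[RHS](mulr0 (- (s * x) * (s * u))) -E; field; exact: v0.
Qed.

End ThreeTerm.

(** * Generic perturbation and passage to the limit *)

Section CoCountable.
Variables (R : realType) (p q : R[i]).
Hypothesis hp : `|p| < 1.
Hypothesis q0 : q != 0.
Local Notation C := R[i].
Local Open Scope classical_set_scope.

(** This notion of genericity allows countably many conditions to be imposed together and still
    leaves good values of s arbitrarily close to 1. *)
Definition cocountably (P : R -> Prop) : Prop := countable [set s | 0 < s /\ ~ P s].

Lemma cocountably_sub (P Q : R -> Prop) :
  (forall s, 0 < s -> P s -> Q s) -> cocountably P -> cocountably Q.
Proof.
move=> PQ; apply: sub_countable; apply: subset_card_le => s [s0 nQ]; split=> // Ps.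
exact/nQ/PQ.
Qed.

Lemma cocountably_forall (T : countType) (P : T -> R -> Prop) :
  (forall t, cocountably (P t)) -> cocountably (fun s => forall t, P t s).
Proof.
move=> H; apply: sub_countable (bigcup_countable (countableP [set: T]) (fun t _ => H t)).
apply: subset_card_le => s [s0 /existsNP[t nP]]; by exists t.
Qed.

Lemma cocountably_and (P Q : R -> Prop) :
  cocountably P -> cocountably Q -> cocountably (fun s => P s /\ Q s).
Proof.
move=> HP HQ; pose F (b : bool) := if b then P else Q.
apply: (@cocountably_sub (fun s => forall b, F b s)).
  by move=> s _ H; split; [exact: (H true) | exact: (H false)].
by apply: cocountably_forall => -[].
Qed.

Lemma cocountably_and4 (P1 P2 P3 P4 : R -> Prop) :
  cocountably P1 -> cocountably P2 -> cocountably P3 -> cocountably P4 ->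
  cocountably (fun s => [/\ P1 s, P2 s, P3 s & P4 s]).
Proof.
move=> H1 H2 H3 H4.
by apply: cocountably_sub (cocountably_and (cocountably_and H1 H2) (cocountably_and H3 H4)) => s
  _ [[? ?] [? ?]].
Qed.

Lemma cocountably_and5 (P1 P2 P3 P4 P5 : R -> Prop) :
  cocountably P1 -> cocountably P2 -> cocountably P3 -> cocountably P4 -> cocountably P5 ->
  cocountably (fun s => [/\ P1 s, P2 s, P3 s, P4 s & P5 s]).
Proof.
move=> H1 H2 H3 H4 H5.
by apply: cocountably_sub (cocountably_and (cocountably_and4 H1 H2 H3 H4) H5) => s _ [[? ? ? ?] ?].
Qed.

Lemma cocountably_notin (A : set R) : (forall s t, 0 < s -> 0 < t -> A s -> A t -> s = t) ->
  cocountably (fun s => ~ A s).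
Proof.
move=> H; apply: finite_set_countable.
have [[s0 [p0 A0]]|N] := pselect (exists s, 0 < s /\ A s).
  apply: (@sub_finite_set _ _ [set s0]); last exact: finite_set1.
  by move=> s [ps /contrapT As]; exact: H.
rewrite (_ : [set s | _] = set0); first exact: finite_set0.
by rewrite -subset0 => s [ps /contrapT As]; apply: N; exists s.
Qed.

(* By theta_eq0 the modulus of a zero of theta p is an integral power of that of p. *)
Lemma cocountably_theta (f : R -> C) : (forall s, 0 < s -> f s != 0) ->
  (forall s t, 0 < s -> 0 < t -> nrm (f s) = nrm (f t) -> s = t) ->
  cocountably (fun s => theta p (f s) != 0).
Proof.
move=> f0 finj.
have H1 : cocountably (fun s => forall j : nat, ~ (p ^+ j * f s = 1)).
  apply: cocountably_forall => j; apply: cocountably_notin => s t s0 t0 /= Es Et.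
  have pj : p ^+ j != 0 by apply: contra_eq_neq Es => ->; rewrite mul0r eq_sym oner_neq0.
  by apply: finj => //; congr nrm; apply: (mulfI pj); rewrite Es Et.
have H2 : cocountably (fun s => forall j : nat, ~ (p ^+ j.+1 = f s)).
  apply: cocountably_forall => j; apply: cocountably_notin => s t s0 t0 /= Es Et.
  by apply: finj => //; rewrite -Es -Et.
apply: cocountably_sub (cocountably_and H1 H2) => s s0 [N1 N2]; apply/eqP => E.
by have [j [Ej|Ej]] := theta_eq0 hp (f0 s s0) E; [apply: (N1 j) | apply: (N2 j)].
Qed.

Lemma nrm_real (s : R) : nrm (s%:C)%C = `|s|.
Proof. by rewrite /nrm /= expr0n addr0 sqrtr_sqr. Qed.

(** A nonzero exponent of s makes the modulus injective on s > 0, so each zero of theta is met at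
    most once for each power of q. *)
Lemma cocountably_generic (f : R -> C) (al : C) k : al != 0 -> (0 < k)%N ->
  (forall s, 0 < s -> f s = al * (s%:C)%C ^+ k) \/
  (forall s, 0 < s -> f s = al / (s%:C)%C ^+ k) ->
  cocountably (fun s => generic (theta p) q (f s)).
Proof.
move=> al0 k0 fE; apply: cocountably_forall => i.
have qi0 : q ^ i != 0 by rewrite expfz_neq0.
have s0 (s : R) : 0 < s -> (s%:C)%C ^+ k != 0.
  by move=> sp; rewrite expf_neq0 // -(rmorph0 (real_complex R)) (inj_eq (@complexI R)) gt_eqF.
have inj (s t : R) : 0 < s -> 0 < t -> s ^+ k = t ^+ k -> s = t.
  by move=> sp tp; apply: (pexpIrn k0); rewrite nnegrE ltW.
have nE (s : R) : 0 < s -> nrm ((s%:C)%C ^+ k) = s ^+ k.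
  by move=> sp; rewrite nrmX nrm_real gtr0_norm.
have can (u v : C) : nrm (al * u * q ^ i) = nrm (al * v * q ^ i) -> nrm u = nrm v.
  have nal : nrm al != 0 by rewrite nrm_eq0.
  have nqi : nrm (q ^ i) != 0 by rewrite nrm_eq0.
  by move: (q ^ i) nqi => Q nqi; rewrite !nrmM => /(mulIf nqi) /(mulfI nal).
case: fE => fE; apply: cocountably_theta => [s sp|s t sp tp].
- by rewrite fE // !mulf_neq0 ?s0.
- by rewrite (fE s) // (fE t) // => /can; rewrite !nE //; exact: inj.
- by rewrite fE // !mulf_neq0 ?invr_eq0 ?s0.
- by rewrite (fE s) // (fE t) // => /can; rewrite 2!nrmV => /invr_inj; rewrite !nE //; exact: inj.
Qed.

(** The interval from 1 to 1 + 2^-n has positive Lebesgue measure and so is not contained in the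
    countable exceptional set. *)
Lemma cocountably_seq (P : R -> Prop) : cocountably P ->
  exists s : nat -> R, [/\ forall n, 0 < s n, forall n, P (s n) & tends (fun n => (s n)%:C%C) 1].
Proof.
move=> HP.
have H (n : nat) : exists s, 1 < s < 1 + 2^-1 ^+ n /\ P s.
  apply: contrapT => N; have e0 : 0 < 2^-1 ^+ n :> R by rewrite exprn_gt0 // invr_gt0.
  have E := countable_lebesgue_measure0 HP.
  have S : `]1, 1 + 2^-1 ^+ n[ `<=` [set s | 0 < s /\ ~ P s].
    move=> s /= /[!in_itv] /= si; split; first by case/andP: si => s1 _; lra.
    by move=> Ps; apply: N; exists s.
  have M : measurable [set s | 0 < s /\ ~ P s].
    by apply: countable_measurable => // x; exact: measurable_set1.
  have L := lebesgue_measure_itv (R := R) `]1, 1 + 2^-1 ^+ n[%R.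
  have : (lebesgue_measure `]1%R, (1 + 2^-1 ^+ n)%R[%classic
      <= @lebesgue_measure R [set s : R | (0 < s)%R /\ ~ P s])%E.
    by apply: le_measure; rewrite ?inE.
  rewrite [X in (_ <= X)%E]E L /= lte_fin ltrDl e0 -EFinD lee_fin => ?; lra.
have [s Hs] := choice H; exists s; split.
- by move=> n; have [/andP[s1 _] _] := Hs n; lra.
- by move=> n; have [] := Hs n.
apply/tendsP => e e0.
have h1 : nrm (2^-1 : C) < 1 by rewrite nrm_half; lra.
have [N0 HN] := (tendsP _ _).1 (tends_geometric h1) e e0.
exists N0 => n nN; have := HN n nN; rewrite sub0r nrmN nrmX nrm_half; apply: le_lt_trans.
rewrite -(rmorph1 (real_complex R)) -rmorphB nrm_real /= ler_norml.
by have [/andP[s1 s2] _] := Hs n; apply/andP; split; lra.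
Qed.

End CoCountable.

(** * Continuity of the summand in its parameters *)

Section Limit.
Variables (R : realType) (p q : R[i]).
Hypothesis hp : `|p| < 1.
Hypothesis q0 : q != 0.
Local Notation C := R[i].
Local Notation pc := (pc (theta p) q).

(** Theta is known to be continuous only away from 0, so nonvanishing is carried along with
    convergence. *)
Definition tends_unit (u : nat -> C) (l : C) :=
  [/\ tends u l, l != 0 & forall n, u n != 0].

Lemma tends_unit_cst x : x != 0 -> tends_unit (fun=> x) x.
Proof. by split=> //; exact: tends_cst. Qed.

Lemma tends_unitM u v l l' : tends_unit u l -> tends_unit v l' ->
  tends_unit (fun n => u n * v n) (l * l').
Proof.
by move=> [Hu l0 u0] [Hv l0' v0]; split=> [||n]; [exact: tendsM | |]; rewrite mulf_neq0.
Qed.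

Lemma tends_unitV u l : tends_unit u l -> tends_unit (fun n => (u n)^-1) l^-1.
Proof.
by move=> [Hu l0 u0]; split=> [||n]; [exact: tendsV | |]; rewrite invr_eq0.
Qed.

Lemma tends_unitX u l k : tends_unit u l -> tends_unit (fun n => u n ^+ k) (l ^+ k).
Proof.
by move=> [Hu l0 u0]; split=> [||n]; [exact: tendsX | |]; rewrite expf_neq0.
Qed.

Lemma tends_unit_theta u l : tends_unit u l -> tends (fun n => theta p (u n)) (theta p l).
Proof. by move=> [Hu l0 u0]; exact: tends_theta. Qed.

Lemma tends_unit_pc u l k : tends_unit u l -> tends (fun n => pc (u n) k) (pc l k).
Proof.
move=> Hu; apply: tends_prod => i _; apply: tends_unit_theta.
by apply: tends_unitM => //; apply: tends_unitX; exact: tends_unit_cst.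
Qed.

Lemma tends_div (u v : nat -> C) l l' : l' != 0 -> tends u l -> tends v l' ->
  tends (fun n => u n / v n) (l / l').
Proof. by move=> l0 Hu Hv; exact: tendsM Hu (tendsV l0 Hv). Qed.

Variables (n : nat) (m : 'I_n -> nat).

Lemma tends_vdm (Z : nat -> 'I_n -> C) z : (forall k, tends_unit (Z ^~ k) (z k)) ->
  tends (fun i => vdm (theta p) (Z i)) (vdm (theta p) z).
Proof.
move=> HZ; apply: tends_prod => j _; apply: tends_prod => k _.
apply: (tendsM _ (tends_unit_theta _)); first by case: (HZ j).
exact: (tends_unitM (HZ k) (tends_unitV (HZ j))).
Qed.

Variables (A B D E F G : nat -> C) (Z : nat -> 'I_n -> C).
Variables (a b c d e f : C) (z : 'I_n -> C).
Hypotheses (Ha : tends_unit A a) (Hb : tends_unit B b) (Hc : tends_unit D c).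
Hypotheses (Hd : tends_unit E d) (He : tends_unit F e) (Hf : tends_unit G f).
Hypothesis Hz : forall k, tends_unit (Z ^~ k) (z k).

Ltac unit_tac := repeat first
  [ exact: Ha | exact: Hb | exact: Hc | exact: Hd | exact: He | exact: Hf | exact: Hz
  | exact: (tends_unit_cst q0)
  | refine (tends_unitX _ _) | refine (tends_unitV _) | refine (tends_unitM _ _) ].

Lemma tends_summand (y : 'I_n -> nat) : let N := (\sum_k y k)%N in
  vdm (theta p) z != 0 -> (forall k, theta p (a * z k) != 0) ->
  (forall j, pc (a * q ^+ (1 + m j) * z j) N * pc (a * q / (z j * q ^+ m j)) N
         * pc (d / z j) (N - y j) != 0) ->
  (forall j k, pc (q * z k / z j) (y k) * pc (a * q / d * z j * z k) (y k) != 0) ->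
  (forall j k : 'I_n, (j < k)%N -> pc (z j * z k) (y j + y k) != 0) ->
  (forall k, pc (a * q / e * z k) (y k) * pc (a * q / f * z k) (y k) != 0) ->
  pc (a * q / b) N * pc (a * q / c) N != 0 ->
  tends (fun i => summand (theta p) q m (Z i) y (A i) (B i) (D i) (E i) (F i) (G i))
    (summand (theta p) q m z y a b c d e f).
Proof.
move=> N n1 n2 n3 n4 n5 n6 n7; rewrite /summand.
apply: (tendsM _ (tends_cst _)); apply: tendsM; last first.
  by apply: (tends_div n7); apply: tendsM; apply: tends_unit_pc; unit_tac.
apply: tendsM; last first.
  apply: tends_prod => k _; apply: (tends_div (n6 k)).
    by apply: tendsM; apply: tends_unit_pc; unit_tac.
  by apply: tendsM; apply: tends_unit_pc; unit_tac.
apply: tendsM; last first.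
  apply: tends_prod => j _; apply: tends_prod => k jk; apply: (tends_div (n5 j k jk)).
    by apply: tends_unit_pc; unit_tac.
  by apply: tends_unit_pc; unit_tac.
apply: tendsM; last first.
  apply: tends_prod => j _; apply: tends_prod => k _; apply: (tends_div (n4 j k)).
    by apply: tendsM; apply: tends_unit_pc; unit_tac.
  by apply: tendsM; apply: tends_unit_pc; unit_tac.
apply: tendsM; last first.
  apply: tends_prod => j _; apply: (tends_div (n3 j)).
    by apply: tendsM; first apply: tendsM; apply: tends_unit_pc; unit_tac.
  by apply: tendsM; first apply: tendsM; apply: tends_unit_pc; unit_tac.
apply: tendsM.
  by apply: (tends_div n1); apply: tends_vdm => k; unit_tac.
by apply: tends_prod => k _; apply: (tends_div (n2 k)); apply: tends_unit_theta; unit_tac.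
Qed.

End Limit.

Section GenericPerturbation.
Variables (R : realType) (p q : R[i]) (n : nat) (z : 'I_n -> R[i]).
Variables a b c d e f lam : R[i].
Hypotheses (hp : `|p| < 1) (q0 : q != 0) (z0 : forall k, z k != 0).
Hypotheses (a0 : a != 0) (b0 : b != 0) (c0 : c != 0) (d0 : d != 0).
Hypotheses (e0 : e != 0) (f0 : f != 0) (lam0 : lam != 0).

Lemma real_complex_neq0 (s : R) : 0 < s -> (s%:C)%C != 0.
Proof. by move=> sp; rewrite -(rmorph0 (real_complex R)) (inj_eq (@complexI R)) gt_eqF. Qed.

Ltac monomial al k :=
  apply: (@cocountably_generic _ _ _ hp q0 _ al k);
  [ by rewrite ?(mulf_neq0, invr_eq0, expf_neq0)
  | by []
  | let s := fresh in let sp := fresh in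
    first [left; move=> s /real_complex_neq0; move: (s%:C)%C => {}s sp;
           field; rewrite ?(sp, z0, a0, b0, c0, d0, e0, f0, lam0); by []
          |right; move=> s /real_complex_neq0; move: (s%:C)%C => {}s sp;
           field; rewrite ?(sp, z0, a0, b0, c0, d0, e0, f0, lam0); by []] ].

(* The exponents preserve the relations between the parameters, and give a nonzero
   exponent to each of the monomials below. *)
Lemma generic_perturbation :
  cocountably (fun s : R => let S := (s%:C)%C in
    let gen := generic (theta p) q in
    let A := a * S ^+ 10 in let B := b * S in let D := c * S ^+ 2 in let E := d * S ^+ 3 in
    let F := e * S ^+ 10 in let G := f * S ^+ 14 in let L := lam * S ^+ 14 in
    let Z k := z k * S in
    [/\ (forall k, [/\ gen (L * Z k), gen (A * Z k), gen (L / Z k), gen (A / Z k) & gen (B * Z k)]),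
      (forall k, [/\ gen (E / Z k), gen (L * E / A / Z k), gen (A * Z k / F),
                     gen (A * Z k / G) & gen (L * Z k / F)]),
      (forall k, gen (L * Z k / G)),
      gen (A / B) /\ gen (A / D) &
      (forall j k, [/\ gen (Z j * Z k), gen (A / E * Z j * Z k),
         gen (A ^+ 2 / (D * E) * Z j * Z k) & gen (A / L * Z j * Z k)])]).
Proof.
cbv zeta; apply: cocountably_and5.
- apply: cocountably_forall => k; apply: cocountably_and5.
  + monomial (lam * z k) 15%N.
  + monomial (a * z k) 11%N.
  + monomial (lam / z k) 13%N.
  + monomial (a / z k) 9%N.
  + monomial (b * z k) 2%N.
- apply: cocountably_forall => k; apply: cocountably_and5.
  + monomial (d / z k) 2%N.
  + monomial (lam * d / a / z k) 6%N.
  + monomial (a * z k / e) 1%N.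
  + monomial (a * z k / f) 3%N.
  + monomial (lam * z k / e) 5%N.
- by apply: cocountably_forall => k; monomial (lam * z k / f) 1%N.
- apply: cocountably_and.
  + monomial (a / b) 9%N.
  + monomial (a / c) 8%N.
- apply: cocountably_forall => j; apply: cocountably_forall => k; apply: cocountably_and4.
  + monomial (z j * z k) 2%N.
  + monomial (a / d * z j * z k) 9%N.
  + monomial (a ^+ 2 / (c * d) * z j * z k) 17%N.
  + monomial (a / lam * z j * z k) 2%N.
Qed.

End GenericPerturbation.

(** * Passage to the limit in the generic identity *)

Section Final.
Variables (R : realType) (p q : R[i]).
Hypothesis hp : `|p| < 1.
Hypothesis q0 : q != 0.
Local Notation C := R[i].
Local Notation pc := (pc (theta p) q).
Variables (n : nat) (m : 'I_n -> nat).

Definition regular (z : 'I_n -> C) (a b c d e f : C) (y : 'I_n -> nat) : Prop :=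
  let N := (\sum_k y k)%N in
  [/\ (forall j, pc (a * q ^+ (1 + m j) * z j) N * pc (a * q / (z j * q ^+ m j)) N
         * pc (d / z j) (N - y j) != 0),
      (forall j k, pc (q * z k / z j) (y k) * pc (a * q / d * z j * z k) (y k) != 0),
      (forall j k : 'I_n, (j < k)%N -> pc (z j * z k) (y j + y k) != 0),
      (forall k, pc (a * q / e * z k) (y k) * pc (a * q / f * z k) (y k) != 0) &
      pc (a * q / b) N * pc (a * q / c) N != 0].

Lemma bailey_limit (z : 'I_n -> C) (a b c d e f lam : C) :
  a != 0 -> b != 0 -> c != 0 -> d != 0 -> e != 0 -> f != 0 -> (forall k, z k != 0) ->
  lam = a ^+ 2 * q / (b * c * d) -> e * f = lam * a * q ->
  vdm (theta p) z != 0 ->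
  (forall k i, (0 < i <= m k)%N -> forall j, theta p (q ^+ i * z k / z j) != 0) ->
  (forall k, theta p (a * z k) != 0) -> (forall k, theta p (lam * z k) != 0) ->
  (forall y : {dffun forall k : 'I_n, 'I_(m k).+1}, regular z a b c d e f (fun k => y k)) ->
  (forall y : {dffun forall k : 'I_n, 'I_(m k).+1},
     regular z lam (lam * b / a) (lam * c / a) (lam * d / a) e f (fun k => y k)) ->
  (forall k, pc (lam * q * z k) (m k) * pc (z k / a) (m k)
         * pc (a * q / e * z k) (m k) * pc (a * q / f * z k) (m k) != 0) ->
  bailey_identity (theta p) q m z a b c d e f lam.
Proof.
move=> a0 b0 c0 d0 e0 f0 z0 lamE efE vz thz tha thl regL regR pre.
have lam0 : lam != 0 by rewrite lamE ?(mulf_neq0, invr_eq0, expf_neq0).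
have [s [s0 gen sT]] := cocountably_seq (generic_perturbation hp q0 z0 a0 b0 c0 d0 e0 f0 lam0).
pose S i : C := (s i)%:C%C.
have S0 i : S i != 0.
  exact: real_complex_neq0.
have T x k : x != 0 -> tends_unit (fun i => x * S i ^+ k) x.
  move=> x0; split=> // [|i]; last by rewrite mulf_neq0 ?expf_neq0.
  by apply: tends_eq (tendsM (tends_cst x) (tendsX k sT)) _; rewrite expr1n mulr1.
have T1 x : x != 0 -> tends_unit (fun i => x * S i) x.
  move=> x0; split=> // [|i]; last by rewrite mulf_neq0.
  by apply: tends_eq (tendsM (tends_cst x) sT) _; rewrite mulr1.
pose Z i k := z k * S i.
have TZ k : tends_unit (Z ^~ k) (z k) by exact: T1.
have Z0 i k : Z i k != 0 by case: (TZ k).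
have [[[TA TB] TD] TE] := (T a 10%N a0, T1 b b0, T c 2%N c0, T d 3%N d0).
have [[TF TG] TL] := (T e 10%N e0, T f 14%N f0, T lam 14%N lam0).
set A := fun i => a * _ in TA; set B := fun i => b * _ in TB; set D := fun i => c * _ in TD.
set E := fun i => d * _ in TE; set F := fun i => e * _ in TF; set G := fun i => f * _ in TG.
set L := fun i => lam * _ in TL.
have ET i : bailey_identity (theta p) q m (Z i) (A i) (B i) (D i) (E i) (F i) (G i) (L i).
  have [G1 G2 G3 [G4 G5] G6] := gen i.
  apply: (bailey_generic (thetaV hp) q0 (Z0 i) (theta1 hp) (theta_three_term hp)) => //;
    try by rewrite /A /B /D /E /F /G ?mulf_neq0 ?expf_neq0.
  - rewrite /L lamE /A /B /D /E; field; rewrite S0 b0 c0 d0 //.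
  - by rewrite /F /G /L /A; transitivity (e * f * S i ^+ 24); [ring|rewrite efE; ring].
  (* The common factor S i cancels in every ratio, so nonvanishing carries over from z to Z i. *)
  - move: vz; rewrite /vdm => /prodf_neq0 vz; apply/prodf_neq0 => j _.
    have /prodf_neq0 {}vz := vz j isT; apply/prodf_neq0 => k jk.
    have := vz k jk; rewrite /Z -mulf_div divff // mulr1.
    by rewrite !mulf_eq0 !negb_or S0 => /andP[-> ->].
  - by move=> k j kj l; rewrite /Z mulrA -mulf_div divff // mulr1; exact: thz.
pose dft := {dffun forall k : 'I_n, 'I_(m k).+1}.
have TL1 : tends (fun i => \sum_(y : dft)
     summand (theta p) q m (Z i) (fun k => y k) (A i) (B i) (D i) (E i) (F i) (G i))
     (\sum_(y : dft) summand (theta p) q m z (fun k => y k) a b c d e f).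
  apply: tends_sum => y _; have [r1 r2 r3 r4 r5] := regL y.
  exact: (tends_summand hp q0 TA TB TD TE TF TG TZ).
have TR1 : tends (fun i => \sum_(y : dft)
     summand (theta p) q m (Z i) (fun k => y k) (L i) (L i * B i / A i) (L i * D i / A i)
          (L i * E i / A i) (F i) (G i))
     (\sum_(y : dft) summand (theta p) q m z (fun k => y k) lam (lam * b / a) (lam * c / a)
          (lam * d / a) e f).
  apply: tends_sum => y _; have [r1 r2 r3 r4 r5] := regR y.
  exact: (tends_summand hp q0 TL (tends_unitM (tends_unitM TL TB) (tends_unitV TA))
    (tends_unitM (tends_unitM TL TD) (tends_unitV TA))
    (tends_unitM (tends_unitM TL TE) (tends_unitV TA)) TF TG TZ).
apply: (tends_uniq TL1); apply: (tends_ext (fun i => esym (ET i))).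
apply: (tendsM _ TR1); apply: tends_prod => k _; apply: (tends_div (pre k));
  repeat apply: tendsM; apply: (tends_unit_pc hp q0); repeat first
   [ exact: (tends_unit_cst q0) | exact: TA | exact: TL | exact: TF | exact: TG | exact: TZ
   | refine (tends_unitV _) | refine (tends_unitM _ _) ].
Qed.

End Final.

(** * Translation to the notation of the statement *)

Section PochhammerLists.
Variables (R : realType) (p q : R[i]).
Local Notation pc := (pc (theta p) q).

Lemma poch_1 x k : poch p q [:: x] k = pc x k.
Proof. by rewrite /poch big_seq1. Qed.

Lemma poch_2 x y k : poch p q [:: x; y] k = pc x k * pc y k.
Proof. by rewrite /poch big_cons big_seq1. Qed.

Lemma poch_4 x y z w k :
  poch p q [:: x; y; z; w] k = pc x k * pc y k * pc z k * pc w k.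
Proof. by rewrite /poch !big_cons big_nil mulr1 !mulrA. Qed.

Lemma pc_theta_neq0 x k i : pc x k != 0 -> (i < k)%N -> theta p (x * q ^+ i) != 0.
Proof. by rewrite /pc big_mkord => /prodf_neq0 H ik; exact: (H (Ordinal ik)). Qed.

End PochhammerLists.

Theorem corollary8p4 (R : realType) (p q : R[i]) (hp : `|p| < 1) (hq : q != 0)
  (n : nat) (hn : (0 < n)%N) (m : 'I_n -> nat)
  (a b c d e f : R[i]) (z : 'I_n -> R[i])
  (ha : a != 0) (hb : b != 0) (hc : c != 0) (hd : d != 0) (he : e != 0)
  (hf : f != 0) (hz : forall k, z k != 0)
  (hbal : a ^+ 3 * q ^+ 2 = b * c * d * e * f)
  (lam : R[i]) (hlam : lam = a ^+ 2 * q / (b * c * d))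
  (* no denominator vanishes: factors common to both sides *)
  (hDelta : Vandermonde_ell p z != 0)
  (hden : forall y : {dffun forall k : 'I_n, 'I_(m k).+1},
    let N := (\sum_(k < n) y k)%N in
    (forall j k, poch p q [:: q * z k / z j; a * q * z j * z k / d] (y k) != 0)
    /\ (forall j k : 'I_n, (j < k)%N -> poch p q [:: z j * z k] (y j + y k) != 0)
    /\ poch p q [:: a * q / b; a * q / c] N != 0)
  (* no denominator vanishes: left-hand sum *)
  (hthetaL : forall k, theta p (a * z k) != 0)
  (hdenL : forall y : {dffun forall k : 'I_n, 'I_(m k).+1},
    let N := (\sum_(k < n) y k)%N in
    (forall j, poch p q [:: a * q ^+ (1 + m j) * z j;
                            a * q ^ (1 - (m j)%:Z) / z j] N != 0)
    /\ (forall j, poch p q [:: d / z j] (N - y j) != 0)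
    /\ (forall k, poch p q [:: a * q * z k / e; a * q * z k / f] (y k) != 0))
  (* no denominator vanishes: right-hand prefactor *)
  (hpre : forall k, poch p q [:: lam * q * z k; z k / a; a * q * z k / e;
                                 a * q * z k / f] (m k) != 0)
  (* no denominator vanishes: right-hand sum *)
  (hthetaR : forall k, theta p (lam * z k) != 0)
  (hdenR : forall y : {dffun forall k : 'I_n, 'I_(m k).+1},
    let N := (\sum_(k < n) y k)%N in
    (forall j, poch p q [:: lam * q ^+ (1 + m j) * z j;
                            lam * q ^ (1 - (m j)%:Z) / z j] N != 0)
    /\ (forall j, poch p q [:: lam * d / (a * z j)] (N - y j) != 0)
    /\ (forall k, poch p q [:: lam * q * z k / e; lam * q * z k / f] (y k) != 0)) :
  \sum_(y : {dffun forall k : 'I_n, 'I_(m k).+1})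
    (let N := (\sum_(k < n) y k)%N in
      Vandermonde_ell p (fun k => z k * q ^+ y k) / Vandermonde_ell p z
      * (\prod_(k < n) (theta p (a * z k * q ^+ (y k + N)) / theta p (a * z k)))
      * (\prod_(j < n)
          ((poch p q [:: a * z j; d / z j] N * poch p q [:: a * q / z j] (N - y j))
           / (poch p q [:: a * q ^+ (1 + m j) * z j;
                           a * q ^ (1 - (m j)%:Z) / z j] N
              * poch p q [:: d / z j] (N - y j))))
      * (\prod_(j < n) \prod_(k < n)
          (poch p q [:: q ^- m j * z k / z j; q ^+ m j * z j * z k] (y k)
           / poch p q [:: q * z k / z j; a * q * z j * z k / d] (y k)))
      * (\prod_(j < n) \prod_(k < n | (j < k)%N)
          (poch p q [:: a * q * z j * z k / d] (y j + y k)
           / poch p q [:: z j * z k] (y j + y k)))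
      * (\prod_(k < n)
          (poch p q [:: b * z k; c * z k] (y k)
           / poch p q [:: a * q * z k / e; a * q * z k / f] (y k)))
      * (poch p q [:: e; f] N / poch p q [:: a * q / b; a * q / c] N)
      * q ^+ N)
  =
  (\prod_(k < n)
    (poch p q [:: a * q * z k; z k / lam; lam * q * z k / e;
                  lam * q * z k / f] (m k)
     / poch p q [:: lam * q * z k; z k / a; a * q * z k / e;
                    a * q * z k / f] (m k)))
  * \sum_(y : {dffun forall k : 'I_n, 'I_(m k).+1})
    (let N := (\sum_(k < n) y k)%N in
      Vandermonde_ell p (fun k => z k * q ^+ y k) / Vandermonde_ell p z
      * (\prod_(k < n) (theta p (lam * z k * q ^+ (y k + N)) / theta p (lam * z k)))
      * (\prod_(j < n)
          ((poch p q [:: lam * z j; lam * d / (a * z j)] N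
            * poch p q [:: lam * q / z j] (N - y j))
           / (poch p q [:: lam * q ^+ (1 + m j) * z j;
                           lam * q ^ (1 - (m j)%:Z) / z j] N
              * poch p q [:: lam * d / (a * z j)] (N - y j))))
      * (\prod_(j < n) \prod_(k < n)
          (poch p q [:: q ^- m j * z k / z j; q ^+ m j * z j * z k] (y k)
           / poch p q [:: q * z k / z j; a * q * z j * z k / d] (y k)))
      * (\prod_(j < n) \prod_(k < n | (j < k)%N)
          (poch p q [:: a * q * z j * z k / d] (y j + y k)
           / poch p q [:: z j * z k] (y j + y k)))
      * (\prod_(k < n)
          (poch p q [:: lam * b * z k / a; lam * c * z k / a] (y k)
           / poch p q [:: lam * q * z k / e; lam * q * z k / f] (y k)))
      * (poch p q [:: e; f] N / poch p q [:: a * q / b; a * q / c] N)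
      * q ^+ N).

Proof.
have lam0 : lam != 0 by rewrite hlam ?(mulf_neq0, invr_eq0, expf_neq0).
(* After multiplication by b c d this is the balancing condition. *)
have efE : e * f = lam * a * q.
  apply: (mulfI (mulf_neq0 (mulf_neq0 hb hc) hd)); rewrite mulrA -hbal hlam.
  by field; rewrite hb hc hd.
have sh x j : x * q ^ (1 - (m j)%:Z) / z j = x * q / (z j * q ^+ m j).
  rewrite expfzDr // expr1z -invr_expz -exprnP; field.
  by rewrite hz expf_neq0.
have E1 j k : a * q * z j * z k / d = a * q / d * z j * z k by field.
(* As lam q / d' = a q / d, and likewise for b and c by [E4], the two sums share these
   denominators. *)
have E2 j k : a * q / d * z j * z k = lam * q / (lam * d / a) * z j * z k.
  by field; rewrite hd ha lam0.
have E3 x y k : x * q * z k / y = x * q / y * z k by rewrite mulrAC.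
have E4 x : x != 0 -> a * q / x = lam * q / (lam * x / a).
  by move=> x0; field; rewrite x0 ha lam0.
have E5 x k : lam * x * z k / a = lam * x / a * z k by rewrite mulrAC.
have E6 j : lam * d / (a * z j) = lam * d / a / z j by rewrite invfM mulrA.
have regL (y : {dffun forall k : 'I_n, 'I_(m k).+1}) : regular p q m z a b c d e f (fun k => y k).
  have [D1 [D2 D3]] := hden y; have [L1 [L2 L3]] := hdenL y.
  split.
  - move=> j; have := L1 j; have := L2 j; rewrite poch_1 poch_2 sh => n1 n2.
    by rewrite mulf_neq0.
  - by move=> j k; have := D1 j k; rewrite poch_2 E1.
  - by move=> j k jk; have := D2 j k jk; rewrite poch_1.
  - by move=> k; have := L3 k; rewrite poch_2 !E3.
  - by have := D3; rewrite poch_2.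
have regR (y : {dffun forall k : 'I_n, 'I_(m k).+1}) :
    regular p q m z lam (lam * b / a) (lam * c / a) (lam * d / a) e f (fun k => y k).
  have [D1 [D2 D3]] := hden y; have [L1 [L2 L3]] := hdenR y.
  split.
  - move=> j; have := L1 j; have := L2 j; rewrite poch_1 poch_2 sh E6 => n1 n2.
    by rewrite mulf_neq0.
  - by move=> j k; have := D1 j k; rewrite poch_2 E1 E2.
  - by move=> j k jk; have := D2 j k jk; rewrite poch_1.
  - by move=> k; have := L3 k; rewrite poch_2 !E3.
  - by have := D3; rewrite poch_2 (E4 b) // (E4 c).
(* At the top index y = m the symbol (q z k / z j)_(m k) contains all these thetas as factors. *)
have thz k i : (0 < i <= m k)%N -> forall j, theta p (q ^+ i * z k / z j) != 0.
  case: i => // i /= im j; pose y : {dffun forall k : 'I_n, 'I_(m k).+1} := [ffun k => ord_max].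
  have [D1 _] := hden y; have := D1 j k; rewrite poch_2 mulf_eq0 negb_or ffunE => /andP[+ _].
  move=> /pc_theta_neq0 /(_ im); congr (theta p _ != 0); rewrite exprS; ring.
have pre k : pc (theta p) q (lam * q * z k) (m k) * pc (theta p) q (z k / a) (m k)
    * pc (theta p) q (a * q / e * z k) (m k) * pc (theta p) q (a * q / f * z k) (m k) != 0.
  by have := hpre k; rewrite poch_4 !E3.
have main := bailey_limit hp hq ha hb hc hd he hf hz hlam efE hDelta thz hthetaL hthetaR
  regL regR pre.
transitivity (\sum_(y : {dffun forall k : 'I_n, 'I_(m k).+1})
     summand (theta p) q m z (fun k => y k) a b c d e f).
  apply: eq_bigr => y _; rewrite /summand; set N := (\sum_k _)%N.
  congr (_ * _ * _ * _ * _ * _ * _ * _).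
  - by apply: eq_bigr => j _; rewrite !poch_1 !poch_2 sh.
  - by apply: eq_bigr => j _; apply: eq_bigr => k _; rewrite !poch_2 E1.
  - by apply: eq_bigr => j _; apply: eq_bigr => k _; rewrite !poch_1 E1.
  - by apply: eq_bigr => k _; rewrite !poch_2 !E3.
  - by rewrite !poch_2.
rewrite main; congr (_ * _).
  by apply: eq_bigr => k _; rewrite !poch_4 !E3.
apply: eq_bigr => y _; rewrite /summand; set N := (\sum_k _)%N.
congr (_ * _ * _ * _ * _ * _ * _ * _).
- by apply: eq_bigr => j _; rewrite !poch_1 !poch_2 sh E6.
- by apply: eq_bigr => j _; apply: eq_bigr => k _; rewrite !poch_2 E1 E2.
- by apply: eq_bigr => j _; apply: eq_bigr => k _; rewrite !poch_1 E1 E2.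
- by apply: eq_bigr => k _; rewrite !poch_2 !E3 !E5.
- by rewrite !poch_2 (E4 b) // (E4 c).
Qed.
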